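(* Let $E$ be a Bryant surface end with Bryant representation $F=\begin{pmatrix}A&B\\C&D\end{pmatrix}$ (defined on the universal cover of $\Omega^*$). Put $\varphi_0=4\pi\operatorname{Res}(D\,dC-C\,dD)$, $\varphi_1=4\pi\operatorname{Res}(C\,dB-D\,dA)$, $\varphi_2=4\pi\operatorname{Res}(B\,dA-A\,dB)$. Let $\mathcal C$ and $\mathcal D$ be two distinct points of $\overline{\mathbb C}$ and let $Y$ be the Killing field associated to the translation along the geodesic $(\mathcal C,\mathcal D)$. Then the flux of $Y$ through $E$ is $$\varphi=\operatorname{Re}\left(\frac{\varphi_2\,\mathcal C\mathcal D+\varphi_1(\mathcal C+\mathcal D)+\varphi_0}{\mathcal C-\mathcal D}\right).$$
   Context: Hyperbolic space is $\mathbb H^3=\{(\zeta,w)\in\mathbb C\times\mathbb R: w>0\}$, $\zeta=u+iv$, with metric $\langle\cdot,\cdot\rangle=(|d\zeta|^2+dw^2)/w^2$ and orientation $du\wedge dv\wedge dw$; its asymptotic boundary is identified with $\overline{\mathbb C}=\mathbb C\cup\{\infty\}$. For distinct $\mathcal A,\mathcal B\in\overline{\mathbb C}$, $(\mathcal A,\mathcal B)$ is the oriented geodesic from $\mathcal A$ to $\mathcal B$. A Bryant surface is a surface of constant mean curvature $1$ in $\mathbb H^3$ (mean curvature $=$ half the trace of the second fundamental form). $\Omega$ is a neighbourhood of $0$ in $\mathbb C$ and $\Omega^*=\Omega\setminus\{0\}$. A Bryant surface end $E$ is given by a conformal immersion $X=(\zeta,w):\Omega^*\to\mathbb H^3$ of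 constant mean curvature $1$ (the puncture $0$ corresponding to the end), the orientation induced by $X$ being the one induced by the mean curvature vector $\vec H$. A Bryant representation of $E$ is a holomorphic map $F=\begin{pmatrix}A&B\\C&D\end{pmatrix}$ from the universal cover of $\Omega^*$ to $\mathrm{SL}_2(\mathbb C)$ with $dA\,dD-dB\,dC=0$ and $\zeta=\frac{\bar A C+\bar B D}{|A|^2+|B|^2}$, $w=\frac1{|A|^2+|B|^2}$. The one-forms $B\,dA-A\,dB$, $C\,dB-D\,dA$, $D\,dC-C\,dD$ are single-valued holomorphic on $\Omega^*$; $\operatorname{Res}$ denotes the residue at $0$, i.e. $\frac1{2\pi i}$ times the integral over a small positively oriented loop around $0$. Killing field of a translation: if $\Phi_t$ is the translation of (signed) distance $t$ along $(\mathcal A,\mathcal B)$, the associated Killing field $Y$ is defined by $\frac{d\Phi_t}{dt}=Y(\Phi_t)$ (for $(0,\infty)$, $Y(\zeta,w)=(\zeta,w)$). Flux of a Killing field $Y$ through $E$: $\varphi=\int_\Gamma\langle\eta,Y\rangle-2\int_K\langle\nu,Y\rangle$, where $\Gamma$ is a generator of $\pi_1(E)$, $K$ a topological disk with boundary $\Gamma$, $\eta$ the unit conormal to $\Gamma$ pointing towards the asymptotic boundary of the end; $\Gamma$ is oriented so that $(\Gamma,\eta,-\vec H)$ is positively oriented, and $\nu$ is the unit normal to $K$ inducing this same orientation on $\Gamma$. It does not depend on the choices of $\Gamma$ and $K$. Convention: when $\mathcal C$ or $\mathcal D$ is $\infty$ the fraction is understood as its limit, i.e. $\varphi_2\mathcal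 D+\varphi_1$ if $\mathcal C=\infty$ and $-(\varphi_2\mathcal C+\varphi_1)$ if $\mathcal D=\infty$. *)

(* Defs.v *)
From Stdlib Require Import Reals.
From Coquelicot Require Import Coquelicot.

Open Scope R_scope.

(** * The upper half-space model *)

(* A point (zeta, w), zeta = u + i v; tangent vectors are written in the same
   coordinates. *)
Definition point : Type := (C * R)%type.
Definition cu (p : point) : R := Re (fst p).
Definition cv (p : point) : R := Im (fst p).
Definition cw (p : point) : R := snd p.

Definition H3 (p : point) : Prop := 0 < cw p.

Definition vscal (l : R) (a : point) : point :=
  ((l * cu a, l * cv a), l * cw a).
Definition vadd (a b : point) : point :=
  ((cu a + cu b, cv a + cv b), cw a + cw b).

Definition edot (a b : point) : R := cu a * cu b + cv a * cv b + cw a * cw b.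

Definition hdot (p a b : point) : R := edot a b / (cw p) ^ 2.
Definition hnorm (p a : point) : R := sqrt (hdot p a a).

Definition cross (a b : point) : point :=
  ((cv a * cw b - cw a * cv b, cw a * cu b - cu a * cw b),
   cu a * cv b - cv a * cu b).

(* (a, b, c) is positively oriented for du /\ dv /\ dw iff 0 < det3 a b c. *)
Definition det3 (a b c : point) : R := edot (cross a b) c.

(** * Maps from a plane domain to the half-space *)

Definition dx (g : C -> R) (z : C) : R := Derive (fun x => g (x, Im z)) (Re z).
Definition dy (g : C -> R) (z : C) : R := Derive (fun y => g (Re z, y)) (Im z).

Definition C1_on (S : C -> Prop) (g : C -> R) : Prop :=
  forall z, S z ->
    ex_derive (fun x => g (x, Im z)) (Re z) /\
    ex_derive (fun y => g (Re z, y)) (Im z) /\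
    continuous (dx g) z /\ continuous (dy g) z.

Definition C2_on (S : C -> Prop) (g : C -> R) : Prop :=
  C1_on S g /\ C1_on S (dx g) /\ C1_on S (dy g).

Definition C2_map (S : C -> Prop) (f : C -> point) : Prop :=
  C2_on S (fun z => cu (f z)) /\ C2_on S (fun z => cv (f z)) /\
  C2_on S (fun z => cw (f z)).

Definition Dx (f : C -> point) (z : C) : point :=
  ((dx (fun z => cu (f z)) z, dx (fun z => cv (f z)) z), dx (fun z => cw (f z)) z).
Definition Dy (f : C -> point) (z : C) : point :=
  ((dy (fun z => cu (f z)) z, dy (fun z => cv (f z)) z), dy (fun z => cw (f z)) z).

Definition immersive (f : C -> point) (z : C) : Prop :=
  cross (Dx f z) (Dy f z) <> ((0, 0), 0).

Definition conformal (f : C -> point) (z : C) : Prop :=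
  hdot (f z) (Dx f z) (Dx f z) = hdot (f z) (Dy f z) (Dy f z) /\
  hdot (f z) (Dx f z) (Dy f z) = 0.

Definition area_density (f : C -> point) (z : C) : R :=
  sqrt (hdot (f z) (Dx f z) (Dx f z) * hdot (f z) (Dy f z) (Dy f z)
        - hdot (f z) (Dx f z) (Dy f z) ^ 2).

(** * Mean curvature *)

(* Levi-Civita covariant derivative in coordinates: [d] is the coordinate
   derivative of the field b in the direction a at p.  For the metric
   w^(-2) (du^2 + dv^2 + dw^2) the Christoffel term is
   - (a_w b + b_w a - (a.b) e_w) / w. *)
Definition covariant (p a b d : point) : point :=
  vadd d (vscal (- / cw p)
    (vadd (vadd (vscal (cw a) b) (vscal (cw b) a))
          (vscal (- edot a b) ((0, 0), 1)))).

(* The hyperbolic metric being conformal to the Euclidean one, the Euclidean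
   cross product is normal; it is rescaled to hyperbolic length 1. *)
Definition unit_normal (f : C -> point) (z : C) : point :=
  let c := cross (Dx f z) (Dy f z) in vscal (/ hnorm (f z) c) c.

Definition second_form_xx (f : C -> point) (z : C) : R :=
  hdot (f z) (unit_normal f z) (covariant (f z) (Dx f z) (Dx f z) (Dx (Dx f) z)).
Definition second_form_xy (f : C -> point) (z : C) : R :=
  hdot (f z) (unit_normal f z) (covariant (f z) (Dx f z) (Dy f z) (Dx (Dy f) z)).
Definition second_form_yy (f : C -> point) (z : C) : R :=
  hdot (f z) (unit_normal f z) (covariant (f z) (Dy f z) (Dy f z) (Dy (Dy f) z)).

(* Half the trace, with respect to the first fundamental form, of the second
   fundamental form for [unit_normal]. *)
Definition mean_curvature (f : C -> point) (z : C) : R :=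
  let E := hdot (f z) (Dx f z) (Dx f z) in
  let F := hdot (f z) (Dx f z) (Dy f z) in
  let G := hdot (f z) (Dy f z) (Dy f z) in
  (G * second_form_xx f z - 2 * F * second_form_xy f z + E * second_form_yy f z)
  / (2 * (E * G - F ^ 2)).

(* Unlike [mean_curvature], it does not depend on the choice of the normal. *)
Definition mean_curvature_vector (f : C -> point) (z : C) : point :=
  vscal (mean_curvature f z) (unit_normal f z).

(** * Bryant surface ends *)

Definition punctured (Om : C -> Prop) (z : C) : Prop := Om z /\ z <> 0%C.

(* The last clause says that the orientation carried over by X from the plane
   is the one induced by the mean curvature vector. *)
Definition bryant_end (Om : C -> Prop) (X : C -> point) : Prop :=
  open Om /\ Om 0%C /\ C2_map (punctured Om) X /\
  forall z, punctured Om z ->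
    H3 (X z) /\ immersive X z /\ conformal X z /\
    hnorm (X z) (mean_curvature_vector X z) = 1 /\
    0 < det3 (Dx X z) (Dy X z) (mean_curvature_vector X z).

Definition cexp (s : C) : C := (exp (Re s) * cos (Im s), exp (Re s) * sin (Im s)).

(* The universal cover of the punctured domain is realised as the set of s with
   exp s in Om, the covering map being exp.  (For this to be the universal
   cover the fundamental group has to be infinite cyclic; that is implied by
   the existence of a generator, see [generator] below.)  The null condition
   dA dD - dB dC = 0 does not depend on the coordinate used. *)
Definition bryant_representation (Om : C -> Prop) (X : C -> point)
    (FA FB FC FD : C -> C) : Prop :=
  forall s, Om (cexp s) ->
    (ex_derive (K := C_AbsRing) (V := C_NormedModule) FA s /\
     ex_derive (K := C_AbsRing) (V := C_NormedModule) FB s /\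
     ex_derive (K := C_AbsRing) (V := C_NormedModule) FC s /\
     ex_derive (K := C_AbsRing) (V := C_NormedModule) FD s) /\
    (FA s * FD s - FB s * FC s)%C = 1%C /\
    (C_derive FA s * C_derive FD s - C_derive FB s * C_derive FC s)%C = 0%C /\
    fst (X (cexp s)) =
      ((Cconj (FA s) * FC s + Cconj (FB s) * FD s)
       / RtoC (Cmod (FA s) ^ 2 + Cmod (FB s) ^ 2))%C /\
    snd (X (cexp s)) = / (Cmod (FA s) ^ 2 + Cmod (FB s) ^ 2).

(* Residue at 0 of the one-form whose pull-back under exp is h(s) ds.  The
   circle of radius r around 0, positively oriented, lifts through exp to
   s = ln r + i t, 0 <= t <= 2 pi, along which ds = i dt. *)
Definition residue (r : R) (h : C -> C) : C :=
  let c t := (h (ln r, t) * Ci)%C in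
  (/ (RtoC (2 * PI) * Ci) *
   (RInt (fun t => Re (c t)) 0 (2 * PI), RInt (fun t => Im (c t)) 0 (2 * PI)))%C.

(** * Translations and their Killing fields *)

(* Points of the Riemann sphere: [None] is infinity. *)
Definition sphere : Type := option C.

Definition mobius (a b c d : C) (z : sphere) : sphere :=
  match z with
  | Some z => if Req_EM_T (Cmod (c * z + d)%C) 0 then None
              else Some ((a * z + b) / (c * z + d))%C
  | None => if Req_EM_T (Cmod c) 0 then None else Some (a / c)%C
  end.

(* The isometry of hyperbolic space extending [mobius a b c d] (Poincare
   extension), for a d - b c = 1. *)
Definition isometry (a b c d : C) (p : point) : point :=
  let z := fst p in
  let w := snd p in
  let q := Cmod (c * z + d)%C ^ 2 + Cmod c ^ 2 * w ^ 2 in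
  ((((a * z + b) * Cconj (c * z + d) + a * Cconj c * RtoC (w ^ 2)) / RtoC q)%C,
   w / q).

(* The translation of signed distance t along the oriented geodesic from P to
   Q: along (0, infinity) it is the dilation of ratio e^t, and the general case
   is obtained by transport under an orientation preserving isometry taking
   (0, infinity) to (P, Q). *)
Definition is_translation (P Q : sphere) (t : R) (Phi : point -> point) : Prop :=
  exists a b c d : C,
    (a * d - b * c)%C = 1%C /\
    mobius a b c d (Some (RtoC 0)) = P /\ mobius a b c d None = Q /\
    forall p, H3 p ->
      Phi (isometry a b c d p) = isometry a b c d (vscal (exp t) p).

Definition translation_killing_field (P Q : sphere) (Y : point -> point) : Prop :=
  exists Phi : R -> point -> point,
    (forall t, is_translation P Q t (Phi t)) /\
    forall t p, H3 p ->
      is_derive (fun t => cu (Phi t p)) t (cu (Y (Phi t p))) /\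
      is_derive (fun t => cv (Phi t p)) t (cv (Y (Phi t p))) /\
      is_derive (fun t => cw (Phi t p)) t (cw (Y (Phi t p))).

(** * Generators of the fundamental group *)

Definition loop_in (S : C -> Prop) (c : R -> C) : Prop :=
  (forall t, continuous c t) /\ c 0 = c 1 /\ forall t, 0 <= t <= 1 -> S (c t).

Definition loop_homotopic (S : C -> Prop) (c0 c1 : R -> C) : Prop :=
  exists h : R * R -> C,
    (forall q, continuous h q) /\
    (forall s t, 0 <= s <= 1 -> 0 <= t <= 1 -> S (h (s, t))) /\
    (forall t, 0 <= t <= 1 -> h (0, t) = c0 t /\ h (1, t) = c1 t) /\
    (forall s, 0 <= s <= 1 -> h (s, 0) = c0 0 /\ h (s, 1) = c0 0).

(* For a 1-periodic g, the loop t |-> g (n t) represents the n-th power of the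
   class of g. *)
Definition generator (S : C -> Prop) (g : R -> C) : Prop :=
  loop_in S g /\
  forall c, loop_in S c -> c 0 = g 0 ->
    exists n : Z, loop_homotopic S c (fun t => g (IZR n * t)).

(* A regular simple closed C^1 curve in the punctured domain generating its
   fundamental group. *)
Definition end_loop (Om : C -> Prop) (g : R -> C) : Prop :=
  (forall t, g (t + 1) = g t) /\
  (forall s t, 0 <= s < 1 -> 0 <= t < 1 -> g s = g t -> s = t) /\
  (forall t,
     ex_derive (fun t => Re (g t)) t /\ ex_derive (fun t => Im (g t)) t /\
     continuous (Derive (fun t => Re (g t))) t /\
     continuous (Derive (fun t => Im (g t))) t /\
     (Derive (fun t => Re (g t)) t, Derive (fun t => Im (g t)) t) <> RtoC 0) /\
  generator (punctured Om) g.

(** * Flux *)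

Definition velocity (G : R -> point) (t : R) : point :=
  ((Derive (fun t => cu (G t)) t, Derive (fun t => cv (G t)) t),
   Derive (fun t => cw (G t)) t).

(* The vector n, based at g t, points into the side of the curve g containing
   the puncture: from there the puncture can be reached without meeting g. *)
Definition towards_puncture (Om : C -> Prop) (g : R -> C) (t : R) (n : C) : Prop :=
  exists delta, 0 < delta /\ forall eps, 0 < eps < delta ->
    exists path : R -> C,
      (forall s, continuous path s) /\
      path 0 = (g t + RtoC eps * n)%C /\ path 1 = 0%C /\
      forall s, 0 <= s <= 1 -> Om (path s) /\ forall t', path s <> g t'.

(* eta is the unit conormal to G = X o g pointing towards the end, and
   (G', eta, - H) is positively oriented. *)
Definition end_conormal (Om : C -> Prop) (X : C -> point) (g : R -> C)
    (eta : R -> point) : Prop :=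
  forall t,
    let G := fun t => X (g t) in
    hnorm (G t) (eta t) = 1 /\ hdot (G t) (eta t) (velocity G t) = 0 /\
    (exists n : C,
       eta t = vadd (vscal (Re n) (Dx X (g t))) (vscal (Im n) (Dy X (g t))) /\
       towards_puncture Om g t n) /\
    0 < det3 (velocity G t) (eta t)
          (vscal (- 1) (mean_curvature_vector X (g t))).

(* An immersed disk in hyperbolic space, C^2 up to the boundary, whose boundary
   is the closed curve G.  Matching parametrisations cost no generality: the
   curve can be reparametrised, and the disk reflected. *)
Definition spanning_disk (G : R -> point) (k : C -> point) : Prop :=
  (exists rho, 1 < rho /\ C2_map (fun z => Cmod z < rho) k) /\
  (forall z, Cmod z <= 1 -> H3 (k z) /\ immersive k z) /\
  forall t, k (cos (2 * PI * t), sin (2 * PI * t)) = G t.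

(* nu is the continuous unit normal along the disk k which induces on its
   boundary the orientation of G: (outward vector, G', nu) is positively
   oriented. *)
Definition disk_normal (G : R -> point) (k : C -> point) (nu : C -> point) : Prop :=
  continuous_on (fun z => Cmod z <= 1) nu /\
  (forall z, Cmod z <= 1 ->
     hnorm (k z) (nu z) = 1 /\
     hdot (k z) (nu z) (Dx k z) = 0 /\ hdot (k z) (nu z) (Dy k z) = 0) /\
  forall t,
    let z := (cos (2 * PI * t), sin (2 * PI * t)) : C in
    let outward := vadd (vscal (Re z) (Dx k z)) (vscal (Im z) (Dy k z)) in
    0 < det3 outward (velocity G t) (nu z).

Definition curve_integral (G : R -> point) (f : R -> R) : R :=
  RInt (fun t => f t * hnorm (G t) (velocity G t)) 0 1.

(* Integral over the unit disk, in polar coordinates, against the hyperbolic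
   area of k. *)
Definition disk_integral (k : C -> point) (f : C -> R) : R :=
  RInt (fun r => RInt (fun th =>
    let z := (r * cos th, r * sin th) : C in
    f z * area_density k z * r) 0 (2 * PI)) 0 1.

(* phi is the flux of Y through the end, computed with some admissible curve
   and disk. *)
Definition is_flux (Om : C -> Prop) (X : C -> point) (Y : point -> point)
    (phi : R) : Prop :=
  exists (g : R -> C) (eta : R -> point) (k nu : C -> point),
    let G := fun t => X (g t) in
    end_loop Om g /\ end_conormal Om X g eta /\
    spanning_disk G k /\ disk_normal G k nu /\
    phi = curve_integral G (fun t => hdot (G t) (eta t) (Y (G t)))
          - 2 * disk_integral k (fun z => hdot (k z) (nu z) (Y (k z))).

(* The last case does not occur for distinct points. *)
Definition flux_fraction (phi0 phi1 phi2 : C) (P Q : sphere) : C :=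
  match P, Q with
  | Some p, Some q =>
      ((phi2 * p * q + phi1 * (p + q) + phi0) / (p - q))%C
  | None, Some q => (phi2 * q + phi1)%C
  | Some p, None => (- (phi2 * p + phi1))%C
  | None, None => 0%C
  end.

(* Main.v *)
Require Import Defs.
From Stdlib Require Import Reals Lra Lia Psatz ZArith ClassicalEpsilon FunctionalExtensionality.
From Coquelicot Require Import Coquelicot.
(* Reals exports another Dx. *)
Import Defs.

(** The flux is first turned into the integral of a closed one-form over a loop around the
    puncture, and this integral into a residue.

    A Killing field of hyperbolic space extends a holomorphic vector field a z^2 + b z + c of the
    sphere at infinity.  For the translation along the geodesic from P to Q this field vanishes at P
    and Q, and [killing_formula] finds a = 1 / (P - Q), b = - (P + Q) / (P - Q) and c = P Q / (P - Q),
    so that the fraction to be obtained is c phi2 - b phi1 + a phi0.  To the field belongs a complex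
    one-form [killing_form] on hyperbolic space, with two properties: its real part is minus the scalar
    product with the field, and half of its imaginary part is a potential for the contraction of the
    volume form with the field ([potential_curl]), a closed form since the field preserves volume.

    By the second property and Green's formula, the integral over the spanning disk is an integral
    over its boundary ([disk_flux]).  As for the conormal term, the parametrisation X is conformal,
    so the conormal, scaled by the speed, is the velocity of the loop turned by a right angle in the
    parameter plane ([conormal_rotation]); by the first property this term is again the integral of
    a one-form.  The two terms combine into - 2 Im (n dz), where n dz, [surface_form], is the (1, 0)
    part of the pull-back of the complex one-form under X ([flux_loop_integral]).

    The Bryant representation says that X is F F^* in the Hermitian model, F^* being
    antiholomorphic.  The derivative of X in s, times the inverse of X, is therefore F' F^-1, and n is
    a linear combination, with coefficients a, b, c, of the entries of F' F^-1, namely of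
    D C' - C D', D A' - C B' and B A' - A B' ([surface_form_cover]).  In particular n is holomorphic,
    Im (n dz) is closed ([surface_form_exact]), and its integral over a circle around 0 is a
    combination of the residues ([circle_surface_integral], [residue_J]).

    It remains to compare the given loop g with a circle.  Since g generates the fundamental group,
    a small circle is homotopic to g run through n times, for some integer n ([circle_turns]); the
    integral of the angle form then shows that the winding number of g is not 0.  The orientation
    conditions put the puncture on the right of g.  At the point of g that is furthest from the
    puncture, g is perpendicular to the radius.  Were it to run counterclockwise there, the
    puncture could be joined, without crossing g, to a point outside of a disk containing g, and the
    winding number would be 0.  So it runs clockwise there, and the puncture can be joined to a
    point slightly inside, around which a simple loop turns exactly once ([inner_winding]).  Hence g
    has winding number -1 ([loop_winding]) and integrals over g are opposite to integrals over
    circles ([loop_integral]). *)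

(** * Functions of class C1 in the plane *)

Lemma pair_eta (z : C) : (Re z, Im z) = z.
Proof. destruct z; reflexivity. Qed.

Lemma continuous_Re (z : C) : continuous Re z.
Proof. destruct z as [x y]. apply continuous_fst. Qed.

Lemma continuous_Im (z : C) : continuous Im z.
Proof. destruct z as [x y]. apply continuous_snd. Qed.

Lemma continuous_pair {T : UniformSpace} (f g : T -> R) (t : T) :
  continuous f t -> continuous g t -> continuous (fun t => (f t, g t) : C) t.
Proof.
  intros Hf Hg. apply (continuous_comp_2 f g (fun x y => (x, y) : C)); try assumption.
  apply continuous_ext with (fun p : R * R => p).
  { intros [a b]; reflexivity. }
  apply continuous_id.
Qed.

Lemma continuous_of_parts {T : UniformSpace} (f : T -> C) (t : T) :
  continuous (fun t => Re (f t)) t -> continuous (fun t => Im (f t)) t ->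
  continuous f t.
Proof.
  intros Hf Hg.
  apply continuous_ext with (fun t => (Re (f t), Im (f t)) : C).
  { intros x. apply pair_eta. }
  apply continuous_pair; assumption.
Qed.

Lemma continuous_Cmult {T : UniformSpace} (f g : T -> C) (t : T) :
  continuous f t -> continuous g t -> continuous (fun t => f t * g t)%C t.
Proof.
  intros Hf Hg.
  assert (Rf := continuous_comp f Re t Hf (continuous_Re _)).
  assert (If := continuous_comp f Im t Hf (continuous_Im _)).
  assert (Rg := continuous_comp g Re t Hg (continuous_Re _)).
  assert (Ig := continuous_comp g Im t Hg (continuous_Im _)).
  apply continuous_pair.
  - apply (continuous_minus (fun t => Re (f t) * Re (g t)) (fun t => Im (f t) * Im (g t))).
    + now apply (continuous_mult (fun t => Re (f t)) (fun t => Re (g t))).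
    + now apply (continuous_mult (fun t => Im (f t)) (fun t => Im (g t))).
  - apply (continuous_plus (fun t => Re (f t) * Im (g t)) (fun t => Im (f t) * Re (g t))).
    + now apply (continuous_mult (fun t => Re (f t)) (fun t => Im (g t))).
    + now apply (continuous_mult (fun t => Im (f t)) (fun t => Re (g t))).
Qed.

Lemma continuous_Cplus {T : UniformSpace} (f g : T -> C) (t : T) :
  continuous f t -> continuous g t -> continuous (fun t => f t + g t)%C t.
Proof. intros Hf Hg. apply (continuous_plus (V := C_R_NormedModule) f g); assumption. Qed.

Lemma continuous_Copp {T : UniformSpace} (f : T -> C) (t : T) :
  continuous f t -> continuous (fun t => - f t)%C t.
Proof. intros Hf. apply (continuous_opp (V := C_R_NormedModule) f); assumption. Qed.

Lemma continuous_Cminus {T : UniformSpace} (f g : T -> C) (t : T) :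
  continuous f t -> continuous g t -> continuous (fun t => f t - g t)%C t.
Proof. intros Hf Hg. apply continuous_Cplus; [|apply continuous_Copp]; assumption. Qed.

Lemma continuous_Cconj {T : UniformSpace} (f : T -> C) (t : T) :
  continuous f t -> continuous (fun t => Cconj (f t)) t.
Proof.
  intros Hf. apply continuous_of_parts; simpl.
  - apply (continuous_comp f Re t Hf (continuous_Re _)).
  - apply (continuous_opp (fun t => Im (f t))).
    apply (continuous_comp f Im t Hf (continuous_Im _)).
Qed.

Lemma continuous_RtoC {T : UniformSpace} (f : T -> R) (t : T) :
  continuous f t -> continuous (fun t => RtoC (f t)) t.
Proof. intros Hf. apply continuous_pair; [exact Hf | apply continuous_const]. Qed.

Lemma continuous_Rmax {T : UniformSpace} (f g : T -> R) t :
  continuous f t -> continuous g t -> continuous (fun t => Rmax (f t) (g t)) t.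
Proof.
  intros Hf Hg.
  apply continuous_ext with (fun t => (f t + g t + Rabs (f t - g t)) / 2).
  { intros u. unfold Rmax, Rabs. destruct (Rle_dec (f u) (g u)), (Rcase_abs (f u - g u)); lra. }
  apply (continuous_mult (fun t => f t + g t + Rabs (f t - g t))); [|apply continuous_const].
  apply (continuous_plus (fun t => f t + g t)); [now apply (continuous_plus f g)|].
  apply (continuous_comp (fun t => f t - g t) Rabs); [now apply (continuous_minus f g)|].
  apply continuous_Rabs.
Qed.

Lemma continuous_Rmin {T : UniformSpace} (f g : T -> R) t :
  continuous f t -> continuous g t -> continuous (fun t => Rmin (f t) (g t)) t.
Proof.
  intros Hf Hg. apply continuous_ext with (fun t => - Rmax (- f t) (- g t)).
  { intros u. unfold Rmax, Rmin. destruct (Rle_dec (- f u) (- g u)), (Rle_dec (f u) (g u)); lra. }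
  apply (continuous_opp (fun t => Rmax (- f t) (- g t))).
  apply continuous_Rmax; [now apply (continuous_opp f) | now apply (continuous_opp g)].
Qed.

(** Truncation to the interval from 0 to m.  With it, a path that rests on some intervals is given
    by one formula, and its continuity needs no gluing. *)
Definition clamp (m x : R) : R := Rmax 0 (Rmin m x).

Lemma continuous_clamp m x : continuous (clamp m) x.
Proof.
  apply continuous_Rmax; [apply continuous_const|].
  apply continuous_Rmin; [apply continuous_const | apply continuous_id].
Qed.

Lemma clamp_range m x : 0 <= m -> 0 <= clamp m x <= m.
Proof.
  intros. unfold clamp, Rmax, Rmin. destruct (Rle_dec m x), (Rle_dec 0 m), (Rle_dec 0 x); lra.
Qed.

Lemma clamp_low m x : 0 <= m -> x <= 0 -> clamp m x = 0.
Proof.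
  intros. unfold clamp, Rmax, Rmin. destruct (Rle_dec m x), (Rle_dec 0 m), (Rle_dec 0 x); lra.
Qed.

Lemma clamp_high m x : 0 <= m -> m <= x -> clamp m x = m.
Proof.
  intros. unfold clamp, Rmax, Rmin. destruct (Rle_dec m x), (Rle_dec 0 m), (Rle_dec 0 x); lra.
Qed.

Ltac cont_at h := lazymatch h with
  | Re => apply continuous_Re
  | Im => apply continuous_Im
  | fst => apply continuous_fst
  | snd => apply continuous_snd
  | clamp _ => apply continuous_clamp
  | cos => apply continuous_cos
  | sin => apply continuous_sin
  | exp => apply continuous_exp
  | _ => match goal with
         | H : continuous h _ |- _ => exact H
         | H : forall _, continuous h _ |- _ => apply H
         | H : forall _, continuous (fun x => h x) _ |- _ => apply H
         end
  end.

(** Continuity of an explicit expression, read off its shape.  The lemmas are chosen by syntax alone: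
    unifying two different functions could unfold exp or cos. *)
Ltac cont := first [ match goal with H : continuous ?f ?x |- continuous ?f ?x => exact H end
  | lazymatch goal with
    | |- continuous (fun x => x) _ => apply continuous_id
    | |- continuous (fun _ => ?c) _ => apply continuous_const
    | |- continuous (fun x => Rplus (@?f x) (@?g x)) _ => apply (continuous_plus f g); cont
    | |- continuous (fun x => Rminus (@?f x) (@?g x)) _ => apply (continuous_minus f g); cont
    | |- continuous (fun x => Rmult (@?f x) (@?g x)) _ => apply (continuous_mult f g); cont
    | |- continuous (fun x => Ropp (@?f x)) _ => apply (continuous_opp f); cont
    | |- continuous (fun x => Rmax (@?f x) (@?g x)) _ => apply (continuous_Rmax f g); cont
    | |- continuous (fun x => Rmin (@?f x) (@?g x)) _ => apply (continuous_Rmin f g); cont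
    | |- continuous (fun x => Cplus (@?f x) (@?g x)) _ => apply (continuous_Cplus f g); cont
    | |- continuous (fun x => Cminus (@?f x) (@?g x)) _ => apply (continuous_Cminus f g); cont
    | |- continuous (fun x => Cmult (@?f x) (@?g x)) _ => apply (continuous_Cmult f g); cont
    | |- continuous (fun x => Copp (@?f x)) _ => apply (continuous_Copp f); cont
    | |- continuous (fun x => Cconj (@?f x)) _ => apply (continuous_Cconj f); cont
    | |- continuous (fun x => RtoC (@?f x)) _ => apply (continuous_RtoC f); cont
    | |- continuous (fun x => (@?f x, @?g x)) _ => apply (continuous_pair f g); cont
    | |- continuous (fun x => ?h (@?f x)) _ => apply (continuous_comp f h); [cont | cont_at h]
    | |- continuous ?h _ => cont_at h
    end ].

Lemma open_nbhd_x (S : C -> Prop) (z : C) :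
  open S -> S z -> locally (Re z) (fun x => S (x, Im z)).
Proof.
  intros HS Hz. destruct z as [a b]. simpl.
  assert (H : continuous (fun x : R => (x, b) : C) a).
  { apply continuous_pair; [apply continuous_id | apply continuous_const]. }
  apply (H S). apply HS. exact Hz.
Qed.

Lemma open_nbhd_y (S : C -> Prop) (z : C) :
  open S -> S z -> locally (Im z) (fun y => S (Re z, y)).
Proof.
  intros HS Hz. destruct z as [a b]. simpl.
  assert (H : continuous (fun y : R => (a, y) : C) b).
  { apply continuous_pair; [apply continuous_const | apply continuous_id]. }
  apply (H S). apply HS. exact Hz.
Qed.

Lemma C1_intro (S : C -> Prop) (g p q : C -> R) :
  open S ->
  (forall z, S z -> is_derive (fun x => g (x, Im z)) (Re z) (p z)) ->
  (forall z, S z -> is_derive (fun y => g (Re z, y)) (Im z) (q z)) ->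
  (forall z, S z -> continuous p z) -> (forall z, S z -> continuous q z) ->
  C1_on S g.
Proof.
  intros HS Hx Hy Hp Hq z Hz. repeat split.
  - eexists; apply Hx, Hz.
  - eexists; apply Hy, Hz.
  - apply continuous_ext_loc with p; [|apply Hp, Hz].
    apply filter_imp with S; [|apply HS, Hz].
    intros u Hu. symmetry. apply is_derive_unique, Hx, Hu.
  - apply continuous_ext_loc with q; [|apply Hq, Hz].
    apply filter_imp with S; [|apply HS, Hz].
    intros u Hu. symmetry. apply is_derive_unique, Hy, Hu.
Qed.

Lemma C1_dx (S : C -> Prop) (g : C -> R) (z : C) :
  C1_on S g -> S z -> is_derive (fun x => g (x, Im z)) (Re z) (dx g z).
Proof. intros H Hz. apply Derive_correct. apply H, Hz. Qed.

Lemma C1_dy (S : C -> Prop) (g : C -> R) (z : C) :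
  C1_on S g -> S z -> is_derive (fun y => g (Re z, y)) (Im z) (dy g z).
Proof. intros H Hz. apply Derive_correct. apply H, Hz. Qed.

Lemma C1_cont_dx (S : C -> Prop) (g : C -> R) (z : C) :
  C1_on S g -> S z -> continuous (dx g) z.
Proof. intros H Hz. exact (proj1 (proj2 (proj2 (H z Hz)))). Qed.

Lemma C1_cont_dy (S : C -> Prop) (g : C -> R) (z : C) :
  C1_on S g -> S z -> continuous (dy g) z.
Proof. intros H Hz. exact (proj2 (proj2 (proj2 (H z Hz)))). Qed.

(** The definition of class C1 speaks of partial derivatives alone; the chain rule along curves
    needs the differential. *)
Lemma C1_differentiable (S : C -> Prop) (g : C -> R) (z : C) :
  open S -> C1_on S g -> S z ->
  differentiable_pt_lim (fun x y => g (x, y)) (Re z) (Im z) (dx g z) (dy g z).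
Proof.
  intros HS Hg Hz.
  apply filterdiff_differentiable_pt_lim.
  assert (K := is_derive_filterdiff (fun x y => g (x, y)) (Re z) (Im z)
                 (fun x y => dx g (x, y)) (dy g z)).
  rewrite pair_eta in K |- *.
  eapply filterdiff_ext_lin.
  - apply K.
    + apply filter_imp with S; [|apply HS, Hz].
      intros u Hu. replace (fst u, snd u) with u by (destruct u; reflexivity).
      apply (C1_dx S g u Hg Hu).
    + apply (C1_dy S g z Hg Hz).
    + apply continuous_ext with (dx g).
      { intros [a b]; reflexivity. }
      exact (C1_cont_dx S g z Hg Hz).
  - intros [a b]. simpl. rewrite pair_eta. reflexivity.
Qed.

Lemma C1_continuous (S : C -> Prop) (g : C -> R) (z : C) :
  open S -> C1_on S g -> S z -> continuous g z.
Proof.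
  intros HS Hg Hz.
  assert (K := C1_differentiable S g z HS Hg Hz).
  assert (K2 : continuity_2d_pt (fun x y => g (x, y)) (Re z) (Im z)).
  { apply differentiable_continuity_pt. exists (dx g z), (dy g z). exact K. }
  apply continuity_2d_pt_filterlim in K2. rewrite pair_eta in K2.
  apply continuous_ext with (fun z : C => g (fst z, snd z)).
  { intros [a b]; reflexivity. }
  unfold continuous. destruct z as [a b]; exact K2.
Qed.

Lemma C1_curve (S : C -> Prop) (g : C -> R) (c : R -> C) (t a b : R) :
  open S -> C1_on S g -> S (c t) ->
  is_derive (fun t => Re (c t)) t a -> is_derive (fun t => Im (c t)) t b ->
  is_derive (fun t => g (c t)) t (dx g (c t) * a + dy g (c t) * b).
Proof.
  intros HS Hg Hc Ha Hb.
  apply is_derive_ext with (fun t => g (Re (c t), Im (c t))).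
  { intros u. now rewrite pair_eta. }
  apply is_derive_Reals.
  apply (derivable_pt_lim_comp_2d (fun x y => g (x, y))
           (fun t => Re (c t)) (fun t => Im (c t))).
  - apply C1_differentiable with S; assumption.
  - now apply is_derive_Reals.
  - now apply is_derive_Reals.
Qed.

Section Closure.
Variables (S : C -> Prop) (HS : open S).

Lemma C1_ext (f g : C -> R) :
  (forall z, S z -> f z = g z) -> C1_on S f -> C1_on S g.
Proof.
  intros E Hf. apply (C1_intro S g (dx f) (dy f) HS).
  - intros z Hz. eapply is_derive_ext_loc; [|apply (C1_dx S f z Hf Hz)].
    apply filter_imp with (2 := open_nbhd_x S z HS Hz). intros x Hx. now apply E.
  - intros z Hz. eapply is_derive_ext_loc; [|apply (C1_dy S f z Hf Hz)].
    apply filter_imp with (2 := open_nbhd_y S z HS Hz). intros x Hx. now apply E.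
  - intros z Hz. exact (C1_cont_dx S f z Hf Hz).
  - intros z Hz. exact (C1_cont_dy S f z Hf Hz).
Qed.

Lemma dx_ext (f g : C -> R) z : (forall z, S z -> f z = g z) -> S z -> dx f z = dx g z.
Proof.
  intros E Hz. apply Derive_ext_loc.
  apply filter_imp with (2 := open_nbhd_x S z HS Hz). intros x Hx. now apply E.
Qed.

Lemma dy_ext (f g : C -> R) z : (forall z, S z -> f z = g z) -> S z -> dy f z = dy g z.
Proof.
  intros E Hz. apply Derive_ext_loc.
  apply filter_imp with (2 := open_nbhd_y S z HS Hz). intros x Hx. now apply E.
Qed.

Lemma C1_const (k : R) : C1_on S (fun _ => k).
Proof.
  apply (C1_intro S (fun _ => k) (fun _ => 0) (fun _ => 0) HS); intros z Hz;
    try apply continuous_const; apply (is_derive_const k).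
Qed.

Lemma C1_plus (f g : C -> R) :
  C1_on S f -> C1_on S g -> C1_on S (fun z => f z + g z).
Proof.
  intros Hf Hg.
  apply (C1_intro S _ (fun z => dx f z + dx g z) (fun z => dy f z + dy g z) HS);
    intros z Hz.
  - apply (is_derive_plus (fun x => f (x, Im z)) (fun x => g (x, Im z)));
      now apply C1_dx with S.
  - apply (is_derive_plus (fun y => f (Re z, y)) (fun y => g (Re z, y)));
      now apply C1_dy with S.
  - apply (continuous_plus (dx f) (dx g)); now apply C1_cont_dx with S.
  - apply (continuous_plus (dy f) (dy g)); now apply C1_cont_dy with S.
Qed.

Lemma C1_opp (f : C -> R) : C1_on S f -> C1_on S (fun z => - f z).
Proof.
  intros Hf.
  apply (C1_intro S _ (fun z => - dx f z) (fun z => - dy f z) HS); intros z Hz.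
  - apply (is_derive_opp (fun x => f (x, Im z))); now apply C1_dx with S.
  - apply (is_derive_opp (fun y => f (Re z, y))); now apply C1_dy with S.
  - apply (continuous_opp (dx f)); now apply C1_cont_dx with S.
  - apply (continuous_opp (dy f)); now apply C1_cont_dy with S.
Qed.

Lemma C1_minus (f g : C -> R) :
  C1_on S f -> C1_on S g -> C1_on S (fun z => f z - g z).
Proof. intros Hf Hg. apply C1_plus; [exact Hf | now apply C1_opp]. Qed.

Lemma is_derive_mult_R (f g : R -> R) (x a b : R) :
  is_derive f x a -> is_derive g x b ->
  is_derive (fun x => f x * g x) x (a * g x + f x * b).
Proof. intros. apply (is_derive_mult f g); [assumption|assumption|exact Rmult_comm]. Qed.

Lemma C1_mult (f g : C -> R) :
  C1_on S f -> C1_on S g -> C1_on S (fun z => f z * g z).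
Proof.
  intros Hf Hg.
  assert (Cf : forall z, S z -> continuous f z) by (intros; now apply C1_continuous with S).
  assert (Cg : forall z, S z -> continuous g z) by (intros; now apply C1_continuous with S).
  apply (C1_intro S _ (fun z => dx f z * g z + f z * dx g z)
           (fun z => dy f z * g z + f z * dy g z) HS); intros z Hz.
  - assert (K := is_derive_mult_R (fun x => f (x, Im z)) (fun x => g (x, Im z)) (Re z) _ _
      (C1_dx S f z Hf Hz) (C1_dx S g z Hg Hz)).
    simpl in K. rewrite pair_eta in K. exact K.
  - assert (K := is_derive_mult_R (fun y => f (Re z, y)) (fun y => g (Re z, y)) (Im z) _ _
      (C1_dy S f z Hf Hz) (C1_dy S g z Hg Hz)).
    simpl in K. rewrite pair_eta in K. exact K.
  - apply (continuous_plus (fun z => dx f z * g z) (fun z => f z * dx g z));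
      [apply (continuous_mult (dx f) g) | apply (continuous_mult f (dx g))]; auto;
      now apply C1_cont_dx with S.
  - apply (continuous_plus (fun z => dy f z * g z) (fun z => f z * dy g z));
      [apply (continuous_mult (dy f) g) | apply (continuous_mult f (dy g))]; auto;
      now apply C1_cont_dy with S.
Qed.

Lemma C1_inv (f : C -> R) :
  (forall z, S z -> f z <> 0) -> C1_on S f -> C1_on S (fun z => / f z).
Proof.
  intros Nf Hf.
  assert (Cf : forall z, S z -> continuous f z) by (intros; now apply C1_continuous with S).
  assert (Ci : forall z, S z -> continuous (fun z => / f z ^ 2) z).
  { intros z Hz. apply (continuous_comp f (fun x => / x ^ 2)); [auto|].
    apply (ex_derive_continuous (fun x => / x ^ 2)).
    auto_derive. specialize (Nf z Hz). nra. }
  apply (C1_intro S _ (fun z => - dx f z * / f z ^ 2)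
           (fun z => - dy f z * / f z ^ 2) HS); intros z Hz.
  - assert (K := is_derive_inv (fun x => f (x, Im z)) (Re z) _ (C1_dx S f z Hf Hz)).
    simpl in K. rewrite pair_eta in K. apply K. auto.
  - assert (K := is_derive_inv (fun x => f (Re z, x)) (Im z) _ (C1_dy S f z Hf Hz)).
    simpl in K. rewrite pair_eta in K. apply K. auto.
  - apply (continuous_mult (fun z => - dx f z)); auto.
    apply (continuous_opp (dx f)). now apply C1_cont_dx with S.
  - apply (continuous_mult (fun z => - dy f z)); auto.
    apply (continuous_opp (dy f)). now apply C1_cont_dy with S.
Qed.

Definition C1c (f : C -> C) : Prop :=
  C1_on S (fun z => Re (f z)) /\ C1_on S (fun z => Im (f z)).

Lemma C1c_const (k : C) : C1c (fun _ => k).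
Proof. split; apply C1_const. Qed.

Lemma C1c_RtoC (f : C -> R) : C1_on S f -> C1c (fun z => RtoC (f z)).
Proof. intros H; split; [exact H | exact (C1_const 0)]. Qed.

Lemma C1c_plus (f g : C -> C) : C1c f -> C1c g -> C1c (fun z => f z + g z)%C.
Proof. intros [] []; split; now apply C1_plus. Qed.

Lemma C1c_opp (f : C -> C) : C1c f -> C1c (fun z => - f z)%C.
Proof. intros []; split; now apply C1_opp. Qed.

Lemma C1c_minus (f g : C -> C) : C1c f -> C1c g -> C1c (fun z => f z - g z)%C.
Proof. intros [] []; split; now apply C1_minus. Qed.

Lemma C1c_mult (f g : C -> C) : C1c f -> C1c g -> C1c (fun z => f z * g z)%C.
Proof.
  intros [] []; split; [apply C1_minus | apply C1_plus]; now apply C1_mult.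
Qed.

Lemma C1c_conj (f : C -> C) : C1c f -> C1c (fun z => Cconj (f z)).
Proof. intros []; split; [assumption | now apply C1_opp]. Qed.

Lemma C1c_ext (f g : C -> C) : (forall z, S z -> f z = g z) -> C1c f -> C1c g.
Proof.
  intros E []; split; [apply C1_ext with (fun z => Re (f z)) | apply C1_ext with (fun z => Im (f z))];
  try assumption; intros z Hz; now rewrite E.
Qed.

Lemma C1c_continuous (f : C -> C) z : C1c f -> S z -> continuous f z.
Proof.
  intros [] Hz. apply continuous_of_parts;
  [apply (C1_continuous S (fun z => Re (f z))) | apply (C1_continuous S (fun z => Im (f z)))]; assumption.
Qed.
End Closure.

Definition cdx (f : C -> C) (z : C) : C :=
  (dx (fun z => Re (f z)) z, dx (fun z => Im (f z)) z).
Definition cdy (f : C -> C) (z : C) : C :=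
  (dy (fun z => Re (f z)) z, dy (fun z => Im (f z)) z).

(** A statement at one point, without continuity of the derivatives: it has to apply to maps that
    are only known to be complex differentiable. *)
Definition partials (f : C -> C) (z fx fy : C) : Prop :=
  (is_derive (fun x => Re (f (x, Im z))) (Re z) (Re fx) /\
   is_derive (fun x => Im (f (x, Im z))) (Re z) (Im fx)) /\
  (is_derive (fun y => Re (f (Re z, y))) (Im z) (Re fy) /\
   is_derive (fun y => Im (f (Re z, y))) (Im z) (Im fy)).

Lemma partials_eq f z fx fy : partials f z fx fy -> cdx f z = fx /\ cdy f z = fy.
Proof.
  intros [[H1 H2] [H3 H4]]. rewrite <- (pair_eta fx), <- (pair_eta fy).
  split; unfold cdx, cdy, dx, dy; f_equal; now apply is_derive_unique.
Qed.

Lemma partials_unique f z fx fy gx gy :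
  partials f z fx fy -> partials f z gx gy -> fx = gx /\ fy = gy.
Proof.
  intros H K. apply partials_eq in H, K. destruct H as [<- <-], K as [<- <-]. now split.
Qed.

Lemma partials_C1 S f z : C1c S f -> S z -> partials f z (cdx f z) (cdy f z).
Proof.
  intros [H1 H2] Hz. split; split.
  - exact (C1_dx S _ z H1 Hz).
  - exact (C1_dx S _ z H2 Hz).
  - exact (C1_dy S _ z H1 Hz).
  - exact (C1_dy S _ z H2 Hz).
Qed.

Lemma is_derive_Cmult (u v : R -> C) (t : R) (a b : C) :
  is_derive (fun t => Re (u t)) t (Re a) -> is_derive (fun t => Im (u t)) t (Im a) ->
  is_derive (fun t => Re (v t)) t (Re b) -> is_derive (fun t => Im (v t)) t (Im b) ->
  is_derive (fun t => Re (u t * v t)%C) t (Re (a * v t + u t * b)%C) /\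
  is_derive (fun t => Im (u t * v t)%C) t (Im (a * v t + u t * b)%C).
Proof.
  intros H1 H2 H3 H4. split.
  - evar_last.
    + apply (is_derive_minus (fun t => Re (u t) * Re (v t)) (fun t => Im (u t) * Im (v t)));
      eapply is_derive_mult_R; eassumption.
    + unfold minus, plus, opp; simpl. unfold Re, Im. ring.
  - evar_last.
    + apply (is_derive_plus (fun t => Re (u t) * Im (v t)) (fun t => Im (u t) * Re (v t)));
      eapply is_derive_mult_R; eassumption.
    + unfold minus, plus, opp; simpl. unfold Re, Im. ring.
Qed.

Lemma partials_mult f g z fx fy gx gy : partials f z fx fy -> partials g z gx gy ->
  partials (fun z => f z * g z)%C z (fx * g z + f z * gx)%C (fy * g z + f z * gy)%C.
Proof.
  intros [[H1 H2] [H3 H4]] [[K1 K2] [K3 K4]].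
  assert (X := is_derive_Cmult (fun x => f (x, Im z)) (fun x => g (x, Im z)) _ _ _ H1 H2 K1 K2).
  assert (Y := is_derive_Cmult (fun y => f (Re z, y)) (fun y => g (Re z, y)) _ _ _ H3 H4 K3 K4).
  cbv beta in X, Y. rewrite !pair_eta in X, Y. split; assumption.
Qed.

Lemma partials_plus f g z fx fy gx gy : partials f z fx fy -> partials g z gx gy ->
  partials (fun z => f z + g z)%C z (fx + gx)%C (fy + gy)%C.
Proof.
  intros [[H1 H2] [H3 H4]] [[K1 K2] [K3 K4]]. split; split.
  - now apply (is_derive_plus (fun x => Re (f (x, Im z))) (fun x => Re (g (x, Im z)))).
  - now apply (is_derive_plus (fun x => Im (f (x, Im z))) (fun x => Im (g (x, Im z)))).
  - now apply (is_derive_plus (fun y => Re (f (Re z, y))) (fun y => Re (g (Re z, y)))).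
  - now apply (is_derive_plus (fun y => Im (f (Re z, y))) (fun y => Im (g (Re z, y)))).
Qed.

Lemma partials_opp f z fx fy : partials f z fx fy ->
  partials (fun z => - f z)%C z (- fx)%C (- fy)%C.
Proof.
  intros [[H1 H2] [H3 H4]]. split; split.
  - now apply (is_derive_opp (fun x => Re (f (x, Im z)))).
  - now apply (is_derive_opp (fun x => Im (f (x, Im z)))).
  - now apply (is_derive_opp (fun y => Re (f (Re z, y)))).
  - now apply (is_derive_opp (fun y => Im (f (Re z, y)))).
Qed.

Lemma partials_conj f z fx fy : partials f z fx fy ->
  partials (fun z => Cconj (f z)) z (Cconj fx) (Cconj fy).
Proof.
  intros [[H1 H2] [H3 H4]]. split; split; try assumption.
  - now apply (is_derive_opp (fun x => Im (f (x, Im z)))).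
  - now apply (is_derive_opp (fun y => Im (f (Re z, y)))).
Qed.

Lemma partials_ext (S : C -> Prop) f g z fx fy : open S -> S z ->
  (forall z, S z -> f z = g z) -> partials f z fx fy -> partials g z fx fy.
Proof.
  intros HS Hz E [[H1 H2] [H3 H4]].
  assert (Nx := open_nbhd_x S z HS Hz). assert (Ny := open_nbhd_y S z HS Hz).
  split; split.
  - eapply is_derive_ext_loc; [|exact H1]. apply filter_imp with (2 := Nx). intros x Hx. now rewrite E.
  - eapply is_derive_ext_loc; [|exact H2]. apply filter_imp with (2 := Nx). intros x Hx. now rewrite E.
  - eapply is_derive_ext_loc; [|exact H3]. apply filter_imp with (2 := Ny). intros x Hx. now rewrite E.
  - eapply is_derive_ext_loc; [|exact H4]. apply filter_imp with (2 := Ny). intros x Hx. now rewrite E.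
Qed.

Lemma partials_const k z : partials (fun _ => k) z 0%C 0%C.
Proof.
  split; split; first [apply (is_derive_const (Re k)) | apply (is_derive_const (Im k))].
Qed.

Lemma mixed_partials (S : C -> Prop) (g : C -> R) z :
  open S -> C2_on S g -> S z -> dx (dy g) z = dy (dx g) z.
Proof.
  intros HS (H1 & Hx & Hy) Hz.
  unfold dx, dy; simpl.
  symmetry. rewrite <- (pair_eta z).
  assert (L : locally z S) by now apply HS.
  destruct L as [e He].
  assert (K := Schwarz (fun x y => g (x, y)) (Re z) (Im z)).
  cbv beta in K. simpl. symmetry. apply K.
  - exists e. intros u v Hu Hv.
    assert (Suv : S (u, v)).
    { apply He. split; assumption. }
    destruct (H1 _ Suv) as (A & B & _). destruct (Hx _ Suv) as (_ & D & _).
    destruct (Hy _ Suv) as (E & _). repeat split; assumption.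
  - apply continuity_2d_pt_filterlim. rewrite pair_eta.
    apply (continuous_ext (dx (dy g))); [intros [a b]; reflexivity|]. now apply C1_cont_dx with S.
  - apply continuity_2d_pt_filterlim. rewrite pair_eta.
    apply (continuous_ext (dy (dx g))); [intros [a b]; reflexivity|]. now apply C1_cont_dy with S.
Qed.

(** * Integration of closed one-forms along paths *)

Definition box (z0 : C) (e : R) (z : C) : Prop :=
  Rabs (Re z - Re z0) < e /\ Rabs (Im z - Im z0) < e.

Definition primitive_on (p q : C -> R) (B : C -> Prop) (f : C -> R) : Prop :=
  forall z, B z ->
    differentiable_pt_lim (fun x y => f (x, y)) (Re z) (Im z) (p z) (q z).

(** Formulated with primitives and not with derivatives of p and q, because the homotopies are
    merely continuous and a form cannot be pulled back along them. *)
Definition locally_exact (U : C -> Prop) (p q : C -> R) : Prop :=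
  forall z0, U z0 -> exists e, 0 < e /\ (forall z, box z0 e z -> U z) /\
    exists f, primitive_on p q (box z0 e) f.

Lemma open_box (z0 : C) (e : R) : open (box z0 e).
Proof.
  intros z [H1 H2].
  set (d := Rmin (e - Rabs (Re z - Re z0)) (e - Rabs (Im z - Im z0))).
  assert (Hd : 0 < d) by (apply Rmin_glb_lt; lra).
  exists (mkposreal d Hd). intros y [Hy1 Hy2].
  change (Rabs (Re y - Re z) < d) in Hy1. change (Rabs (Im y - Im z) < d) in Hy2.
  assert (K1 := Rmin_l (e - Rabs (Re z - Re z0)) (e - Rabs (Im z - Im z0))).
  assert (K2 := Rmin_r (e - Rabs (Re z - Re z0)) (e - Rabs (Im z - Im z0))).
  fold d in K1, K2.
  split.
  - replace (Re y - Re z0) with ((Re y - Re z) + (Re z - Re z0)) by ring.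
    eapply Rle_lt_trans; [apply Rabs_triang | lra].
  - replace (Im y - Im z0) with ((Im y - Im z) + (Im z - Im z0)) by ring.
    eapply Rle_lt_trans; [apply Rabs_triang | lra].
Qed.

Lemma open_has_box (U : C -> Prop) (z0 : C) :
  open U -> U z0 -> exists e, 0 < e /\ forall z, box z0 e z -> U z.
Proof.
  intros HU Hz. destruct (HU z0 Hz) as [e He].
  exists e. split; [apply cond_pos|]. intros z [H1 H2]. apply He. split; assumption.
Qed.

Lemma between_abs (a b t e : R) :
  Rabs (b - a) < e -> Rmin a b <= t <= Rmax a b -> Rabs (t - a) < e.
Proof.
  intros H1 H2. revert H1 H2. unfold Rmin, Rmax.
  destruct (Rle_dec a b); unfold Rabs; repeat destruct Rcase_abs; lra.
Qed.

Lemma continuous_slice_x (p : C -> R) (x y : R) :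
  continuous p (x, y) -> continuous (fun x => p (x, y)) x.
Proof.
  intros H. apply (continuous_comp (fun x : R => (x, y) : C) p); [|exact H].
  apply continuous_pair; [apply continuous_id | apply continuous_const].
Qed.

Lemma continuous_slice_y (p : C -> R) (x y : R) :
  continuous p (x, y) -> continuous (fun y => p (x, y)) y.
Proof.
  intros H. apply (continuous_comp (fun y : R => (x, y) : C) p); [|exact H].
  apply continuous_pair; [apply continuous_const | apply continuous_id].
Qed.

Lemma continuous_2d (p : C -> R) (x y : R) :
  continuous p (x, y) -> continuity_2d_pt (fun x y => p (x, y)) x y.
Proof.
  intros H. apply continuity_2d_pt_filterlim.
  apply (continuous_ext p (fun z : R * R => p (fst z, snd z)) (x, y)); [intros [a b]; reflexivity | exact H].
Qed.

(** The primitive integrates p along a horizontal segment from the centre, then q along a vertical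
    one.  In its derivative with respect to x, closedness turns the integral of dq/dx into that of
    dp/dy. *)
Lemma box_C1_primitive (U : C -> Prop) (p q : C -> R) (z0 : C) (e : R) :
  (forall z, box z0 e z -> U z) -> 0 < e -> open U ->
  C1_on U p -> C1_on U q -> (forall z, U z -> dx q z = dy p z) ->
  exists f, primitive_on p q (box z0 e) f.
Proof.
  intros HB He HU Hp Hq Hcl.
  destruct z0 as [x0 y0].
  set (f := fun z : C => RInt (fun x => p (x, y0)) x0 (Re z)
                         + RInt (fun y => q (Re z, y)) y0 (Im z)).
  assert (Cp : forall z, U z -> continuous p z) by (intros; now apply C1_continuous with U).
  assert (Cq : forall z, U z -> continuous q z) by (intros; now apply C1_continuous with U).
  assert (Iq : forall x y, box (x0, y0) e (x, y) -> ex_RInt (fun y => q (x, y)) y0 y).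
  { intros x y [H1 H2]. apply (ex_RInt_continuous (V := R_CompleteNormedModule)). intros t Ht.
    apply continuous_slice_y, Cq, HB. split; [exact H1|]. simpl in *.
    now apply between_abs with y. }
  assert (Ip : forall x, Rabs (x - x0) < e -> ex_RInt (fun x => p (x, y0)) x0 x).
  { intros x H1. apply (ex_RInt_continuous (V := R_CompleteNormedModule)). intros t Ht.
    apply continuous_slice_x, Cp, HB. split; simpl in *.
    - now apply between_abs with x.
    - now rewrite Rminus_diag, Rabs_R0. }
  assert (Dy : forall z, box (x0, y0) e z ->
    is_derive (fun y => f (Re z, y)) (Im z) (q z)).
  { intros [x y] Hz. unfold f; simpl.
    evar_last.
    - apply (is_derive_plus (fun _ : R => RInt (fun x => p (x, y0)) x0 x)
             (fun y => RInt (fun y => q (x, y)) y0 y)).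
      + apply is_derive_const.
      + apply (is_derive_RInt (fun y => q (x, y)) _ y0).
        * apply filter_imp with (2 := open_nbhd_y _ (x, y) (open_box (x0,y0) e) Hz).
          intros y' Hy'. apply (RInt_correct (fun y => q (x, y))). now apply Iq.
        * apply continuous_slice_y, Cq, HB, Hz.
    - apply (plus_zero_l (G := R_AbelianGroup)). }
  assert (Dx : forall z, box (x0, y0) e z ->
    is_derive (fun x => f (x, Im z)) (Re z) (p z)).
  { intros [x y] Hz. unfold f; simpl.
    assert (Hb := Hz). destruct Hb as [Hx Hy]; simpl in Hx, Hy.
    assert (HzB : forall t, Rmin y0 y <= t <= Rmax y0 y -> U (x, t)).
    { intros t Ht. apply HB. split; simpl; [exact Hx | now apply between_abs with y]. }
    evar_last.
    - apply (is_derive_plus (fun x : R => RInt (fun x => p (x, y0)) x0 x)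
             (fun x => RInt (fun y => q (x, y)) y0 y)).
      + apply (is_derive_RInt (fun x => p (x, y0)) _ x0).
        * assert (Hz' : box (x0, y0) e (x, y0)).
          { split; [exact Hx | simpl; now rewrite Rminus_diag, Rabs_R0]. }
          apply filter_imp with (2 := open_nbhd_x _ (x, y0) (open_box (x0,y0) e) Hz').
          intros x' [Hx' _]. apply (RInt_correct (fun x => p (x, y0))). now apply Ip.
        * apply continuous_slice_x, Cp, HB. split; simpl; [exact Hx | now rewrite Rminus_diag, Rabs_R0].
      + apply (is_derive_RInt_param (fun x y => q (x, y)) y0 y x).
        * apply filter_imp with (2 := open_nbhd_x _ (x, y) (open_box (x0,y0) e) Hz).
          intros x' [Hx' _] t Ht.
          eexists. apply (C1_dx U q (x', t) Hq). apply HB. split; simpl in *;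
          [exact Hx' | now apply between_abs with y].
        * intros t Ht. apply (continuous_2d (dx q)). apply (C1_cont_dx U q); [exact Hq|].
          now apply HzB.
        * apply filter_imp with (2 := open_nbhd_x _ (x, y) (open_box (x0,y0) e) Hz).
          intros x' Hx'. now apply Iq.
    - simpl.
      replace (RInt (fun t => Derive (fun u => q (u, t)) x) y0 y) with (p (x, y) - p (x, y0)).
      + unfold plus; simpl. ring.
      + symmetry.
        rewrite (RInt_ext (fun t => Derive (fun u => q (u, t)) x) (Derive (fun t => p (x, t)))).
        * apply RInt_Derive.
          -- intros t Ht. eexists. apply (C1_dy U p (x, t) Hp). now apply HzB.
          -- intros t Ht. apply (continuous_slice_y (dy p)). apply (C1_cont_dy U p); auto.
        * intros t Ht. apply (Hcl (x, t)). apply HzB. lra. }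
  exists f.
  assert (Hf : C1_on (box (x0, y0) e) f).
  { apply (C1_intro _ f p q); [apply open_box|exact Dx|exact Dy| |]; intros z Hz; auto. }
  intros z Hz.
  replace (p z) with (dx f z) by (apply is_derive_unique, Dx, Hz).
  replace (q z) with (dy f z) by (apply is_derive_unique, Dy, Hz).
  apply C1_differentiable with (box (x0, y0) e); [apply open_box | exact Hf | exact Hz].
Qed.

Lemma closed_locally_exact (U : C -> Prop) (p q : C -> R) :
  open U -> C1_on U p -> C1_on U q -> (forall z, U z -> dx q z = dy p z) ->
  locally_exact U p q.
Proof.
  intros HU Hp Hq Hcl z0 Hz0.
  destruct (open_has_box U z0 HU Hz0) as (e & He & HB).
  exists e. repeat split; auto.
  now apply box_C1_primitive with U.
Qed.

Definition C1_path (c : R -> C) : Prop := forall t,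
  ex_derive (fun t => Re (c t)) t /\ ex_derive (fun t => Im (c t)) t /\
  continuous (Derive (fun t => Re (c t))) t /\
  continuous (Derive (fun t => Im (c t))) t.

Definition form_along (p q : C -> R) (c : R -> C) (t : R) : R :=
  p (c t) * Derive (fun t => Re (c t)) t + q (c t) * Derive (fun t => Im (c t)) t.

Lemma C1_path_continuous c t : C1_path c -> continuous c t.
Proof.
  intros H. destruct (H t) as (H1 & H2 & _).
  apply continuous_of_parts; apply (ex_derive_continuous (V := R_NormedModule)); assumption.
Qed.

Lemma continuous_form_along p q c t :
  C1_path c -> continuous p (c t) -> continuous q (c t) ->
  continuous (form_along p q c) t.
Proof.
  intros Hc Hp Hq. assert (Cc := C1_path_continuous c t Hc).
  destruct (Hc t) as (H1 & H2 & H3 & H4).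
  unfold form_along.
  apply (continuous_plus (fun t => p (c t) * _) (fun t => q (c t) * _)).
  - apply (continuous_mult (fun t => p (c t))); [|assumption].
    now apply (continuous_comp c p).
  - apply (continuous_mult (fun t => q (c t))); [|assumption].
    now apply (continuous_comp c q).
Qed.

Lemma path_ftc p q B f c a b :
  primitive_on p q B f -> C1_path c -> a <= b ->
  (forall t, a <= t <= b -> B (c t) /\ continuous p (c t) /\ continuous q (c t)) ->
  is_RInt (form_along p q c) a b (f (c b) - f (c a)).
Proof.
  intros Hf Hc Hab HB.
  apply (is_RInt_derive (V := R_CompleteNormedModule) (fun t => f (c t))).
  - rewrite Rmin_left, Rmax_right by assumption. intros t Ht.
    apply is_derive_ext with (fun t => f (Re (c t), Im (c t))).
    { intros u; now rewrite pair_eta. }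
    apply is_derive_Reals.
    destruct (Hc t) as (H1 & H2 & _).
    apply (derivable_pt_lim_comp_2d (fun x y => f (x, y)) (fun t => Re (c t)) (fun t => Im (c t))).
    + apply Hf, HB, Ht.
    + apply is_derive_Reals. now apply Derive_correct.
    + apply is_derive_Reals. now apply Derive_correct.
  - rewrite Rmin_left, Rmax_right by assumption. intros t Ht.
    apply continuous_form_along; [assumption|apply HB, Ht|apply HB, Ht].
Qed.

Definition segment (a b : C) (t : R) : C :=
  (Re a + t * (Re b - Re a), Im a + t * (Im b - Im a)).

Definition segment_integral (p q : C -> R) (a b : C) : R :=
  RInt (form_along p q (segment a b)) 0 1.

Lemma C1_segment a b : C1_path (segment a b).
Proof.
  intros t. unfold segment; simpl.
  assert (H : forall u v : R, is_derive (fun t => u + t * v) t v).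
  { intros u v. auto_derive; [exact I | ring]. }
  assert (E : forall u v : R, forall t, Derive (fun t => u + t * v) t = v).
  { intros u v s. apply is_derive_unique. auto_derive; [exact I | ring]. }
  repeat split.
  - eexists; apply H.
  - eexists; apply H.
  - apply continuous_ext with (fun _ => Re b - Re a); [intros; now rewrite E|apply continuous_const].
  - apply continuous_ext with (fun _ => Im b - Im a); [intros; now rewrite E|apply continuous_const].
Qed.

Lemma box_segment z0 e a b t :
  box z0 e a -> box z0 e b -> 0 <= t <= 1 -> box z0 e (segment a b t).
Proof.
  intros [H1 H2] [H3 H4] Ht.
  assert (K : forall x y z, Rabs (x - z) < e -> Rabs (y - z) < e ->
     Rabs (x + t * (y - x) - z) < e).
  { intros x y z Hx Hy. apply Rabs_def2 in Hx. apply Rabs_def2 in Hy.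
    assert (M : forall u v, u < e -> v < e -> u + t * (v - u) < e).
    { intros u v Hu Hv. assert (0 <= t * (e - v)) by (apply Rmult_le_pos; lra).
      assert (0 <= (1 - t) * (e - u)) by (apply Rmult_le_pos; lra).
      destruct (Rle_lt_dec t (1 / 2)).
      - assert (0 < (1 - t) * (e - u)) by (apply Rmult_lt_0_compat; lra). lra.
      - assert (0 < t * (e - v)) by (apply Rmult_lt_0_compat; lra). lra. }
    assert (M1 := M (x - z) (y - z) ltac:(lra) ltac:(lra)).
    assert (M2 := M (z - x) (z - y) ltac:(lra) ltac:(lra)).
    apply Rabs_def1; lra. }
  split; apply K; assumption.
Qed.

Lemma segment_integral_eq p q z0 e f a b :
  primitive_on p q (box z0 e) f ->
  (forall z, box z0 e z -> continuous p z /\ continuous q z) ->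
  box z0 e a -> box z0 e b -> segment_integral p q a b = f b - f a.
Proof.
  intros Hf Hc Ha Hb. unfold segment_integral.
  apply is_RInt_unique.
  assert (E0 : segment a b 0 = a).
  { destruct a, b. unfold segment; simpl. f_equal; ring. }
  assert (E1 : segment a b 1 = b).
  { destruct a, b. unfold segment; simpl. f_equal; ring. }
  replace (f b - f a) with (f (segment a b 1) - f (segment a b 0)) by now rewrite E0, E1.
  apply path_ftc with (box z0 e); [assumption|apply C1_segment|lra|].
  intros t Ht. split; [|apply Hc]; now apply box_segment.
Qed.

Fixpoint chain (p q : C -> R) (c : R -> C) (N j : nat) : R :=
  match j with
  | O => 0
  | S i => chain p q c N i
           + segment_integral p q (c (INR i / INR N)) (c (INR (S i) / INR N))
  end.

(** For a locally exact form, the polygons inscribed in the path all give the same value as soon as they are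
    fine enough; this defines the integral along a path that is only continuous. *)
Definition integral_along (p q : C -> R) (c : R -> C) (I : R) : Prop :=
  exists N0 : nat, forall N, (N0 <= N)%nat -> chain p q c (S N) (S N) = I.

Lemma integral_along_unique p q c I J :
  integral_along p q c I -> integral_along p q c J -> I = J.
Proof.
  intros [N0 H0] [N1 H1]. rewrite <- (H0 (max N0 N1)), <- (H1 (max N0 N1)); lia || reflexivity.
Qed.

Lemma grid_in (N i : nat) : (i <= S N)%nat -> 0 <= INR i / INR (S N) <= 1.
Proof.
  intros H. assert (0 < INR (S N)) by (apply lt_0_INR; lia).
  apply le_INR in H. assert (0 <= INR i) by apply pos_INR.
  split.
  - apply Rmult_le_pos; [lra | left; now apply Rinv_0_lt_compat].
  - apply Rmult_le_reg_r with (INR (S N)); [lra|].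
    unfold Rdiv. rewrite Rmult_assoc, Rinv_l by lra. lra.
Qed.

Lemma grid_step (N i : nat) : INR (S i) / INR (S N) = INR i / INR (S N) + / INR (S N).
Proof.
  assert (0 < INR (S N)) by (apply lt_0_INR; lia). rewrite (S_INR i). field. lra.
Qed.

Lemma chain_ext p q c c' N j :
  (forall t, 0 <= t <= 1 -> c t = c' t) -> (j <= S N)%nat ->
  chain p q c (S N) j = chain p q c' (S N) j.
Proof.
  intros E. induction j as [|j IH]; intros Hj; [reflexivity|].
  cbn [chain]. rewrite IH by lia. rewrite !E by (apply grid_in; lia). reflexivity.
Qed.

Lemma integral_along_ext p q c c' I :
  (forall t, 0 <= t <= 1 -> c t = c' t) ->
  integral_along p q c I -> integral_along p q c' I.
Proof.
  intros E [N0 H]. exists N0. intros N HN. rewrite <- (H N HN).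
  symmetry. apply chain_ext; [assumption | lia].
Qed.

Lemma exists_small_step d : 0 < d -> exists N0 : nat, forall N, (N0 <= N)%nat -> / INR (S N) < d.
Proof.
  intros Hd. exists (Z.to_nat (up (/ d))). intros N HN.
  assert (Hi : 0 < / d) by now apply Rinv_0_lt_compat.
  rewrite <- (Rinv_inv d). apply Rinv_lt_contravar.
  - apply Rmult_lt_0_compat; [lra | apply lt_0_INR; lia].
  - destruct (archimed (/ d)) as [K _].
    apply Rlt_le_trans with (IZR (up (/ d))); [lra|].
    apply le_INR in HN. apply Rle_trans with (INR N); [|apply le_INR; lia].
    rewrite INR_IZR_INZ, Z2Nat.id in HN; [exact HN|].
    apply le_IZR. lra.
Qed.

Section Cover.
Variables (U : C -> Prop) (p q : C -> R).
Hypothesis (Cp : forall z, U z -> continuous p z) (Cq : forall z, U z -> continuous q z).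
Hypothesis HE : locally_exact U p q.

(** The square is compact, so it has a Lebesgue number for the covering by the inverse images of
    the boxes that carry a primitive. *)
Lemma lebesgue_number (h : R * R -> C) :
  (forall x, continuous h x) ->
  (forall s t, 0 <= s <= 1 -> 0 <= t <= 1 -> U (h (s, t))) ->
  exists d, 0 < d /\ forall s t, 0 <= s <= 1 -> 0 <= t <= 1 ->
    exists z0 e f, (forall z, box z0 e z -> U z) /\ primitive_on p q (box z0 e) f /\
      forall s' t', Rabs (s' - s) < d -> Rabs (t' - t) < d -> box z0 e (h (s', t')).
Proof.
  intros Hh HU.
  assert (L : forall u v, exists d : posreal, 0 <= u <= 1 -> 0 <= v <= 1 ->
    exists z0 e f, (forall z, box z0 e z -> U z) /\ primitive_on p q (box z0 e) f /\
      forall s' t', Rabs (s' - u) < 2 * d -> Rabs (t' - v) < 2 * d -> box z0 e (h (s', t'))).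
  { intros u v.
    destruct (excluded_middle_informative (0 <= u <= 1 /\ 0 <= v <= 1)) as [[Hu Hv]|N].
    2: { exists (mkposreal 1 Rlt_0_1). tauto. }
    destruct (HE (h (u, v)) (HU u v Hu Hv)) as (e & He & HB & f & Hf).
    assert (Hb0 : box (h (u, v)) e (h (u, v))).
    { split; rewrite Rminus_diag, Rabs_R0; assumption. }
    assert (K := Hh (u, v) _ (open_box (h (u, v)) e _ Hb0)).
    destruct K as [d Hd].
    assert (Hd2 : 0 < d / 2) by (destruct d; simpl; lra).
    exists (mkposreal (d / 2) Hd2). intros _ _.
    exists (h (u, v)), e, f. repeat (split; [assumption|]).
    intros s' t' Hs Ht. apply Hd. simpl in Hs, Ht. split; [|].
    - change (Rabs (s' - u) < d). lra.
    - change (Rabs (t' - v) < d). lra. }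
  set (delta := fun u v => proj1_sig (constructive_indefinite_description _ (L u v))).
  destruct (compactness_value_2d 0 1 0 1 delta) as [d Hd].
  exists d. split; [apply cond_pos|]. intros s t Hs Ht.
  destruct (classic (exists u v : R,
       0 <= u <= 1 /\ 0 <= v <= 1 /\
       Rabs (s - u) < delta u v /\ Rabs (t - v) < delta u v /\ d <= delta u v)) as [K|K];
    [|exfalso; now apply (Hd s t)].
  destruct K as (u & v & Hu & Hv & H1 & H2 & H3).
  unfold delta in *.
  destruct (constructive_indefinite_description _ (L u v)) as [dl Hdl]; simpl in *.
  destruct (Hdl Hu Hv) as (z0 & e & f & HB & Hf & HH).
  exists z0, e, f. repeat (split; [assumption|]).
  intros s' t' Hs' Ht'. apply HH.
  - replace (s' - u) with ((s' - s) + (s - u)) by ring.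
    eapply Rle_lt_trans; [apply Rabs_triang | lra].
  - replace (t' - v) with ((t' - t) + (t - v)) by ring.
    eapply Rle_lt_trans; [apply Rabs_triang | lra].
Qed.

(** On a fine grid, each cell of the square is sent into a box with a primitive, so both ways
    around it give the same sum.  Adding up the cells of a row, the sums over two successive
    polygons differ by the contributions of the two ends, which cancel because the loops close up. *)
Lemma chain_homotopy (h : R * R -> C) (I : R) :
  (forall x, continuous h x) ->
  (forall s t, 0 <= s <= 1 -> 0 <= t <= 1 -> U (h (s, t))) ->
  (forall s, 0 <= s <= 1 -> h (s, 0) = h (s, 1)) ->
  integral_along p q (fun t => h (0, t)) I -> integral_along p q (fun t => h (1, t)) I.
Proof.
  intros Hh HU Hcl [N1 HI].
  destruct (lebesgue_number h Hh HU) as (d & Hd & HL).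
  destruct (exists_small_step d Hd) as [N2 HN2].
  exists (max N1 N2). intros N HN.
  rewrite <- (HI N) by lia.
  assert (Hst : / INR (S N) < d) by (apply HN2; lia).
  assert (Hp : 0 < / INR (S N)) by (apply Rinv_0_lt_compat, lt_0_INR; lia).
  set (gr := fun i => INR i / INR (S N)).
  assert (Hgr : forall i, gr (S i) = gr i + / INR (S N)) by (intros; apply grid_step).
  assert (Cell : forall i j, (i < S N)%nat -> (j < S N)%nat ->
    segment_integral p q (h (gr i, gr j)) (h (gr i, gr (S j))) +
    segment_integral p q (h (gr i, gr (S j))) (h (gr (S i), gr (S j))) =
    segment_integral p q (h (gr i, gr j)) (h (gr (S i), gr j)) +
    segment_integral p q (h (gr (S i), gr j)) (h (gr (S i), gr (S j)))).
  { intros i j Hi Hj.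
    destruct (HL (gr i) (gr j)) as (z0 & e & f & HB & Hf & HH);
      [apply grid_in; lia | apply grid_in; lia |].
    assert (D0 : forall k, Rabs (gr k - gr k) < d) by (intros; rewrite Rminus_diag, Rabs_R0; lra).
    assert (D1 : forall k, Rabs (gr (S k) - gr k) < d).
    { intros k. rewrite Hgr. replace (gr k + / INR (S N) - gr k) with (/ INR (S N)) by ring.
      rewrite Rabs_pos_eq; lra. }
    assert (HC : forall z, box z0 e z -> continuous p z /\ continuous q z) by auto.
    rewrite !(segment_integral_eq p q z0 e f); auto; ring. }
  assert (Row : forall i j, (i < S N)%nat -> (j <= S N)%nat ->
    chain p q (fun t => h (gr i, t)) (S N) j +
    segment_integral p q (h (gr i, gr j)) (h (gr (S i), gr j)) =
    segment_integral p q (h (gr i, gr 0%nat)) (h (gr (S i), gr 0%nat)) +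
    chain p q (fun t => h (gr (S i), t)) (S N) j).
  { intros i j Hi. induction j as [|j IH]; intros Hj; [cbn [chain]; ring|].
    cbn [chain]. specialize (IH ltac:(lia)). specialize (Cell i j Hi ltac:(lia)).
    fold (gr j) (gr (S j)). lra. }
  assert (G0 : gr 0%nat = 0) by (unfold gr; simpl; unfold Rdiv; ring).
  assert (G1 : gr (S N) = 1).
  { unfold gr. field. apply not_0_INR. lia. }
  assert (All : forall i, (i <= S N)%nat ->
    chain p q (fun t => h (gr i, t)) (S N) (S N) = chain p q (fun t => h (0, t)) (S N) (S N)).
  { induction i as [|i IH]; intros Hi; [now rewrite G0|].
    rewrite <- IH by lia. specialize (Row i (S N) ltac:(lia) ltac:(lia)).
    rewrite G0, G1 in Row.
    rewrite !Hcl in Row by (apply grid_in; lia). lra. }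
  specialize (All (S N) ltac:(lia)). rewrite G1 in All. exact All.
Qed.

(** On each piece of a fine subdivision the arc and its chord lie in a box with a primitive. *)
Lemma integral_along_C1 (c : R -> C) :
  C1_path c -> (forall t, 0 <= t <= 1 -> U (c t)) ->
  integral_along p q c (RInt (form_along p q c) 0 1).
Proof.
  intros Hc HU.
  destruct (lebesgue_number (fun x => c (snd x))) as (d & Hd & HL).
  { intros x. apply (continuous_comp snd c); [apply continuous_snd|now apply C1_path_continuous]. }
  { intros s t _ Ht. now apply HU. }
  destruct (exists_small_step d Hd) as [N0 HN0].
  exists N0. intros N HN.
  assert (Hst : / INR (S N) < d) by (apply HN0; lia).
  assert (Hp : 0 < / INR (S N)) by (apply Rinv_0_lt_compat, lt_0_INR; lia).
  set (gr := fun i => INR i / INR (S N)).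
  assert (Hgr : forall i, gr (S i) = gr i + / INR (S N)) by (intros; apply grid_step).
  assert (G0 : gr 0%nat = 0) by (unfold gr; simpl; unfold Rdiv; ring).
  assert (G1 : gr (S N) = 1).
  { unfold gr. field. apply not_0_INR. lia. }
  assert (All : forall j, (j <= S N)%nat ->
    is_RInt (form_along p q c) 0 (gr j) (chain p q c (S N) j)).
  { induction j as [|j IH]; intros Hj.
    - rewrite G0. cbn [chain]. apply (is_RInt_point (form_along p q c)).
    - cbn [chain].
      apply (is_RInt_Chasles (form_along p q c) _ (gr j)); [apply IH; lia|].
      fold (gr j) (gr (S j)).
      destruct (HL 0 (gr j)) as (z0 & e & f & HB & Hf & HH); [lra|apply grid_in; lia|].
      assert (HBt : forall t, gr j <= t <= gr (S j) -> box z0 e (c t)).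
      { intros t Ht. apply (HH 0 t); [rewrite Rminus_diag, Rabs_R0; lra|].
        rewrite Hgr in Ht. rewrite Rabs_pos_eq; lra. }
      assert (Hle : gr j <= gr (S j)) by (rewrite Hgr; lra).
      assert (Hb0 : box z0 e (c (gr j))) by (apply HBt; lra).
      assert (Hb1 : box z0 e (c (gr (S j)))) by (apply HBt; lra).
      rewrite (segment_integral_eq p q z0 e f (c (gr j)) (c (gr (S j))) Hf); auto.
      apply path_ftc with (box z0 e); [exact Hf | exact Hc | exact Hle |].
      intros t Ht. assert (Hbt := HBt t Ht). auto. }
  symmetry. apply is_RInt_unique. rewrite <- G1 at 1. apply All. lia.
Qed.
End Cover.

(** * The argument along a path *)

Definition nonzeroC (z : C) : Prop := z <> 0%C.
(** The form arg_x dx + arg_y dy is the differential of the argument. *)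
Definition arg_x (z : C) : R := - Im z / (Re z ^ 2 + Im z ^ 2).
Definition arg_y (z : C) : R := Re z / (Re z ^ 2 + Im z ^ 2).

Lemma nonzero_norm (z : C) : nonzeroC z -> 0 < Re z ^ 2 + Im z ^ 2.
Proof.
  destruct z as [x y]; unfold nonzeroC; simpl. intros H.
  destruct (Req_dec x 0) as [->|Hx]; [destruct (Req_dec y 0) as [->|Hy]|]; [now elim H| |]; nra.
Qed.

Lemma norm_nonzero (z : C) : 0 < Re z ^ 2 + Im z ^ 2 -> nonzeroC z.
Proof. intros H E. rewrite E in H. simpl in H. lra. Qed.

Lemma open_nonzero : open nonzeroC.
Proof.
  intros z Hz. apply nonzero_norm in Hz.
  assert (K : continuous (fun z => Re z ^ 2 + Im z ^ 2) z).
  { apply continuous_ext with (fun z => Re z * Re z + Im z * Im z); [intros; simpl; ring|].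
    assert (HR := continuous_Re z). assert (HI := continuous_Im z). cont. }
  apply filter_imp with (fun z => 0 < Re z ^ 2 + Im z ^ 2); [intros; now apply norm_nonzero|].
  apply (K (fun x => 0 < x)). now apply (open_gt 0).
Qed.

Lemma C1_Re (S : C -> Prop) : open S -> C1_on S Re.
Proof.
  intros HS. apply (C1_intro S Re (fun _ => 1) (fun _ => 0)); auto; intros z Hz;
    try apply continuous_const; simpl.
  - apply (is_derive_id (Re z)).
  - apply (is_derive_const (Re z)).
Qed.

Lemma C1_Im (S : C -> Prop) : open S -> C1_on S Im.
Proof.
  intros HS. apply (C1_intro S Im (fun _ => 0) (fun _ => 1)); auto; intros z Hz;
    try apply continuous_const; simpl.
  - apply (is_derive_const (Im z)).
  - apply (is_derive_id (Im z)).
Qed.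

Lemma C1_norm_inv : C1_on nonzeroC (fun z => / (Re z ^ 2 + Im z ^ 2)).
Proof.
  assert (HR := C1_Re nonzeroC open_nonzero). assert (HI := C1_Im nonzeroC open_nonzero).
  apply (C1_inv nonzeroC open_nonzero).
  - intros z Hz. apply nonzero_norm in Hz. lra.
  - apply C1_ext with (fun z => Re z * Re z + Im z * Im z).
    + apply open_nonzero.
    + intros; ring.
    + apply C1_plus; [apply open_nonzero| |]; apply C1_mult; auto; apply open_nonzero.
Qed.

Lemma C1_arg : C1_on nonzeroC arg_x /\ C1_on nonzeroC arg_y.
Proof.
  assert (HR := C1_Re nonzeroC open_nonzero). assert (HI := C1_Im nonzeroC open_nonzero).
  split; apply C1_mult; try apply C1_norm_inv; try apply open_nonzero; auto.
  now apply C1_opp; [apply open_nonzero|].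
Qed.

Lemma arg_closed z : nonzeroC z -> dx arg_y z = dy arg_x z.
Proof.
  intros Hz. apply nonzero_norm in Hz. destruct z as [x y]. simpl in Hz.
  unfold dx, dy, arg_x, arg_y. simpl.
  transitivity ((y ^ 2 - x ^ 2) / (x ^ 2 + y ^ 2) ^ 2); [|symmetry];
    apply is_derive_unique; auto_derive; simpl; try nra; field; nra.
Qed.

Lemma continuous_arg z : nonzeroC z -> continuous arg_x z /\ continuous arg_y z.
Proof.
  intros Hz. destruct C1_arg as [H1 H2].
  split; apply C1_continuous with nonzeroC; auto; apply open_nonzero.
Qed.

Lemma arg_exact : locally_exact nonzeroC arg_x arg_y.
Proof.
  destruct C1_arg. apply closed_locally_exact; auto. apply open_nonzero. apply arg_closed.
Qed.

(** The value I is the total change of the argument, that is 2 pi times the winding number. *)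
Definition winding (c : R -> C) (I : R) : Prop := integral_along arg_x arg_y c I.

Lemma winding_homotopy (h : R * R -> C) (I : R) :
  (forall x, continuous h x) ->
  (forall s t, 0 <= s <= 1 -> 0 <= t <= 1 -> nonzeroC (h (s, t))) ->
  (forall s, 0 <= s <= 1 -> h (s, 0) = h (s, 1)) ->
  winding (fun t => h (0, t)) I -> winding (fun t => h (1, t)) I.
Proof.
  apply chain_homotopy with (U := nonzeroC); try apply arg_exact;
    intros; now apply continuous_arg.
Qed.

Lemma winding_C1 (c : R -> C) :
  C1_path c -> (forall t, 0 <= t <= 1 -> nonzeroC (c t)) ->
  winding c (RInt (form_along arg_x arg_y c) 0 1).
Proof.
  apply integral_along_C1 with (U := nonzeroC); try apply arg_exact;
    intros; now apply continuous_arg.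
Qed.

Lemma C1_path_intro (c : R -> C) (a b : R -> R) :
  (forall t, is_derive (fun t => Re (c t)) t (a t)) ->
  (forall t, is_derive (fun t => Im (c t)) t (b t)) ->
  (forall t, continuous a t) -> (forall t, continuous b t) -> C1_path c.
Proof.
  intros Ha Hb Ca Cb t. repeat split.
  - eexists; apply Ha.
  - eexists; apply Hb.
  - apply continuous_ext with a; [|apply Ca]. intros x; symmetry; now apply is_derive_unique.
  - apply continuous_ext with b; [|apply Cb]. intros x; symmetry; now apply is_derive_unique.
Qed.

Definition path_velocity (c : R -> C) (t : R) : C :=
  (Derive (fun t => Re (c t)) t, Derive (fun t => Im (c t)) t).

Lemma vel_intro c t (l : C) :
  is_derive (fun t => Re (c t)) t (Re l) -> is_derive (fun t => Im (c t)) t (Im l) ->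
  path_velocity c t = l.
Proof.
  intros H1 H2. rewrite <- (pair_eta l). unfold path_velocity. f_equal; now apply is_derive_unique.
Qed.

Lemma C1_path_vel c t : C1_path c ->
  is_derive (fun t => Re (c t)) t (Re (path_velocity c t)) /\
  is_derive (fun t => Im (c t)) t (Im (path_velocity c t)).
Proof.
  intros H. destruct (H t) as (H1 & H2 & _). split; now apply Derive_correct.
Qed.

Lemma C1_path_cont_vel c t : C1_path c -> continuous (path_velocity c) t.
Proof.
  intros H. destruct (H t) as (_ & _ & H3 & H4). now apply continuous_pair.
Qed.

Lemma C1_path_of_vel c (v : R -> C) :
  (forall t, is_derive (fun t => Re (c t)) t (Re (v t)) /\
             is_derive (fun t => Im (c t)) t (Im (v t))) ->
  (forall t, continuous v t) -> C1_path c.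
Proof.
  intros H Hv. apply (C1_path_intro c (fun t => Re (v t)) (fun t => Im (v t))).
  - apply H.
  - apply H.
  - intros t. apply (continuous_comp v Re); [apply Hv | apply continuous_Re].
  - intros t. apply (continuous_comp v Im); [apply Hv | apply continuous_Im].
Qed.

Lemma C1_path_mult c d : C1_path c -> C1_path d ->
  C1_path (fun t => c t * d t)%C /\
  forall t, path_velocity (fun t => c t * d t)%C t = (path_velocity c t * d t + c t * path_velocity d t)%C.
Proof.
  intros Hc Hd.
  assert (K : forall t,
    is_derive (fun t => Re (c t * d t)%C) t (Re (path_velocity c t * d t + c t * path_velocity d t)%C) /\
    is_derive (fun t => Im (c t * d t)%C) t (Im (path_velocity c t * d t + c t * path_velocity d t)%C)).
  { intros t. destruct (C1_path_vel c t Hc), (C1_path_vel d t Hd). now apply is_derive_Cmult. }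
  split.
  - apply (C1_path_of_vel _ (fun t => path_velocity c t * d t + c t * path_velocity d t)%C K).
    intros t. assert (Cc := C1_path_continuous c t Hc). assert (Cd := C1_path_continuous d t Hd).
    assert (Vc := C1_path_cont_vel c t Hc). assert (Vd := C1_path_cont_vel d t Hd). cont.
  - intros t. exact (vel_intro _ t _ (proj1 (K t)) (proj2 (K t))).
Qed.

Lemma C1_path_const k : C1_path (fun _ => k) /\ forall t, path_velocity (fun _ => k) t = 0%C.
Proof.
  assert (K : forall t : R, is_derive (fun _ : R => Re k) t 0 /\ is_derive (fun _ : R => Im k) t 0).
  { intros t; split; [apply (is_derive_const (Re k)) | apply (is_derive_const (Im k))]. }
  split.
  - apply (C1_path_of_vel _ (fun _ => 0%C) K). intros; apply continuous_const.
  - intros t. exact (vel_intro (fun _ => k) t 0%C (proj1 (K t)) (proj2 (K t))).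
Qed.

Lemma C1_path_plus c d : C1_path c -> C1_path d ->
  C1_path (fun t => c t + d t)%C /\
  forall t, path_velocity (fun t => c t + d t)%C t = (path_velocity c t + path_velocity d t)%C.
Proof.
  intros Hc Hd.
  assert (K : forall t,
    is_derive (fun t => Re (c t + d t)%C) t (Re (path_velocity c t + path_velocity d t)%C) /\
    is_derive (fun t => Im (c t + d t)%C) t (Im (path_velocity c t + path_velocity d t)%C)).
  { intros t. destruct (C1_path_vel c t Hc), (C1_path_vel d t Hd). split.
    - now apply (is_derive_plus (fun t => Re (c t)) (fun t => Re (d t))).
    - now apply (is_derive_plus (fun t => Im (c t)) (fun t => Im (d t))). }
  split.
  - apply (C1_path_of_vel _ (fun t => path_velocity c t + path_velocity d t)%C K).
    intros t. apply continuous_Cplus; now apply C1_path_cont_vel.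
  - intros t. exact (vel_intro _ t _ (proj1 (K t)) (proj2 (K t))).
Qed.

Lemma C1_path_conj c : C1_path c ->
  C1_path (fun t => Cconj (c t)) /\ forall t, path_velocity (fun t => Cconj (c t)) t = Cconj (path_velocity c t).
Proof.
  intros Hc.
  assert (K : forall t,
    is_derive (fun t => Re (Cconj (c t))) t (Re (Cconj (path_velocity c t))) /\
    is_derive (fun t => Im (Cconj (c t))) t (Im (Cconj (path_velocity c t)))).
  { intros t. destruct (C1_path_vel c t Hc). split; [assumption|].
    now apply (is_derive_opp (fun t => Im (c t))). }
  split.
  - apply (C1_path_of_vel _ (fun t => Cconj (path_velocity c t)) K).
    intros t. apply continuous_Cconj; now apply C1_path_cont_vel.
  - intros t. exact (vel_intro _ t _ (proj1 (K t)) (proj2 (K t))).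
Qed.

Lemma C1_path_affine c a b : C1_path c ->
  C1_path (fun t => c (a + b * t)) /\
  forall t, path_velocity (fun t => c (a + b * t)) t = (RtoC b * path_velocity c (a + b * t)%R)%C.
Proof.
  intros Hc.
  assert (A : forall t : R, is_derive (fun t => a + b * t) t b).
  { intros t. auto_derive; [exact I | ring]. }
  assert (K : forall t,
    is_derive (fun t => Re (c (a + b * t))) t (Re (RtoC b * path_velocity c (a + b * t)%R)%C) /\
    is_derive (fun t => Im (c (a + b * t))) t (Im (RtoC b * path_velocity c (a + b * t)%R)%C)).
  { intros t. destruct (C1_path_vel c (a + b * t) Hc) as [H1 H2]. split.
    - evar_last; [apply (is_derive_comp (fun t => Re (c t)) _ t _ _ H1 (A t))|].
      unfold scal; simpl; unfold mult; simpl. unfold Re, Im. ring.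
    - evar_last; [apply (is_derive_comp (fun t => Im (c t)) _ t _ _ H2 (A t))|].
      unfold scal; simpl; unfold mult; simpl. unfold Re, Im. ring. }
  split.
  - apply (C1_path_of_vel _ _ K). intros t.
    apply continuous_Cmult; [apply continuous_const|].
    apply (continuous_comp (fun t => a + b * t) (path_velocity c)).
    + apply (ex_derive_continuous (fun t => a + b * t)). now exists b.
    + now apply C1_path_cont_vel.
  - intros t. exact (vel_intro _ t _ (proj1 (K t)) (proj2 (K t))).
Qed.

Ltac eta_derive f := change (Derive (fun x0 : R => f x0)) with (Derive f).

Section Angle.
Variables (M : R -> C) (HM : C1_path M) (HN : forall t, nonzeroC (M t)).
Let L (t : R) : R := RInt (form_along arg_x arg_y M) 0 t.

Lemma angle_derive t : is_derive L t (form_along arg_x arg_y M t).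
Proof.
  assert (K : forall t, continuous (form_along arg_x arg_y M) t).
  { intros u. apply continuous_form_along; auto; now apply continuous_arg. }
  apply (is_derive_RInt (form_along arg_x arg_y M) L 0); [|apply K].
  apply filter_forall. intros u. apply (RInt_correct (form_along arg_x arg_y M)).
  apply (ex_RInt_continuous (V := R_CompleteNormedModule)). intros; apply K.
Qed.

(** L is a continuous determination of the argument of M.  The two components of M in the frame
    rotated by L satisfy the differential equation w' = r w that the modulus of M satisfies as well;
    so their quotients by the modulus are constant, and they are known at time 0. *)
Lemma angle_spec : Im (M 0) = 0 -> 0 < Re (M 0) ->
  forall t, exists u, 0 < u /\ Re (M t) = u * cos (L t) /\ Im (M t) = u * sin (L t).
Proof.
  intros HI HR.
  set (x := fun t => Re (M t)). set (y := fun t => Im (M t)).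
  set (N := fun t => x t ^ 2 + y t ^ 2).
  assert (HNp : forall t, 0 < N t) by (intros t; apply nonzero_norm, HN).
  set (u := fun t => (x t * cos (L t) + y t * sin (L t))).
  set (v := fun t => (y t * cos (L t) - x t * sin (L t))).
  assert (Dx : forall t, is_derive x t (Re (path_velocity M t))) by (intros t; exact (proj1 (C1_path_vel M t HM))).
  assert (Dy : forall t, is_derive y t (Im (path_velocity M t))) by (intros t; exact (proj2 (C1_path_vel M t HM))).
  set (r := fun t => (x t * Re (path_velocity M t) + y t * Im (path_velocity M t)) / N t).
  assert (DL : forall t, is_derive L t ((x t * Im (path_velocity M t) - y t * Re (path_velocity M t)) / N t)).
  { intros t. evar_last; [apply angle_derive|]. unfold form_along, arg_x, arg_y.
    fold (x t) (y t). unfold path_velocity, Re, Im; simpl. specialize (HNp t). unfold N in *.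
    field. simpl in HNp. lra. }
  assert (Du : forall t, is_derive u t (r t * u t)).
  { intros t. unfold u. auto_derive.
    - repeat split; eexists; [apply Dx|apply DL|apply Dy|apply DL].
    - eta_derive x; eta_derive y; eta_derive L.
      rewrite (is_derive_unique _ _ _ (Dx t)), (is_derive_unique _ _ _ (Dy t)).
      rewrite (is_derive_unique L _ _ (DL t)). unfold r. specialize (HNp t). unfold N in *.
      field. simpl in HNp. lra. }
  assert (Dv : forall t, is_derive v t (r t * v t)).
  { intros t. unfold v. auto_derive.
    - repeat split; eexists; [apply Dy|apply DL|apply Dx|apply DL].
    - eta_derive x; eta_derive y; eta_derive L.
      rewrite (is_derive_unique _ _ _ (Dx t)), (is_derive_unique _ _ _ (Dy t)).
      rewrite (is_derive_unique L _ _ (DL t)). unfold r. specialize (HNp t). unfold N in *.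
      field. simpl in HNp. lra. }
  assert (DN : forall t, is_derive N t (2 * r t * N t)).
  { intros t. unfold N. auto_derive.
    - repeat split; eexists; [apply Dx|apply Dy].
    - eta_derive x; eta_derive y.
      rewrite (is_derive_unique _ _ _ (Dx t)), (is_derive_unique _ _ _ (Dy t)).
      unfold r. specialize (HNp t). unfold N in *. field. simpl in HNp. lra. }
  assert (Const : forall w, (forall t, is_derive w t (r t * w t)) -> forall t,
    w t ^ 2 / N t = w 0 ^ 2 / N 0).
  { intros w Hw t.
    assert (D0 : forall t, is_derive (fun t => w t ^ 2 / N t) t 0).
    { intros s. auto_derive.
      - repeat split; [eexists; apply Hw | eexists; apply DN |]. specialize (HNp s). lra.
      - eta_derive w; eta_derive N.
        rewrite (is_derive_unique w _ _ (Hw s)), (is_derive_unique N _ _ (DN s)).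
        field. specialize (HNp s). lra. }
    destruct (MVT_gen (fun t => w t ^ 2 / N t) 0 t (fun _ => 0)) as (c & _ & Hc).
    - intros; apply D0.
    - intros s _. apply continuity_pt_filterlim.
      apply (ex_derive_continuous (fun t => w t ^ 2 / N t)). now exists 0.
    - lra. }
  assert (L0 : L 0 = 0) by apply (RInt_point (V := R_CompleteNormedModule)).
  assert (v0 : v 0 = 0). { unfold v, y. rewrite HI, L0, sin_0. ring. }
  assert (u0 : u 0 = x 0). { unfold u, y. rewrite HI, L0, cos_0. ring. }
  assert (vz : forall t, v t = 0).
  { intros t. assert (K := Const v Dv t). rewrite v0 in K. specialize (HNp t).
    assert (v t ^ 2 = 0).
    { apply Rmult_eq_reg_r with (/ N t); [|apply Rinv_neq_0_compat; lra].
      unfold Rdiv in K. rewrite K. ring. }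
    nra. }
  assert (unz : forall t, u t <> 0).
  { intros t E. assert (K := Const u Du t). rewrite u0, E in K.
    assert (P0 := HNp 0). unfold x in K at 1.
    assert (0 < Re (M 0) ^ 2 / N 0) by (apply Rdiv_lt_0_compat; [apply pow_lt|]; lra).
    unfold Rdiv in K at 1. rewrite pow_i in K by lia. unfold x in *. lra. }
  assert (up : forall t, 0 < u t).
  { intros t. destruct (Rle_lt_dec (u t) 0) as [Hle|]; [|assumption].
    destruct (IVT_gen u 0 t 0) as (s & _ & Hs).
    - intros s. apply continuity_pt_filterlim. apply (ex_derive_continuous u). now exists (r s * u s).
    - rewrite u0. unfold x at 1 2. split; [apply Rle_trans with (u t); [apply Rmin_r|assumption]|].
      apply Rle_trans with (Re (M 0)); [lra | apply Rmax_l].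
    - now elim (unz s). }
  intros t. exists (u t). split; [apply up|].
  assert (V := vz t). assert (S2 := sin2_cos2 (L t)). unfold Rsqr in S2.
  unfold u, v in *. fold (x t) (y t). split.
  - transitivity (x t * (sin (L t) * sin (L t) + cos (L t) * cos (L t))); [rewrite S2; ring|].
    transitivity (x t * (sin (L t) * sin (L t) + cos (L t) * cos (L t)) + sin (L t) * (y t * cos (L t) - x t * sin (L t))); [rewrite V|]; ring.
  - transitivity (y t * (sin (L t) * sin (L t) + cos (L t) * cos (L t))); [rewrite S2; ring|].
    transitivity (y t * (sin (L t) * sin (L t) + cos (L t) * cos (L t)) - cos (L t) * (y t * cos (L t) - x t * sin (L t))); [rewrite V|]; ring.
Qed.
End Angle.

(** The derivative may change its sign arbitrarily close to a, so f is only compared with f a. *)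
Lemma derive_neg_local (f : R -> R) (a l : R) :
  is_derive f a l -> l < 0 ->
  exists d, 0 < d /\ forall h, 0 < h < d -> f (a + h) < f a /\ f a < f (a - h).
Proof.
  intros Hf Hl. apply is_derive_Reals in Hf.
  assert (He : 0 < - l) by lra.
  destruct (Hf (- l) He) as [d Hd].
  exists d. split; [apply cond_pos|]. intros h Hh. split.
  - assert (K := Hd h ltac:(lra) ltac:(rewrite Rabs_pos_eq; lra)).
    apply Rabs_def2 in K. destruct K as [K _].
    assert ((f (a + h) - f a) / h < 0) by lra.
    assert (E : f (a + h) - f a = (f (a + h) - f a) / h * h) by (field; lra). nra.
  - assert (K := Hd (- h) ltac:(lra) ltac:(rewrite Rabs_Ropp, Rabs_pos_eq; lra)).
    apply Rabs_def2 in K. destruct K as [K _].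
    assert ((f (a + - h) - f a) / - h < 0) by lra.
    assert (E : f (a + - h) - f a = (f (a + - h) - f a) / - h * - h) by (field; lra).
    unfold Rminus at 1. nra.
Qed.

(** * The winding number at an extremal point *)

Lemma periodic_Z {A : Type} (g : R -> A) :
  (forall t, g (t + 1) = g t) -> forall (n : Z) t, g (t + IZR n) = g t.
Proof.
  intros H.
  assert (P : forall (n : nat) t, g (t + INR n) = g t).
  { induction n as [|n IH]; intros t; [now rewrite Rplus_0_r|].
    rewrite S_INR, <- Rplus_assoc, H. apply IH. }
  intros n t. destruct (Z_le_gt_dec 0 n) as [Hn|Hn].
  - rewrite <- (Z2Nat.id n Hn), <- INR_IZR_INZ. apply P.
  - rewrite <- (P (Z.to_nat (- n))), INR_IZR_INZ, Z2Nat.id by lia.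
    f_equal. rewrite opp_IZR. ring.
Qed.

Lemma periodic_reduce {A : Type} (g : R -> A) :
  (forall t, g (t + 1) = g t) -> forall t, exists s, 0 <= s < 1 /\ g t = g s.
Proof.
  intros H t. exists (t + IZR (- Int_part t)). split.
  - rewrite opp_IZR. destruct (base_Int_part t). lra.
  - symmetry. now apply periodic_Z.
Qed.

Lemma Cmult_nonzero a b : nonzeroC a -> nonzeroC b -> nonzeroC (a * b)%C.
Proof. apply Cmult_neq_0. Qed.

Lemma ex_derive_sqr_sum (x y : R -> R) (t : R) :
  ex_derive x t -> ex_derive y t -> ex_derive (fun t => (x t - 1) ^ 2 + y t ^ 2) t.
Proof. intros Hx Hy. auto_derive. repeat split; assumption. Qed.

Section Inner.
Variables (g : R -> C) (l : R).
Hypotheses (Hg : C1_path g) (Hper : forall t, g (t + 1) = g t)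
  (Hinj : forall t, 0 < t < 1 -> g t <> g 0)
  (Hg0 : g 0 = 1%C) (Hle : forall t, Re (g t) ^ 2 + Im (g t) ^ 2 <= 1)
  (Hvel : path_velocity g 0 = (0, l)) (Hl : l < 0).

Let x (t : R) : R := Re (g t).
Let y (t : R) : R := Im (g t).

Lemma inner_x0 : x 0 = 1. Proof. unfold x. now rewrite Hg0. Qed.
Lemma inner_y0 : y 0 = 0. Proof. unfold y. now rewrite Hg0. Qed.

Lemma vel_periodic t : path_velocity g (t + 1) = path_velocity g t.
Proof.
  destruct (C1_path_vel g t Hg) as [H1 H2].
  destruct (C1_path_affine g 1 1 Hg) as [_ K].
  specialize (K t). rewrite Cmult_1_l in K.
  replace (t + 1) with (1 + 1 * t) by ring. rewrite <- K.
  unfold path_velocity. f_equal; apply Derive_ext; intros s; rewrite <- (Hper s); do 2 f_equal; ring.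
Qed.

Lemma inner_y_sign : exists d, 0 < d < 1 / 2 /\
  forall h, 0 < h < d -> y h < 0 /\ 0 < y (1 - h).
Proof.
  destruct (C1_path_vel g 0 Hg) as [_ H2]. rewrite Hvel in H2. simpl in H2.
  destruct (derive_neg_local y 0 l H2 Hl) as (d & Hd & K).
  exists (Rmin d (1 / 4)). split.
  { split; [apply Rmin_glb_lt; lra|]. apply Rle_lt_trans with (1 / 4); [apply Rmin_r | lra]. }
  intros h Hh. assert (Rmin d (1 / 4) <= d) by apply Rmin_l.
  destruct (K h ltac:(lra)) as [K1 K2].
  rewrite inner_y0 in *. rewrite Rplus_0_l in K1. split; [assumption|].
  unfold y in *. rewrite <- Hper in K2. replace (1 - h) with (0 - h + 1) by ring. assumption.
Qed.

(** Near its base point 1 the loop is vertical, so that y does not vanish there.  Elsewhere,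
    being simple, it stays at a positive distance from 1. *)
Lemma inner_avoid : exists e0, 0 < e0 /\ forall t, 0 < t < 1 ->
  y t = 0 -> e0 < Rabs (x t - 1).
Proof.
  destruct inner_y_sign as (d & Hd & K).
  set (f := fun t => (x t - 1) ^ 2 + y t ^ 2).
  destruct (continuity_ab_min f d (1 - d)) as (m & Hm1 & Hm2); [lra| |].
  { intros t _. apply continuity_pt_filterlim. apply (ex_derive_continuous f).
    apply (ex_derive_sqr_sum x y); apply Hg. }
  assert (Hf : 0 < f m).
  { unfold f. destruct (Req_dec (x m) 1) as [E|E]; [|nra].
    destruct (Req_dec (y m) 0) as [E'|E']; [|nra].
    elim (Hinj m ltac:(lra)). rewrite Hg0, <- (pair_eta (g m)).
    unfold x, y in *. rewrite E, E'. reflexivity. }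
  exists (sqrt (f m) / 2).
  assert (Hs : 0 < sqrt (f m)) by now apply sqrt_lt_R0.
  split; [lra|]. intros t Ht Hy.
  destruct (Rlt_le_dec t d) as [H1|H1].
  { destruct (K t ltac:(lra)). lra. }
  destruct (Rlt_le_dec (1 - d) t) as [H2|H2].
  { destruct (K (1 - t) ltac:(lra)) as [_ K2].
    replace (1 - (1 - t)) with t in K2 by ring. lra. }
  specialize (Hm1 t ltac:(lra)). unfold f at 2 in Hm1. rewrite Hy in Hm1.
  apply Rlt_le_trans with (sqrt (f m)); [lra|].
  rewrite <- (sqrt_pow2 (Rabs (x t - 1))) by apply Rabs_pos.
  apply sqrt_le_1_alt. rewrite RPow_abs, Rabs_pos_eq by (apply pow2_ge_0). lra.
Qed.

Section Eps.
Variables (e : R) (He : 0 < e < 1)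
  (Hav : forall t, 0 < t < 1 -> y t = 0 -> e < Rabs (x t - 1)).

(* The first factor is the loop seen from the inner point 1 - e.  With the second one, which has
positive real part, the product is real exactly where y vanishes. *)
Let M (t : R) : C := ((g t + - RtoC (1 - e)) * (RtoC (1 + e) + - Cconj (g t)))%C.

Lemma inner_ReM t : Re (M t) = e ^ 2 - (x t - 1) ^ 2 - y t ^ 2.
Proof. unfold M, x, y, Re, Im. simpl. ring. Qed.
Lemma inner_ImM t : Im (M t) = 2 * e * y t.
Proof. unfold M, x, y, Re, Im. simpl. ring. Qed.

Lemma inner_ne t : g t <> RtoC (1 - e).
Proof.
  destruct (periodic_reduce g Hper t) as (s & Hs & ->). intros E.
  destruct (Req_dec s 0) as [->|Hs0].
  - rewrite Hg0 in E. apply (f_equal Re) in E. simpl in E. lra.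
  - assert (Hy : y s = 0) by (unfold y; rewrite E; reflexivity).
    assert (Hx : x s = 1 - e) by (unfold x; rewrite E; reflexivity).
    specialize (Hav s ltac:(lra) Hy). rewrite Hx in Hav.
    replace (1 - e - 1) with (- e) in Hav by ring.
    rewrite Rabs_Ropp, Rabs_pos_eq in Hav; lra.
Qed.

Lemma inner_factor t k : 0 <= k <= 1 -> nonzeroC (RtoC 1 + RtoC k * (RtoC e - Cconj (g t)))%C.
Proof.
  intros Hk. apply norm_nonzero.
  assert (Hx : x t <= 1).
  { specialize (Hle t). unfold x. nra. }
  assert (0 < Re (RtoC 1 + RtoC k * (RtoC e - Cconj (g t)))%C).
  { unfold Re; simpl. change (fst (g t)) with (x t).
    replace (1 + (k * (e + - x t) - 0 * (0 + - - snd (g t)))) with (1 - k + k * (1 - x t) + k * e) by ring.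
    assert (0 <= k * (1 - x t)) by (apply Rmult_le_pos; lra).
    destruct (Req_dec k 0) as [->|]; [lra|]. assert (0 < k * e) by (apply Rmult_lt_0_compat; lra). lra. }
  nra.
Qed.

Lemma inner_M_nonzero t : nonzeroC (M t).
Proof.
  apply Cmult_nonzero.
  - intros E. apply (inner_ne t).
    replace (g t) with (g t + - RtoC (1 - e) + RtoC (1 - e))%C by ring. rewrite E. ring.
  - replace (RtoC (1 + e) + - Cconj (g t))%C with (RtoC 1 + RtoC 1 * (RtoC e - Cconj (g t)))%C.
    + apply inner_factor. lra.
    + rewrite RtoC_plus. ring.
Qed.

Lemma inner_M_C1 : C1_path M /\ path_velocity M 0 = (0, 2 * e * l).
Proof.
  destruct (C1_path_const (- RtoC (1 - e))%C) as [A1 V1].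
  destruct (C1_path_const (RtoC (1 + e))) as [A2 V2].
  destruct (C1_path_conj g Hg) as [A3 V3].
  destruct (C1_path_const (- RtoC 1)%C) as [A4 V4].
  destruct (C1_path_plus _ _ Hg A1) as [A5 V5].
  destruct (C1_path_mult _ _ A4 A3) as [A6 V6].
  destruct (C1_path_plus _ _ A2 A6) as [A7 V7].
  destruct (C1_path_mult _ _ A5 A7) as [A8 V8].
  assert (E : forall t, ((g t + - RtoC (1 - e)) * (RtoC (1 + e) + - RtoC 1 * Cconj (g t)))%C = M t).
  { intros t. unfold M. ring. }
  assert (E2 : M = fun t => ((g t + - RtoC (1 - e)) * (RtoC (1 + e) + - RtoC 1 * Cconj (g t)))%C).
  { apply functional_extensionality. intros; now rewrite E. }
  rewrite E2. split; [assumption|].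
  rewrite V8, V5, V7, V6, V3, V4, V1, V2, Hg0, Hvel.
  apply injective_projections; simpl; ring.
Qed.

(** The argument of M starts at 0 and ends at a multiple of 2 pi, decreasing at both ends.  In
    between M is never a positive real number, so the argument takes neither the value 0 nor the
    value - 2 pi.  This leaves - 2 pi as its final value. *)
Lemma inner_M_winding : winding M (- (2 * PI)).
Proof.
  destruct inner_M_C1 as [HM VM].
  assert (HN := inner_M_nonzero).
  pose (L := (fun t => RInt (form_along arg_x arg_y M) 0 t) : R -> R).
  assert (DL := angle_derive M HM HN). change (forall t, is_derive L t (form_along arg_x arg_y M t)) in DL.
  assert (Per : forall t, M (t + 1) = M t) by (intros t; unfold M; now rewrite Hper).
  assert (R0 : Re (M 0) = e ^ 2) by (rewrite inner_ReM, inner_x0, inner_y0; ring).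
  assert (I0 : Im (M 0) = 0) by (rewrite inner_ImM, inner_y0; ring).
  assert (Sp := angle_spec M HM HN I0 ltac:(rewrite R0; nra)). change (forall t, exists u, 0 < u /\ Re (M t) = u * cos (L t) /\ Im (M t) = u * sin (L t)) in Sp.
  replace (- (2 * PI)) with (L 1); [apply winding_C1; auto|].
  assert (L0 : L 0 = 0) by apply (RInt_point (V := R_CompleteNormedModule)).
  assert (D0 : form_along arg_x arg_y M 0 = 2 * l / e).
  { unfold form_along, arg_x, arg_y. rewrite I0, R0.
    change (Derive (fun t => Im (M t)) 0) with (Im (path_velocity M 0)). rewrite VM. simpl. field. lra. }
  assert (D1 : form_along arg_x arg_y M 1 = 2 * l / e).
  { rewrite <- D0. unfold form_along.
    change (Derive (fun t => Re (M t)) 1) with (Re (path_velocity M 1)).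
    change (Derive (fun t => Im (M t)) 1) with (Im (path_velocity M 1)).
    replace 1 with (0 + 1) by ring. rewrite Per.
    assert (V : path_velocity M (0 + 1) = path_velocity M 0).
    { destruct (C1_path_affine M 1 1 HM) as [_ K]. specialize (K 0). rewrite Cmult_1_l in K.
      replace (0 + 1) with (1 + 1 * 0) by ring. rewrite <- K.
      unfold path_velocity. f_equal; apply Derive_ext; intros s; rewrite <- (Per s); do 2 f_equal; ring. }
    rewrite V. reflexivity. }
  assert (Hneg : 2 * l / e < 0).
  { unfold Rdiv. assert (0 < / e) by (apply Rinv_0_lt_compat; lra). nra. }
  assert (Dl0 : is_derive L 0 (2 * l / e)) by (rewrite <- D0; apply DL).
  assert (Dl1 : is_derive L 1 (2 * l / e)) by (rewrite <- D1; apply DL).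
  destruct (derive_neg_local L 0 _ Dl0 Hneg) as (d0 & Hd0 & K0).
  destruct (derive_neg_local L 1 _ Dl1 Hneg) as (d1 & Hd1 & K1).
  set (d := Rmin (Rmin d0 d1) (1 / 2) / 2).
  assert (Hd : 0 < d /\ d < d0 /\ d < d1 /\ d <= 1 / 4).
  { unfold d. assert (A := Rmin_l (Rmin d0 d1) (1 / 2)). assert (B := Rmin_r (Rmin d0 d1) (1 / 2)).
    assert (A' := Rmin_l d0 d1). assert (B' := Rmin_r d0 d1).
    assert (0 < Rmin (Rmin d0 d1) (1 / 2)) by (repeat apply Rmin_glb_lt; lra). lra. }
  destruct (K0 d ltac:(lra)) as [Kd0 _]. rewrite Rplus_0_l, L0 in Kd0.
  destruct (K1 d ltac:(lra)) as [_ Kd1].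
  assert (Cont : continuity L).
  { intros t. apply continuity_pt_filterlim. apply (ex_derive_continuous L). eexists; apply DL. }
  assert (Avoid : forall t, 0 < t < 1 -> L t <> 0 /\ L t <> - (2 * PI)).
  { intros t Ht.
    assert (K : sin (L t) = 0 -> cos (L t) = 1 -> False).
    { intros Hs Hc. destruct (Sp t) as (u & Hu & E1 & E2). rewrite Hs in E2. rewrite Hc in E1.
      rewrite inner_ReM in E1. rewrite inner_ImM in E2.
      assert (Hy : y t = 0) by nra. rewrite Hy in E1.
      specialize (Hav t Ht Hy).
      assert (e ^ 2 < Rabs (x t - 1) ^ 2) by nra.
      rewrite RPow_abs, Rabs_pos_eq in H by apply pow2_ge_0. lra. }
    split; intros E; apply K; rewrite E.
    - apply sin_0.
    - apply cos_0.
    - rewrite sin_neg, sin_2PI. ring.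
    - rewrite cos_neg, cos_2PI. reflexivity. }
  assert (End : exists k : Z, L 1 = 2 * PI * IZR k).
  { destruct (Sp 1) as (u & Hu & E1 & E2).
    replace 1 with (0 + 1) in E1 at 1 by ring. replace 1 with (0 + 1) in E2 at 1 by ring.
    rewrite Per, R0 in E1. rewrite Per, I0 in E2.
    assert (S0 : sin (L 1) = 0) by nra.
    assert (C0 : 0 < cos (L 1)) by nra.
    destruct (sin_eq_0_0 _ S0) as [k Hk].
    destruct (Z.Even_or_Odd k) as [[j ->]|[j ->]].
    - exists j. rewrite Hk, mult_IZR. ring.
    - exfalso. rewrite Hk, plus_IZR, mult_IZR in C0.
      replace ((2 * IZR j + 1) * PI)%R with (2 * IZR j * PI + PI)%R in C0 by (simpl; ring).
      rewrite neg_cos in C0.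
      assert (C1 : cos (2 * IZR j * PI) = 1).
      { replace (2 * IZR j * PI) with (2 * (IZR j * PI)) by ring.
        rewrite cos_2a_sin. rewrite (sin_eq_0_1 (IZR j * PI)); [ring|]. now exists j. }
      lra. }
  destruct End as [k Hk].
  assert (PP := PI_RGT_0).
  (* By the intermediate value theorem, L would otherwise take one of the two excluded values. *)
  destruct (Z.lt_trichotomy k (-1)) as [Hk1|[Hk1|Hk1]].
  - exfalso. assert (IZR k <= -2) by (apply IZR_le; lia).
    assert (L 1 <= - (4 * PI)) by nra.
    destruct (IVT_gen L 0 1 (- (2 * PI)) Cont) as (s & Hs1 & Hs2).
    { rewrite L0. rewrite Rmin_right, Rmax_left by lra. lra. }
    rewrite Rmin_left, Rmax_right in Hs1 by lra.
    destruct (Req_dec s 0) as [->|]; [lra|]. destruct (Req_dec s 1) as [->|]; [lra|].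
    destruct (Avoid s ltac:(lra)). contradiction.
  - rewrite Hk, Hk1. ring.
  - exfalso.
    destruct (Z.eq_dec k 0) as [->|Hk0].
    + destruct (IVT_gen L d (1 - d) 0 Cont) as (s & Hs1 & Hs2).
      { rewrite Rmin_left, Rmax_right by lra. lra. }
      rewrite Rmin_left, Rmax_right in Hs1 by lra.
      destruct (Avoid s ltac:(lra)). contradiction.
    + assert (1 <= IZR k) by (apply IZR_le; lia).
      assert (0 < L 1) by (rewrite Hk; nra).
      destruct (IVT_gen L d 1 0 Cont) as (s & Hs1 & Hs2).
      { rewrite Rmin_left, Rmax_right by lra. lra. }
      rewrite Rmin_left, Rmax_right in Hs1 by lra.
      destruct (Req_dec s 1) as [->|]; [lra|].
      destruct (Avoid s ltac:(lra)). contradiction.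
Qed.

(** The second factor of M stays in the right half-plane and can be contracted to 1. *)
Lemma inner_winding_eps : winding (fun t => g t - RtoC (1 - e))%C (- (2 * PI)).
Proof.
  assert (Cg : forall t, continuous g t) by (intros; now apply C1_path_continuous).
  set (h := fun st : R * R => ((g (snd st) - RtoC (1 - e)) *
      (RtoC 1 + RtoC (1 - fst st) * (RtoC e - Cconj (g (snd st)))))%C).
  assert (Per1 : g 1 = g 0) by (rewrite <- (Hper 0); f_equal; ring).
  apply integral_along_ext with (fun t => h (1, t)).
  { intros t _. unfold h; simpl. rewrite Rminus_diag. ring. }
  apply winding_homotopy with (h := h).
  - intros [s t]. unfold h.
    cont.
  - intros s t Hs Ht. apply Cmult_nonzero; simpl.
    + intros E. apply (inner_ne t).
      replace (g t) with (g t - RtoC (1 - e) + RtoC (1 - e))%C by ring. rewrite E. ring.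
    + apply inner_factor. lra.
  - intros s _. unfold h; simpl. now rewrite Per1.
  - apply integral_along_ext with M; [|apply inner_M_winding].
    intros t _. unfold h, M; simpl. rewrite RtoC_plus. rewrite Rminus_0_r. ring.
Qed.
End Eps.

(** Running clockwise where it touches the unit circle, the loop has the points just inside on its
    right and surrounds them; that it is simple limits it to one turn. *)
Lemma inner_winding : exists e0, 0 < e0 /\ forall e, 0 < e < e0 ->
  (forall t, g t <> RtoC (1 - e)) /\ winding (fun t => g t - RtoC (1 - e))%C (- (2 * PI)).
Proof.
  destruct inner_avoid as (e0 & He0 & K).
  exists (Rmin e0 1). split; [apply Rmin_glb_lt; lra|].
  intros e He. assert (A := Rmin_l e0 1). assert (B := Rmin_r e0 1).
  assert (Hav : forall t, 0 < t < 1 -> y t = 0 -> e < Rabs (x t - 1)).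
  { intros t Ht Hy. specialize (K t Ht Hy). lra. }
  split; [apply inner_ne | apply inner_winding_eps]; auto; lra.
Qed.
End Inner.

(** * The complex exponential and circles *)

Lemma Cmod_sqr (z : C) : Cmod z ^ 2 = Re z ^ 2 + Im z ^ 2.
Proof. unfold Cmod. rewrite pow2_sqrt; [reflexivity|]. unfold Re, Im. nra. Qed.

Lemma cexp_plus a b : cexp (a + b)%C = (cexp a * cexp b)%C.
Proof.
  unfold cexp; simpl. rewrite exp_plus, cos_plus, sin_plus.
  apply injective_projections; unfold Re, Im; simpl; ring.
Qed.

Lemma cexp_nz a : nonzeroC (cexp a).
Proof.
  apply norm_nonzero. unfold cexp; simpl.
  assert (H := exp_pos (Re a)). assert (K := sin2_cos2 (Im a)). unfold Rsqr in K.
  unfold Re, Im in *. nra.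
Qed.

Lemma cexp_0 : cexp (RtoC 0) = 1%C.
Proof. unfold cexp; simpl. rewrite exp_0, cos_0, sin_0. apply injective_projections; simpl; ring. Qed.

Lemma cexp_opp a : cexp (- a)%C = (/ cexp a)%C.
Proof.
  assert (K : (cexp a * cexp (- a))%C = 1%C).
  { rewrite <- cexp_plus, <- cexp_0. f_equal. ring. }
  transitivity (/ cexp a * (cexp a * cexp (- a)))%C; [field; apply cexp_nz | rewrite K; ring].
Qed.

Lemma sqr_inj (a b : R) : 0 <= a -> 0 <= b -> a ^ 2 = b ^ 2 -> a = b.
Proof. intros. apply Rsqr_inj; auto. unfold Rsqr. lra. Qed.

Lemma Cmod_cexp a : Cmod (cexp a) = exp (Re a).
Proof.
  apply sqr_inj; [apply Cmod_ge_0 | left; apply exp_pos |].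
  rewrite Cmod_sqr. destruct a as [x y]. unfold cexp, Re, Im; simpl fst; simpl snd.
  assert (K := sin2_cos2 y). unfold Rsqr in K.
  transitivity (exp x ^ 2 * (sin y * sin y + cos y * cos y)); [ring|].
  rewrite K; ring.
Qed.

Lemma cexp_surj z : nonzeroC z -> exists a, cexp a = z.
Proof.
  intros Hz. assert (Hn := nonzero_norm z Hz). destruct z as [x y]. simpl in Hn.
  set (r := sqrt (x ^ 2 + y ^ 2)).
  assert (Hr : 0 < r) by (apply sqrt_lt_R0; simpl; lra).
  assert (Hr2 : r ^ 2 = x ^ 2 + y ^ 2) by (apply pow2_sqrt; simpl; lra).
  assert (Hx : -1 <= x / r <= 1).
  { assert (- r <= x <= r) by (split; nra).
    split; apply Rmult_le_reg_r with r; auto; unfold Rdiv; rewrite Rmult_assoc, Rinv_l by lra; lra. }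
  assert (Hs : sin (acos (x / r)) = Rabs y / r).
  { rewrite sin_acos by assumption. apply sqrt_lem_1.
    - assert ((x / r) ^ 2 <= 1) by nra. unfold Rsqr. simpl in H. lra.
    - apply Rmult_le_pos; [apply Rabs_pos | left; now apply Rinv_0_lt_compat].
    - replace (Rabs y / r * (Rabs y / r)) with (Rabs y ^ 2 / r ^ 2) by (field; lra).
      rewrite RPow_abs, Rabs_pos_eq by apply pow2_ge_0. unfold Rsqr.
      replace (1 - x / r * (x / r)) with ((r ^ 2 - x ^ 2) / r ^ 2) by (field; lra).
      rewrite Hr2. f_equal. ring. }
  destruct (Rle_lt_dec 0 y) as [Hy|Hy].
  - exists (ln r, acos (x / r)). unfold cexp; simpl. rewrite exp_ln by assumption.
    rewrite cos_acos by assumption. rewrite Hs, Rabs_pos_eq by assumption.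
    f_equal; field; lra.
  - exists (ln r, - acos (x / r)). unfold cexp; simpl. rewrite exp_ln by assumption.
    rewrite cos_neg, sin_neg, cos_acos by assumption. rewrite Hs, Rabs_left by assumption.
    f_equal; field; lra.
Qed.

Lemma cexp_2PI a : cexp (a + (0%R, (2 * PI)%R))%C = cexp a.
Proof.
  rewrite cexp_plus. unfold cexp at 2; simpl. rewrite exp_0, cos_2PI, sin_2PI.
  apply injective_projections; unfold Re, Im; simpl; ring.
Qed.

Lemma continuous_cexp a : continuous cexp a.
Proof.
  assert (HR := continuous_Re a). assert (HI := continuous_Im a). unfold cexp. cont.
Qed.

Lemma open_punctured Om : open Om -> open (punctured Om).
Proof.
  intros H. apply open_and; [exact H | exact open_nonzero].
Qed.

(** A path to the puncture leaves the punctured domain, possibly before its end; it is stopped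
    shortly before its first zero. *)
Lemma stop_before_zero (path : R -> C) (r : R) :
  (forall s, continuous path s) -> path 0 <> 0%C -> path 1 = 0%C -> 0 < r ->
  exists m, 0 <= m <= 1 /\ Cmod (path m) <= r /\ forall s, 0 <= s <= m -> path s <> 0%C.
Proof.
  intros Hc H0 H1 Hr.
  set (Z := fun s => 0 <= s <= 1 /\ forall u, 0 <= u <= s -> path u <> 0%C).
  assert (Z0 : Z 0).
  { split; [lra|]. intros u Hu. replace u with 0 by lra. exact H0. }
  destruct (completeness Z) as [M [HM1 HM2]].
  { exists 1. intros s [Hs _]. lra. }
  { now exists 0. }
  assert (HM : 0 <= M <= 1).
  { split; [now apply HM1|]. apply HM2. intros s [Hs _]. lra. }
  assert (Below : forall u, 0 <= u < M -> path u <> 0%C).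
  { intros u Hu E. assert (M <= u); [|lra]. apply HM2. intros s [Hs K].
    destruct (Rle_lt_dec s u); [assumption|]. exfalso. apply (K u); [lra|exact E]. }
  assert (PM : path M = 0%C).
  { destruct (excluded_middle_informative (path M = 0%C)) as [E|N]; [exact E|exfalso].
    destruct (Hc M nonzeroC (open_nonzero _ N)) as [d Hd].
    assert (HM' : M < 1) by (destruct (Req_dec M 1) as [->|]; [contradiction|lra]).
    set (k := Rmin (d / 2) (1 - M)).
    assert (Hk : 0 < k) by (destruct d; apply Rmin_glb_lt; simpl; lra).
    assert (Hk1 := Rmin_l (d / 2) (1 - M)). assert (Hk2 := Rmin_r (d / 2) (1 - M)). fold k in Hk1, Hk2.
    assert (ZM : Z (M + k)).
    { split; [lra|]. intros u Hu. destruct (Rlt_le_dec u M); [apply Below; lra|].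
      apply Hd. change (Rabs (u - M) < d). rewrite Rabs_pos_eq by lra. destruct d; simpl in *; lra. }
    apply HM1 in ZM. lra. }
  assert (HMp : 0 < M).
  { destruct (Req_dec M 0) as [E|]; [|lra]. rewrite E in PM. contradiction. }
  assert (L : locally (path M) (fun z => Cmod z <= r)).
  { rewrite PM. assert (Hr2 : 0 < r / 2) by lra.
    exists (mkposreal _ Hr2). intros z [Z1 Z2].
    change (Rabs (Re z - 0) < r / 2) in Z1. change (Rabs (Im z - 0) < r / 2) in Z2.
    rewrite Rminus_0_r in Z1, Z2.
    assert (Cmod z ^ 2 <= r ^ 2).
    { rewrite Cmod_sqr. apply Rabs_def2 in Z1. apply Rabs_def2 in Z2. nra. }
    assert (0 <= Cmod z) by apply Cmod_ge_0. nra. }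
  destruct (Hc M _ L) as [d Hd].
  set (s := Rmax 0 (M - d / 2)).
  assert (Hs : 0 <= s < M) by (destruct d; split; [apply Rmax_l | apply Rmax_lub_lt; simpl; lra]).
  exists s. split; [lra|]. split.
  - apply Hd. change (Rabs (s - M) < d). rewrite Rabs_left by lra.
    assert (M - d / 2 <= s) by apply Rmax_r. destruct d; simpl in *; lra.
  - intros u Hu. apply Below. lra.
Qed.

Definition circle (r t : R) : C := (r * cos (2 * PI * t), r * sin (2 * PI * t)).

Lemma C1_circle r : C1_path (circle r) /\
  forall t, path_velocity (circle r) t = (- r * (2 * PI) * sin (2 * PI * t), r * (2 * PI) * cos (2 * PI * t)).
Proof.
  assert (K : forall t,
    is_derive (fun t => Re (circle r t)) t (- r * (2 * PI) * sin (2 * PI * t)) /\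
    is_derive (fun t => Im (circle r t)) t (r * (2 * PI) * cos (2 * PI * t))).
  { intros t. unfold circle; simpl. split; auto_derive; auto; ring. }
  split.
  - apply (C1_path_of_vel _ (fun t => (- r * (2 * PI) * sin (2 * PI * t), r * (2 * PI) * cos (2 * PI * t))) K).
    intros t. cont.
  - intros t. exact (vel_intro (circle r) t (- r * (2 * PI) * sin (2 * PI * t), r * (2 * PI) * cos (2 * PI * t)) (proj1 (K t)) (proj2 (K t))).
Qed.

Lemma circle_cexp r t : 0 < r -> circle r t = cexp (ln r, 2 * PI * t).
Proof. intros H. unfold circle, cexp; simpl. now rewrite exp_ln. Qed.

Lemma Cmod_circle r t : 0 < r -> Cmod (circle r t) = r.
Proof. intros H. rewrite circle_cexp, Cmod_cexp by assumption. simpl. now apply exp_ln. Qed.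

Lemma winding_circle r : 0 < r -> winding (circle r) (2 * PI).
Proof.
  intros Hr. destruct (C1_circle r) as [H1 H2].
  replace (2 * PI) with (RInt (form_along arg_x arg_y (circle r)) 0 1).
  - apply winding_C1; [assumption|]. intros t _. rewrite circle_cexp by assumption. apply cexp_nz.
  - rewrite (RInt_ext _ (fun _ => 2 * PI)).
    + rewrite RInt_const. unfold scal; simpl; unfold mult; simpl. ring.
    + intros t _. unfold form_along.
      change (Derive (fun t => Re (circle r t)) t) with (Re (path_velocity (circle r) t)).
      change (Derive (fun t => Im (circle r t)) t) with (Im (path_velocity (circle r) t)).
      rewrite H2. unfold arg_x, arg_y, circle; simpl.
      assert (K := sin2_cos2 (2 * PI * t)). unfold Rsqr in K.
      set (S := sin (2 * PI * t)) in *. set (T := cos (2 * PI * t)) in *.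
      replace (r * T * (r * T * 1) + r * S * (r * S * 1)) with (r * r * (S * S + T * T)) by ring.
      rewrite K. transitivity (2 * PI * (S * S + T * T)); [field; lra | rewrite K; ring].
Qed.

(** Change of variable: the path on the left describes the period of g exactly n times. *)
Lemma RInt_turns (p q : C -> R) (g : R -> C) (n : Z) :
  C1_path g -> (forall t, g (t + 1) = g t) ->
  (forall t, continuous p (g t) /\ continuous q (g t)) ->
  RInt (form_along p q (fun t => g (IZR n * t))) 0 1 = IZR n * RInt (form_along p q g) 0 1.
Proof.
  intros Hg Hper Hpq.
  set (f := form_along p q g).
  assert (Cf : forall t, continuous f t) by (intros; apply continuous_form_along; auto; apply Hpq).
  assert (If : forall a b, ex_RInt f a b).
  { intros. apply (ex_RInt_continuous (V := R_CompleteNormedModule)). auto. }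
  assert (fper : forall t, f (t + 1) = f t).
  { intros t. unfold f, form_along. rewrite Hper.
    assert (V : path_velocity g (t + 1) = path_velocity g t) by now apply vel_periodic.
    change (p (g t) * Re (path_velocity g (t + 1)) + q (g t) * Im (path_velocity g (t + 1)) =
            p (g t) * Re (path_velocity g t) + q (g t) * Im (path_velocity g t)).
    now rewrite V. }
  destruct (C1_path_affine g 0 (IZR n) Hg) as [_ V].
  rewrite (RInt_ext _ (fun t => scal (IZR n) (f (IZR n * t + 0)))).
  2:{ intros t _. unfold f, form_along.
      assert (E : path_velocity (fun t => g (IZR n * t)) t = (RtoC (IZR n) * path_velocity g (IZR n * t + 0)%R)%C).
      { replace (IZR n * t + 0) with (0 + IZR n * t) by ring. rewrite <- V. unfold path_velocity.
        f_equal; apply Derive_ext; intros u; do 2 f_equal; ring. }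
      change (p (g (IZR n * t)) * Re (path_velocity (fun t => g (IZR n * t)) t) +
              q (g (IZR n * t)) * Im (path_velocity (fun t => g (IZR n * t)) t) =
              IZR n * (p (g (IZR n * t + 0)) * Re (path_velocity g (IZR n * t + 0)) +
                       q (g (IZR n * t + 0)) * Im (path_velocity g (IZR n * t + 0)))).
      rewrite E. replace (IZR n * t + 0) with (IZR n * t) by ring. unfold Re, Im; simpl. ring. }
  etransitivity; [apply (RInt_comp_lin f (IZR n) 0 0 1); apply If|].
  rewrite Rmult_0_r, Rmult_1_r, !Rplus_0_r.
  pose (L := (fun t => RInt f 0 t) : R -> R).
  assert (DL : forall t, is_derive L t (f t)).
  { intros t. apply (is_derive_RInt f L 0); [|apply Cf].
    apply filter_forall. intros u. apply (RInt_correct f). apply If. }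
  assert (Step : forall t, L (t + 1) = L t + L 1).
  { intros t. unfold L. rewrite <- (RInt_Chasles f 0 1 (t + 1)) by apply If.
    rewrite Rplus_comm. unfold plus; simpl. f_equal.
    assert (K := RInt_comp_lin f 1 1 0 t). rewrite !Rmult_1_l, Rplus_0_l in K.
    rewrite <- K by apply If. apply RInt_ext. intros u _.
    unfold scal; simpl; unfold mult; simpl. rewrite Rmult_1_l, Rmult_1_l. apply fper. }
  assert (L0 : L 0 = 0) by apply (RInt_point (V := R_CompleteNormedModule)).
  assert (LN : forall k : nat, forall t, L (t + INR k) = L t + INR k * L 1).
  { induction k as [|k IH]; intros t; [simpl; rewrite Rplus_0_r; ring|].
    rewrite S_INR, <- Rplus_assoc, Step, IH. ring. }
  change (L (IZR n) = IZR n * L 1).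
  destruct (Z_le_gt_dec 0 n) as [Hn|Hn].
  - rewrite <- (Z2Nat.id n Hn), <- INR_IZR_INZ, <- (Rplus_0_l (INR _)), LN, L0. ring.
  - assert (K := LN (Z.to_nat (- n)) (IZR n)).
    rewrite INR_IZR_INZ, Z2Nat.id, opp_IZR in K by lia.
    rewrite Rplus_opp_r, L0 in K. lra.
Qed.

(** * Loops that generate the fundamental group *)

Lemma box_radius (a v : C) (e : R) : 0 < e -> exists d, 0 < d /\
  forall u eps, 0 <= u <= 1 -> 0 < eps < d -> box a e (a + RtoC u * (RtoC eps * v))%C.
Proof.
  intros He. set (K := 1 + Rabs (Re v) + Rabs (Im v)).
  assert (P1 := Rabs_pos (Re v)). assert (P2 := Rabs_pos (Im v)).
  assert (HK : 0 < K) by (unfold K; lra).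
  exists (e / K). split; [now apply Rdiv_lt_0_compat|].
  intros u eps Hu Heps.
  assert (B : eps * K < e).
  { replace e with (e / K * K) by (field; lra). apply Rmult_lt_compat_r; lra. }
  assert (M : forall w, Rabs w <= K -> Rabs (u * (eps * w)) < e).
  { intros w Hw. rewrite !Rabs_mult, (Rabs_pos_eq u), (Rabs_pos_eq eps) by lra.
    assert (W := Rabs_pos w). assert (eps * Rabs w <= eps * K) by (apply Rmult_le_compat_l; lra).
    assert (0 <= eps * Rabs w) by (apply Rmult_le_pos; lra). nra. }
  split; unfold Re, Im in *; simpl.
  - replace (fst a + (u * (eps * fst v - 0 * snd v) - 0 * (eps * snd v + 0 * fst v)) - fst a)
      with (u * (eps * fst v)) by ring. apply M. unfold K. lra.
  - replace (snd a + (u * (eps * snd v + 0 * fst v) + 0 * (eps * fst v - 0 * snd v)) - snd a)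
      with (u * (eps * snd v)) by ring. apply M. unfold K. lra.
Qed.

(** Multiplication by a complex number and a change of base point bring the point furthest from 0
    to 1 and to time 0.  At this critical point of the modulus the velocity is tangent to the unit
    circle, and the sign of lam says in which sense the loop runs there. *)
Lemma normalized_loop (g : R -> C) :
  C1_path g -> (forall t, g (t + 1) = g t) ->
  (forall s t, 0 <= s < 1 -> 0 <= t < 1 -> g s = g t -> s = t) ->
  (forall t, nonzeroC (g t)) -> (forall t, path_velocity g t <> 0%C) ->
  exists t0 lam ga, C1_path ga /\ (forall t, ga (t + 1) = ga t) /\
    (forall t, 0 < t < 1 -> ga t <> ga 0) /\ ga 0 = 1%C /\
    (forall t, Re (ga t) ^ 2 + Im (ga t) ^ 2 <= 1) /\ path_velocity ga 0 = (0, lam) /\ lam <> 0 /\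
    (forall t, g (t0 + 1 * t) = (ga t * g t0)%C) /\ path_velocity g t0 = ((0%R, lam) * g t0)%C.
Proof.
  intros Hg Hper Hinj Hnz Hreg.
  set (f := fun t => Re (g t) ^ 2 + Im (g t) ^ 2).
  assert (Df : forall t, is_derive f t (2 * (Re (g t) * Re (path_velocity g t) + Im (g t) * Im (path_velocity g t)))).
  { intros t. destruct (C1_path_vel g t Hg) as [D1 D2].
    assert (K : forall (x y : R -> R) a b, is_derive x t a -> is_derive y t b ->
      is_derive (fun t => x t ^ 2 + y t ^ 2) t (2 * (x t * a + y t * b))).
    { intros x y a b Hx Hy. auto_derive; [repeat split; eexists; eassumption|].
      eta_derive x; eta_derive y.
      rewrite (is_derive_unique x t a Hx), (is_derive_unique y t b Hy). ring. }
    exact (K _ _ _ _ D1 D2). }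
  destruct (continuity_ab_maj f 0 1) as (t0 & Hmax & Ht0); [lra| |].
  { intros t _. apply continuity_pt_filterlim. apply (ex_derive_continuous f). eexists; apply Df. }
  assert (Hmaxg : forall t, f t <= f t0).
  { intros t. destruct (periodic_reduce g Hper t) as (s & Hs & Es).
    unfold f at 1. rewrite Es. apply Hmax. lra. }
  assert (Crit : Re (g t0) * Re (path_velocity g t0) + Im (g t0) * Im (path_velocity g t0) = 0).
  { destruct (Req_dec (Re (g t0) * Re (path_velocity g t0) + Im (g t0) * Im (path_velocity g t0)) 0) as [|N]; [assumption|exfalso].
    destruct (Rlt_le_dec (Re (g t0) * Re (path_velocity g t0) + Im (g t0) * Im (path_velocity g t0)) 0).
    - destruct (derive_neg_local f t0 _ (Df t0) ltac:(lra)) as (d & Hd & K).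
      destruct (K (d / 2) ltac:(lra)) as [_ K2]. specialize (Hmaxg (t0 - d / 2)). lra.
    - assert (Dm : is_derive (fun t => - f t) t0 (- (2 * (Re (g t0) * Re (path_velocity g t0) + Im (g t0) * Im (path_velocity g t0))))).
      { apply (is_derive_opp f). apply Df. }
      destruct (derive_neg_local _ t0 _ Dm ltac:(lra)) as (d & Hd & K).
      destruct (K (d / 2) ltac:(lra)) as [K2 _]. specialize (Hmaxg (t0 + d / 2)). lra. }
  set (z0 := g t0) in *.
  assert (Hz0 : nonzeroC z0) by apply Hnz.
  assert (Hf0 : 0 < f t0) by apply (nonzero_norm z0 Hz0).
  set (ga := fun t => (g (t0 + 1 * t)%R * / z0)%C).
  destruct (C1_path_affine g t0 1 Hg) as [A1 V1].
  destruct (C1_path_const (/ z0)%C) as [A2 V2].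
  destruct (C1_path_mult _ _ A1 A2) as [A3 V3].
  change (C1_path ga) in A3.
  set (lam := (Re z0 * Im (path_velocity g t0) - Im z0 * Re (path_velocity g t0)) / f t0).
  assert (Vz : path_velocity g t0 = ((0%R, lam) * z0)%C).
  { apply injective_projections; unfold lam, f; fold z0; unfold f in Hf0; fold z0 in Hf0.
    - change (fst (path_velocity g t0)) with (Re (path_velocity g t0)).
      transitivity (Re (path_velocity g t0) - Re z0 * (Re z0 * Re (path_velocity g t0) + Im z0 * Im (path_velocity g t0)) / (Re z0 ^ 2 + Im z0 ^ 2)).
      + rewrite Crit. field. lra.
      + unfold Re, Im in *; simpl in *. field. lra.
    - change (snd (path_velocity g t0)) with (Im (path_velocity g t0)).
      transitivity (Im (path_velocity g t0) - Im z0 * (Re z0 * Re (path_velocity g t0) + Im z0 * Im (path_velocity g t0)) / (Re z0 ^ 2 + Im z0 ^ 2)).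
      + rewrite Crit. field. lra.
      + unfold Re, Im in *; simpl in *. field. lra. }
  assert (Vga : path_velocity ga 0 = (0, lam)).
  { change (path_velocity ga 0) with (path_velocity (fun t : R => (g (t0 + 1 * t)%R * / z0)%C) 0). rewrite V3, V1, V2.
    rewrite Rmult_0_r, Rplus_0_r, Vz.
    replace (RtoC 1 * ((0%R, lam) * z0) * / z0 + g t0 * 0)%C with ((0%R, lam) * (z0 * / z0))%C by ring.
    rewrite Cinv_r by exact Hz0. ring. }
  assert (Hga0 : ga 0 = 1%C).
  { unfold ga. rewrite Rmult_0_r, Rplus_0_r. apply Cinv_r. exact Hz0. }
  assert (Hgz : forall t, g (t0 + 1 * t) = (ga t * z0)%C).
  { intros t. unfold ga. rewrite <- Cmult_assoc, Cinv_l by exact Hz0. ring. }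
  assert (Hgaper : forall t, ga (t + 1) = ga t).
  { intros t. unfold ga. rewrite <- (Hper (t0 + 1 * t)). do 2 f_equal. ring. }
  assert (Hgainj : forall t, 0 < t < 1 -> ga t <> ga 0).
  { intros t Ht E0.
    assert (E1 : g (t0 + t) = g t0).
    { rewrite <- (Rmult_1_l t). rewrite Hgz, E0, Hga0. fold z0. ring. }
    assert (Red : forall s, exists n : Z, 0 <= s + IZR n < 1).
    { intros s. exists (- Int_part s)%Z. rewrite opp_IZR. destruct (base_Int_part s). lra. }
    destruct (Red (t0 + t)) as [k1 Hk1]. destruct (Red t0) as [k2 Hk2].
    assert (E2 : t0 + t + IZR k1 = t0 + IZR k2).
    { apply Hinj; auto. rewrite !(periodic_Z g Hper). exact E1. }
    assert (E3 : t = IZR (k2 - k1)) by (rewrite minus_IZR; lra).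
    rewrite E3 in Ht. destruct Ht as [T1 T2]. apply lt_IZR in T1. apply lt_IZR in T2. lia. }
  assert (Hgale : forall t, Re (ga t) ^ 2 + Im (ga t) ^ 2 <= 1).
  { intros t. assert (K := Hmaxg (t0 + 1 * t)). unfold f at 1 in K.
    rewrite <- Cmod_sqr, Hgz, Cmod_mult in K. rewrite <- Cmod_sqr.
    unfold f in K, Hf0. fold z0 in K, Hf0. rewrite <- Cmod_sqr in K, Hf0.
    rewrite Rpow_mult_distr in K.
    apply Rmult_le_reg_r with (Cmod z0 ^ 2); lra. }
  assert (Hlam : lam <> 0).
  { intros E0. apply (Hreg t0). rewrite Vz, E0. apply injective_projections; simpl; ring. }
  exists t0, lam, ga. repeat (split; [assumption|]). assumption.
Qed.

Lemma winding_normalized (g ga : R -> C) (t0 W : R) :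
  C1_path g -> (forall t, g (t + 1) = g t) -> (forall t, nonzeroC (g t)) ->
  (forall t, g (t0 + 1 * t) = (ga t * g t0)%C) -> winding g W -> winding ga W.
Proof.
  intros Hg Hper Hnz Hga HW.
  assert (Cg : forall t, continuous g t) by (intros; now apply C1_path_continuous).
  destruct (cexp_surj _ (Hnz t0)) as [a Ha].
  (* The base point is moved from 0 to t0, and a factor from 1 to / g t0, through exp. *)
  set (h := fun st : R * R => (g (fst st * t0 + snd st)%R * cexp (RtoC (fst st) * - a))%C).
  apply integral_along_ext with (fun t => h (1, t)).
  { intros t _. unfold h; simpl. replace (1 * t0 + t) with (t0 + 1 * t) by ring.
    rewrite Hga, Cmult_1_l, cexp_opp, Ha. field. apply Hnz. }
  apply winding_homotopy.
  - intros x. assert (Ce := continuous_cexp). unfold h. cont.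
  - intros s t _ _. apply Cmult_nonzero; [apply Hnz|apply cexp_nz].
  - intros s _. unfold h; simpl. rewrite Rplus_0_r. now rewrite Hper.
  - apply integral_along_ext with g; [|exact HW].
    intros t _. unfold h; simpl. rewrite Rmult_0_l, Rplus_0_l.
    replace (RtoC 0 * - a)%C with (RtoC 0) by ring. rewrite cexp_0. ring.
Qed.

(** Within the disk, the loop contracts to 0 without meeting the point k outside. *)
Lemma winding_outside (ga : R -> C) (k W : R) :
  (forall t, continuous ga t) -> ga 1 = ga 0 ->
  (forall t, Re (ga t) ^ 2 + Im (ga t) ^ 2 <= 1) -> 1 < k ->
  winding (fun t => ga t - RtoC k)%C W -> W = 0.
Proof.
  intros Cga Ga1 Hgale Hk Sh.
  destruct (C1_path_const (- RtoC k)%C) as [B1 B2].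
  assert (Z : winding (fun _ => - RtoC k)%C 0).
  { replace 0 with (RInt (form_along arg_x arg_y (fun _ => - RtoC k)%C) 0 1).
    - apply winding_C1; [exact B1|]. intros t _ E0. apply (f_equal Re) in E0. simpl in E0. lra.
    - rewrite (RInt_ext _ (fun _ => 0)).
      + rewrite RInt_const. unfold scal; simpl; unfold mult; simpl. ring.
      + intros t _. unfold form_along. rewrite !Derive_const, !Rmult_0_r. apply Rplus_0_l. }
  apply integral_along_unique with arg_x arg_y (fun _ : R => - RtoC k)%C; [|exact Z].
  set (h := fun st : R * R => (RtoC (1 - fst st) * ga (snd st) - RtoC k)%C).
  apply integral_along_ext with (fun t => h (1, t)).
  { intros t _. unfold h; simpl. rewrite Rminus_diag. ring. }
  apply winding_homotopy.
  + intros x. unfold h. cont.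
  + intros s t Hs Ht E0. apply (f_equal Re) in E0. unfold h, Re in E0; simpl in E0.
    specialize (Hgale t). unfold Re, Im in Hgale.
    assert (fst (ga t) <= 1) by nra.
    assert ((1 - s) * fst (ga t) <= (1 - s) * 1) by (apply Rmult_le_compat_l; lra). lra.
  + intros s _. unfold h; simpl. now rewrite Ga1.
  + apply integral_along_ext with (fun t => ga t - RtoC k)%C; [|exact Sh].
    intros t _. unfold h; simpl. rewrite Rminus_0_r. ring.
Qed.

Section Loop.
Variables (Om : C -> Prop) (g : R -> C) (r : R).
Hypotheses (HO : open Om) (Hr : 0 < r) (Hdisc : forall z, Cmod z <= r -> Om z)
  (HL : end_loop Om g)
  (Hside : forall t, exists n : C, Re (n * Cconj (path_velocity g t))%C = 0 /\
     Im (Cconj (path_velocity g t) * n)%C < 0 /\ towards_puncture Om g t n).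

Lemma loop_C1 : C1_path g.
Proof.
  destruct HL as (_ & _ & H & _). intros t. destruct (H t) as (A & B & D & E & _). auto.
Qed.

Lemma loop_per t : g (t + 1) = g t.
Proof. apply HL. Qed.

Lemma loop_punctured t : punctured Om (g t).
Proof.
  destruct (periodic_reduce g loop_per t) as (s & Hs & ->).
  destruct HL as (_ & _ & _ & (_ & _ & H) & _). apply H. lra.
Qed.

(** The segment in the conormal direction leads from [g 0] to the start of a path towards the
    puncture, which is then followed until it is close to 0.  The result rests after time 2. *)
Lemma join_path : exists ga : R -> C, (forall u, continuous ga u) /\
  (forall u, punctured Om (ga u)) /\ ga 0 = g 0 /\
  (forall u, 2 <= u -> ga u = ga 2) /\ Cmod (ga 2) <= r.
Proof.
  destruct (Hside 0) as (n & _ & _ & (delta & Hdelta & HT)).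
  destruct (open_has_box _ (g 0) (open_punctured Om HO) (loop_punctured 0)) as (e & He & HB).
  destruct (box_radius (g 0) n e He) as (d & Hd & Hbox).
  set (eps := Rmin delta d / 2).
  assert (Heps : 0 < eps < delta /\ eps < d).
  { assert (A := Rmin_l delta d). assert (B := Rmin_r delta d).
    assert (0 < Rmin delta d) by (apply Rmin_glb_lt; lra). unfold eps. lra. }
  destruct (HT eps ltac:(lra)) as (path & Hpc & Hp0 & Hp1 & Hp).
  assert (N0 : path 0 <> 0%C).
  { rewrite Hp0. apply (HB (g 0 + RtoC eps * n)%C).
    replace (g 0 + RtoC eps * n)%C with (g 0 + RtoC 1 * (RtoC eps * n))%C by ring.
    apply Hbox; lra. }
  destruct (stop_before_zero path r Hpc N0 Hp1 Hr) as (m & Hm & Hmr & Hmz).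
  set (ga := fun u => (path (clamp m (u - 1)) + RtoC (clamp 1 u - 1) * (RtoC eps * n))%C).
  exists ga.
  assert (High : forall u, 1 <= u -> ga u = path (clamp m (u - 1))).
  { intros u Hu. unfold ga. rewrite (clamp_high 1 u) by lra. rewrite Rminus_diag. ring. }
  assert (Low : forall u, u <= 1 -> ga u = (g 0 + RtoC (clamp 1 u) * (RtoC eps * n))%C).
  { intros u Hu. unfold ga. rewrite (clamp_low m) by lra. rewrite Hp0, RtoC_minus. ring. }
  assert (Cp : forall u, continuous path u) by auto.
  split; [|split; [|split; [|split]]].
  - intros u. unfold ga. cont.
  - intros u. destruct (Rle_lt_dec u 1) as [Hu|Hu].
    + rewrite Low by assumption. apply HB, Hbox; [apply clamp_range; lra | lra].
    + rewrite High by lra. assert (R := clamp_range m (u - 1) ltac:(lra)).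
      split; [apply Hp; lra | apply Hmz; lra].
  - rewrite Low by lra. rewrite clamp_low by lra. ring.
  - intros u Hu. rewrite !High by lra. rewrite !(clamp_high m) by lra. reflexivity.
  - rewrite High by lra. rewrite clamp_high by lra. exact Hmr.
Qed.

(* One turn around the unit circle, during the middle third of the unit interval. *)
Let E (t : R) : C := cexp (0, 2 * PI * clamp 1 (3 * t - 1)).

Lemma E_continuous t : continuous E t.
Proof. assert (Ce := continuous_cexp). unfold E. cont. Qed.

Lemma E_low t : 3 * t <= 1 -> E t = 1%C.
Proof.
  intros H. unfold E. rewrite clamp_low by lra. rewrite Rmult_0_r.
  unfold cexp; simpl. rewrite exp_0, cos_0, sin_0. apply injective_projections; simpl; ring.
Qed.

Lemma E_high t : 2 <= 3 * t -> E t = 1%C.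
Proof.
  intros H. unfold E. rewrite clamp_high by lra. rewrite Rmult_1_r.
  unfold cexp; simpl. rewrite exp_0, cos_2PI, sin_2PI. apply injective_projections; simpl; ring.
Qed.

(** The loop that follows the joining path to a point close to 0, turns once around 0 and comes back
    is based at [g 0], so it is homotopic to a power of g.  It is also freely homotopic to the turn
    alone, and the latter to a circle, by exp of the segments between their logarithms. *)
Lemma circle_turns : exists n : Z, forall p q : C -> R,
  (forall z, punctured Om z -> continuous p z) ->
  (forall z, punctured Om z -> continuous q z) ->
  locally_exact (punctured Om) p q ->
  RInt (form_along p q (circle r)) 0 1 = IZR n * RInt (form_along p q g) 0 1.
Proof.
  destruct join_path as (ga & Cga & Pga & Ga0 & Ga2 & Gar).
  (* At s = 0: the joining path up to time 2, the turn, the joining path backwards, each during a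
  third of the interval.  At s = 1: the turn only, as ga rests after time 2. *)
  set (h := fun st : R * R =>
    (ga (Rmax (2 * fst st) (Rmin (6 * snd st) (6 - 6 * snd st))) * E (snd st))%C).
  assert (Ch : forall x, continuous h x).
  { intros x. assert (CE := E_continuous). unfold h. cont. }
  assert (Ph : forall s t, punctured Om (h (s, t))).
  { intros s t. unfold h; simpl.
    destruct (Rle_lt_dec (3 * t) 1) as [H1|H1]; [rewrite E_low, Cmult_1_r by lra; apply Pga|].
    destruct (Rle_lt_dec 2 (3 * t)) as [H2|H2]; [rewrite E_high, Cmult_1_r by lra; apply Pga|].
    rewrite Ga2.
    - split.
      + apply Hdisc. rewrite Cmod_mult. unfold E. rewrite Cmod_cexp. simpl. rewrite exp_0, Rmult_1_r.
        exact Gar.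
      + apply Cmult_nonzero; [apply (Pga 2) | apply cexp_nz].
    - apply Rle_trans with (Rmin (6 * t) (6 - 6 * t)); [apply Rmin_glb; lra | apply Rmax_r]. }
  assert (E0 : E 0 = 1%C) by (apply E_low; lra).
  assert (E1 : E 1 = 1%C) by (apply E_high; lra).
  assert (Lh : forall s, h (s, 0) = h (s, 1)).
  { intros s. unfold h; simpl. rewrite E0, E1. do 3 f_equal. unfold Rmin.
    destruct (Rle_dec (6 * 0) (6 - 6 * 0)), (Rle_dec (6 * 1) (6 - 6 * 1)); lra. }
  destruct HL as (_ & _ & _ & (_ & Hgen)).
  destruct (Hgen (fun t => h (0, t))) as [n Hn].
  { split; [|split].
    - intros t. apply (continuous_comp (fun t : R => (0, t)) h); [cont | apply Ch].
    - apply Lh.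
    - intros t _. apply Ph. }
  { unfold h; simpl. rewrite E0, Cmult_1_r.
    rewrite <- Ga0. f_equal. rewrite Rmin_left, Rmax_left by lra. ring. }
  destruct Hn as (H & CH & PH & H01 & Hends).
  exists n. intros p q Cp Cq Hex.
  assert (Hg := loop_C1).
  destruct (C1_circle r) as [HC _].
  (* From the circle to the turn of ga 2, by a segment between their logarithms. *)
  destruct (cexp_surj (ga 2) (proj2 (Pga 2))) as [a Ha].
  set (w := fun st : R * R => (RtoC (fst st) * (a + RtoC (clamp 1 (3 * snd st - 1)) * (0%R, (2 * PI)%R)) +
      RtoC (1 - fst st) * (RtoC (ln r) + RtoC (snd st) * (0%R, (2 * PI)%R)))%C).
  assert (Cw : forall x, continuous w x).
  { intros x. unfold w. cont. }
  assert (Hra : Re a <= ln r).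
  { rewrite <- Ha, Cmod_cexp in Gar. rewrite <- (ln_exp (Re a)). apply ln_le; [apply exp_pos|exact Gar]. }
  apply (integral_along_unique p q (fun t => g (IZR n * t))).
  2:{ rewrite <- RInt_turns.
      - apply integral_along_C1 with (punctured Om); auto.
        + destruct (C1_path_affine g 0 (IZR n) Hg) as [K _].
          assert (EE : (fun t => g (IZR n * t)) = (fun t => g (0 + IZR n * t))).
          { apply functional_extensionality. intros t. f_equal. ring. }
          rewrite EE. exact K.
        + intros; apply loop_punctured.
      - exact Hg.
      - exact loop_per.
      - intros t. split; [apply Cp | apply Cq]; apply loop_punctured. }
  assert (I0 : integral_along p q (circle r) (RInt (form_along p q (circle r)) 0 1)).
  { apply integral_along_C1 with (punctured Om); auto.
    intros t _. split; [apply Hdisc; rewrite Cmod_circle; lra|].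
    rewrite circle_cexp by assumption. apply cexp_nz. }
  set (I := RInt (form_along p q (circle r)) 0 1) in *. clearbody I.
  assert (I1 : integral_along p q (fun t => h (1, t)) I).
  { apply integral_along_ext with (fun t => (fun st => cexp (w st)) (1, t)).
    { intros t _. unfold w, h; simpl. rewrite Ga2; [|apply Rle_trans with (2 * 1); [lra|apply Rmax_l]].
      rewrite <- Ha. unfold E. rewrite <- cexp_plus. f_equal. rewrite Rminus_diag.
      apply injective_projections; simpl; ring. }
    apply (chain_homotopy (punctured Om) p q Cp Cq Hex (fun st => cexp (w st))).
    - intros x. apply (continuous_comp w cexp); [apply Cw|apply continuous_cexp].
    - intros s t Hs Ht. split; [|apply cexp_nz]. apply Hdisc. rewrite Cmod_cexp.
      rewrite <- (exp_ln r) by assumption.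
      assert (K : Re (w (s, t)) = s * Re a + (1 - s) * ln r).
      { unfold w, Re; simpl. ring. }
      rewrite K. destruct (Req_dec (s * Re a + (1 - s) * ln r) (ln r)) as [->|Hne]; [lra|].
      left. apply exp_increasing. assert (s * Re a <= s * ln r) by (apply Rmult_le_compat_l; lra). lra.
    - intros s _. rewrite <- (cexp_2PI (w (s, 0))). f_equal. unfold w; simpl.
      rewrite (clamp_low 1 (3 * 0 - 1)), (clamp_high 1 (3 * 1 - 1)) by lra.
      apply injective_projections; simpl; ring.
    - apply integral_along_ext with (circle r); [|exact I0].
      intros t _. rewrite circle_cexp by assumption. f_equal. unfold w; simpl. rewrite Rminus_0_r.
      apply injective_projections; simpl; ring. }
  assert (I2 : integral_along p q (fun t => h (0, t)) I).
  { apply integral_along_ext with (fun t => (fun st => h (1 - fst st, snd st)) (1, t)).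
    { intros t _; simpl. now rewrite Rminus_diag. }
    apply (chain_homotopy (punctured Om) p q Cp Cq Hex (fun st => h (1 - fst st, snd st))).
    - intros x. apply (continuous_comp (fun st : R * R => (1 - fst st, snd st)) h); [cont | apply Ch].
    - intros s t _ _. apply Ph.
    - intros s _. simpl. apply Lh.
    - apply integral_along_ext with (fun t => h (1, t)); [|exact I1].
      intros t _; simpl. now rewrite Rminus_0_r. }
  apply integral_along_ext with (fun t => H (1, t)).
  { intros t Ht. now apply H01. }
  apply (chain_homotopy (punctured Om) p q Cp Cq Hex H I CH PH).
  - intros s Hs. destruct (Hends s Hs) as [-> ->]. reflexivity.
  - apply integral_along_ext with (fun t => h (0, t)); [|exact I2].
    intros t Ht. symmetry. now apply H01.
Qed.

Lemma arg_exact_punctured : locally_exact (punctured Om) arg_x arg_y.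
Proof.
  destruct C1_arg as [A1 A2].
  assert (Sub : forall f, C1_on nonzeroC f -> C1_on (punctured Om) f).
  { intros f Hf z Hz. apply Hf, Hz. }
  apply closed_locally_exact; auto; [now apply open_punctured|].
  intros z Hz. apply arg_closed, Hz.
Qed.

(** Applied to the angle form, whose integral over the circle is 2 pi, the previous lemma shows
    that g has nonzero winding number. *)
Lemma turns_winding (W : R) : winding g W -> exists n : Z, 2 * PI = IZR n * W /\
  forall p q : C -> R,
  (forall z, punctured Om z -> continuous p z) ->
  (forall z, punctured Om z -> continuous q z) ->
  locally_exact (punctured Om) p q ->
  RInt (form_along p q (circle r)) 0 1 = IZR n * RInt (form_along p q g) 0 1.
Proof.
  intros HW. destruct circle_turns as [n Hn]. exists n. split; [|exact Hn].
  specialize (Hn arg_x arg_y (fun z Hz => proj1 (continuous_arg z (proj2 Hz)))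
     (fun z Hz => proj2 (continuous_arg z (proj2 Hz))) arg_exact_punctured).
  replace (2 * PI) with (RInt (form_along arg_x arg_y (circle r)) 0 1).
  - rewrite Hn. f_equal. apply integral_along_unique with arg_x arg_y g; [|exact HW].
    apply winding_C1; [exact loop_C1|]. intros t _. apply loop_punctured.
  - apply integral_along_unique with arg_x arg_y (circle r); [|now apply winding_circle].
    apply winding_C1; [apply C1_circle|]. intros t _. rewrite circle_cexp by assumption. apply cexp_nz.
Qed.

(** The orientation is decided at the point z0 of the loop that is furthest from 0.  There the
    conormal is radial.  A path from the puncture to a point close to z0, on the side of the
    conormal, avoids the loop; along it the winding number is constant.  A point outside the
    furthest circle has winding number 0, which is excluded, so the point is inside. *)
Lemma loop_winding : winding g (- (2 * PI)).
Proof.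
  assert (Hg := loop_C1).
  set (W := RInt (form_along arg_x arg_y g) 0 1 : R).
  assert (HW : winding g W).
  { apply winding_C1; [exact Hg|]. intros t _. apply loop_punctured. }
  assert (W0 : W <> 0).
  { destruct (turns_winding W HW) as (n & Hn & _). intros E0. rewrite E0 in Hn.
    assert (P := PI_RGT_0). lra. }
  assert (HL' := HL). destruct HL' as (_ & Hinj & Hreg & _).
  destruct (normalized_loop g Hg loop_per Hinj (fun t => proj2 (loop_punctured t))
    (fun t => proj2 (proj2 (proj2 (proj2 (Hreg t))))))
    as (t0 & lam & ga & A3 & Hgaper & Hgainj & Hga0 & Hgale & Vga & Hlam & Hgz & Vz).
  assert (HWga := winding_normalized g ga t0 W Hg loop_per (fun t => proj2 (loop_punctured t)) Hgz HW).
  set (z0 := g t0) in *.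
  assert (Hz0 : nonzeroC z0) by apply loop_punctured.
  assert (Hf0 : 0 < Re z0 ^ 2 + Im z0 ^ 2) by apply (nonzero_norm z0 Hz0).
  destruct (Hside t0) as (n & N1 & N2 & (delta & Hdelta & HT)).
  rewrite Vz in N1, N2. fold z0 in HT.
  set (nu := (n * / z0)%C).
  assert (Hn : n = (nu * z0)%C).
  { unfold nu. rewrite <- Cmult_assoc, Cinv_l by exact Hz0. ring. }
  clearbody nu. rewrite Hn in N1, N2.
  (* The velocity at t0 is i lam z0, and n is perpendicular to it, on its right. *)
  assert (HNu : Im nu = 0 /\ 0 < lam * Re nu).
  { clearbody z0. clear - N1 N2 Hf0 Hlam.
    unfold Re, Im in *; simpl in *. split.
    - assert (K : lam * (fst z0 * (fst z0 * 1) + snd z0 * (snd z0 * 1)) * snd nu = 0) by nra.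
      apply Rmult_integral in K. destruct K as [K|K]; [|exact K].
      apply Rmult_integral in K. destruct K as [K|K]; [contradiction|lra].
    - assert (K : 0 < (lam * fst nu) * (fst z0 * (fst z0 * 1) + snd z0 * (snd z0 * 1))) by nra.
      nra. }
  destruct HNu as [Nu1 Nu2].
  assert (Cga : forall t, continuous ga t) by (intros; now apply C1_path_continuous).
  assert (Ga1 : ga 1 = ga 0) by (rewrite <- (Hgaper 0); f_equal; ring).
  (* The path from the puncture, divided by z0, ends at the real point 1 + eps Re nu. *)
  assert (Shift : forall eps, 0 < eps < delta ->
    winding (fun t => ga t - RtoC (1 + eps * Re nu))%C W).
  { intros eps Heps. destruct (HT eps Heps) as (path & Pc & P0 & P1 & Pav).
    set (h := fun st : R * R => (ga (snd st) - path (clamp 1 (1 - fst st)) * / z0)%C).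
    apply integral_along_ext with (fun t => h (1, t)).
    { intros t _. unfold h; simpl. rewrite clamp_low by lra. rewrite P0, Hn. f_equal. f_equal.
      replace ((z0 + RtoC eps * (nu * z0)) * / z0)%C with ((1 + RtoC eps * nu) * (z0 * / z0))%C by ring.
      rewrite Cinv_r by exact Hz0. apply injective_projections; unfold Re, Im in *; simpl; rewrite ?Nu1; ring. }
    apply winding_homotopy.
    - intros x. unfold h. cont.
    - intros s t _ _. unfold h; simpl. intros E0.
      assert (E1 : path (clamp 1 (1 - s)) = g (t0 + 1 * t)).
      { rewrite Hgz. replace (ga t) with (path (clamp 1 (1 - s)) * / z0)%C.
        - rewrite <- Cmult_assoc, Cinv_l by exact Hz0. ring.
        - replace (ga t) with (ga t - path (clamp 1 (1 - s)) * / z0 + path (clamp 1 (1 - s)) * / z0)%C by ring.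
          rewrite E0. ring. }
      assert (Rg := clamp_range 1 (1 - s) ltac:(lra)).
      now apply (proj2 (Pav _ Rg) (t0 + 1 * t)).
    - intros s _. unfold h; simpl. now rewrite Ga1.
    - apply integral_along_ext with ga; [|exact HWga].
      intros t _. unfold h; simpl. rewrite clamp_high by lra. rewrite P1. ring. }
  destruct (Rlt_le_dec 0 lam) as [Hpos|Hneg].
  - (* counterclockwise at an extremal point: the puncture would lie outside *)
    exfalso. apply W0.
    assert (Hnu : 0 < Re nu) by nra.
    apply (winding_outside ga (1 + delta / 2 * Re nu)); auto; [|apply Shift; lra].
    assert (0 < delta / 2 * Re nu) by (apply Rmult_lt_0_compat; lra). lra.
  - assert (Hl : lam < 0) by lra.
    assert (Hnu : Re nu < 0) by nra.
    destruct (inner_winding ga lam A3 Hgaper Hgainj Hga0 Hgale Vga Hl) as (e0 & He0 & K).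
    (* Small enough for the path to exist and for the end point to be close to 1. *)
    set (eps := Rmin (delta / 2) (e0 / (2 * - Re nu))).
    assert (Q : 0 < e0 / (2 * - Re nu)) by (apply Rdiv_lt_0_compat; lra).
    assert (Heps : 0 < eps < delta).
    { split; [apply Rmin_glb_lt; lra|]. apply Rle_lt_trans with (delta / 2); [apply Rmin_l|lra]. }
    assert (Heps2 : eps <= e0 / (2 * - Re nu)) by apply Rmin_r.
    assert (Hee : 0 < eps * - Re nu < e0).
    { split; [apply Rmult_lt_0_compat; lra|].
      apply Rle_lt_trans with (e0 / (2 * - Re nu) * - Re nu); [apply Rmult_le_compat_r; lra|].
      replace (e0 / (2 * - Re nu) * - Re nu) with (e0 / 2) by (field; lra). lra. }
    destruct (K _ Hee) as [_ K2].
    replace (- (2 * PI)) with W; [exact HW|].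
    apply integral_along_unique with arg_x arg_y (fun t => ga t - RtoC (1 + eps * Re nu))%C.
    + now apply Shift.
    + replace (1 + eps * Re nu) with (1 - eps * - Re nu) by ring. exact K2.
Qed.

Lemma loop_integral (p q : C -> R) :
  (forall z, punctured Om z -> continuous p z) ->
  (forall z, punctured Om z -> continuous q z) ->
  locally_exact (punctured Om) p q ->
  RInt (form_along p q g) 0 1 = - RInt (form_along p q (circle r)) 0 1.
Proof.
  intros Cp Cq Hex. destruct (turns_winding _ loop_winding) as (n & Ha & Hn).
  assert (Hn1 : IZR n = -1).
  { assert (P := PI_RGT_0). apply Rmult_eq_reg_r with (2 * PI); lra. }
  rewrite (Hn p q Cp Cq Hex), Hn1.
  assert (K : forall x : R, x = - (-1 * x)) by (intros; ring). apply K.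
Qed.
End Loop.

(** * Green's formula on the unit disk *)

Lemma continuous_RInt_param (f : R -> R -> R) (a b c : R) :
  a <= b ->
  (forall t, a <= t <= b -> continuity_2d_pt f c t) ->
  locally c (fun x => ex_RInt (f x) a b) ->
  continuous (fun x => RInt (f x) a b) c.
Proof.
  intros Hab Hf [d0 Hex].
  apply filterlim_locally. intros eps.
  assert (He : 0 < eps / (2 * (b - a + 1))) by (destruct eps; apply Rdiv_lt_0_compat; simpl; lra).
  destruct (uniform_continuity_2d_1d' f a b c Hf (mkposreal _ He)) as [d Hd].
  assert (Hm : 0 < Rmin d0 d) by (apply Rmin_glb_lt; apply cond_pos).
  exists (mkposreal _ Hm). intros x Hx. change (Rabs (x - c) < Rmin d0 d) in Hx.
  assert (A := Rmin_l d0 d). assert (B := Rmin_r d0 d).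
  assert (E1 : ex_RInt (f x) a b) by (apply Hex; change (Rabs (x - c) < d0); lra).
  assert (E2 : ex_RInt (f c) a b) by (apply Hex; apply ball_center).
  change (Rabs (RInt (f x) a b - RInt (f c) a b) < eps).
  assert (E := RInt_minus (V := R_CompleteNormedModule) (f x) (f c) a b E1 E2).
  change (RInt (f x) a b - RInt (f c) a b) with (minus (RInt (f x) a b) (RInt (f c) a b)).
  rewrite <- E.
  apply Rle_lt_trans with ((b - a) * (eps / (2 * (b - a + 1)))).
  - apply abs_RInt_le_const; [exact Hab|now apply (ex_RInt_minus (V := R_NormedModule))|].
    intros t Ht. left. assert (Hx' := Rabs_def2 _ _ Hx). destruct d as [d Pd]; simpl in *.
    apply (Hd t c t x); try lra. rewrite Rminus_diag, Rabs_R0. exact Pd.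
  - destruct eps as [eps Pe]; simpl in *.
    replace ((b - a) * (eps / (2 * (b - a + 1)))) with (eps * ((b - a) / (2 * (b - a + 1)))) by (field; lra).
    rewrite <- (Rmult_1_r eps) at 2. apply Rmult_lt_compat_l; [exact Pe|].
    apply Rmult_lt_reg_r with (2 * (b - a + 1)); [lra|].
    unfold Rdiv. rewrite Rmult_assoc, Rinv_l by lra. lra.
Qed.

Definition polar (r th : R) : C := (r * cos th, r * sin th).

Lemma open_disk rho : open (fun z => Cmod z < rho).
Proof.
  intros z Hz.
  assert (K : continuous Cmod z) by apply (filterlim_norm (K := C_AbsRing) (V := C_NormedModule) z).
  apply (K (fun x => x < rho)). now apply (open_lt rho).
Qed.

Lemma continuous_polar (f : C -> R) (r th : R) :
  continuous f (polar r th) -> continuity_2d_pt (fun r th => f (polar r th)) r th.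
Proof.
  intros H. apply continuity_2d_pt_filterlim.
  apply (continuous_comp (fun x : R * R => polar (fst x) (snd x)) f); [|exact H].
  unfold polar. cont.
Qed.

Lemma Cmod_polar r th : Cmod (polar r th) = Rabs r.
Proof.
  apply sqr_inj; [apply Cmod_ge_0|apply Rabs_pos|].
  rewrite Cmod_sqr, RPow_abs, Rabs_pos_eq by apply pow2_ge_0.
  unfold polar; simpl. assert (K := sin2_cos2 th). unfold Rsqr in K.
  transitivity (r ^ 2 * (sin th * sin th + cos th * cos th)); [ring|rewrite K; ring].
Qed.

Section Green.
Variables (rho : R) (P Q : C -> R).
Hypotheses (Hrho : 1 < rho).
Let D (z : C) : Prop := Cmod z < rho.
Hypotheses (HP : C1_on D P) (HQ : C1_on D Q).

(* The form P dx + Q dy is b dr + a dtheta; ar and bt are the derivatives of a in r and of b in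
theta. *)
Let a (r th : R) : R := r * (- P (polar r th) * sin th + Q (polar r th) * cos th).
Let b (r th : R) : R := P (polar r th) * cos th + Q (polar r th) * sin th.
Let ar (r th : R) : R := (- P (polar r th) * sin th + Q (polar r th) * cos th) +
  r * (- (dx P (polar r th) * cos th + dy P (polar r th) * sin th) * sin th +
       (dx Q (polar r th) * cos th + dy Q (polar r th) * sin th) * cos th).
Let bt (r th : R) : R :=
  (dx P (polar r th) * (- (r * sin th)) + dy P (polar r th) * (r * cos th)) * cos th
  - P (polar r th) * sin th +
  ((dx Q (polar r th) * (- (r * sin th)) + dy Q (polar r th) * (r * cos th)) * sin th
  + Q (polar r th) * cos th).

Lemma D_polar r th : - rho < r < rho -> D (polar r th).
Proof. intros H. unfold D. rewrite Cmod_polar. now apply Rabs_def1. Qed.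

Lemma polar_dr (f : C -> R) r th : C1_on D f -> - rho < r < rho ->
  is_derive (fun r => f (polar r th)) r (dx f (polar r th) * cos th + dy f (polar r th) * sin th).
Proof.
  intros Hf Hr. apply (C1_curve D f (fun r => polar r th)); auto.
  - apply open_disk.
  - now apply D_polar.
  - unfold polar; simpl. auto_derive; auto; ring.
  - unfold polar; simpl. auto_derive; auto; ring.
Qed.

Lemma polar_dth (f : C -> R) r th : C1_on D f -> - rho < r < rho ->
  is_derive (fun th => f (polar r th)) th (dx f (polar r th) * (- (r * sin th)) + dy f (polar r th) * (r * cos th)).
Proof.
  intros Hf Hr. apply (C1_curve D f (fun th => polar r th)); auto.
  - apply open_disk.
  - now apply D_polar.
  - unfold polar; simpl. auto_derive; auto; ring.
  - unfold polar; simpl. auto_derive; auto; ring.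
Qed.

Lemma a_dr r th : - rho < r < rho -> is_derive (fun r => a r th) r (ar r th).
Proof.
  intros Hr. assert (D1 := polar_dr P r th HP Hr). assert (D2 := polar_dr Q r th HQ Hr).
  unfold a. evar_last.
  - apply (is_derive_mult_R (fun r => r)); [apply (is_derive_id r)|].
    apply (is_derive_plus (fun r => - P (polar r th) * sin th)).
    + apply (is_derive_mult_R (fun r => - P (polar r th))); [apply (is_derive_opp (fun r => P (polar r th))); exact D1|apply (is_derive_const (sin th))].
    + apply (is_derive_mult_R (fun r => Q (polar r th))); [exact D2|apply (is_derive_const (cos th))].
  - unfold ar, plus, opp, zero, one; simpl. unfold opp, zero; simpl. ring.
Qed.

Lemma b_dth r th : - rho < r < rho -> is_derive (fun th => b r th) th (bt r th).
Proof.
  intros Hr. assert (D1 := polar_dth P r th HP Hr). assert (D2 := polar_dth Q r th HQ Hr).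
  assert (Dc : is_derive cos th (- sin th)) by (auto_derive; auto; ring).
  assert (Ds : is_derive sin th (cos th)) by (auto_derive; auto; ring).
  unfold b. evar_last.
  - apply (is_derive_plus (fun th => P (polar r th) * cos th)).
    + apply (is_derive_mult_R (fun th => P (polar r th))); [exact D1|exact Dc].
    + apply (is_derive_mult_R (fun th => Q (polar r th))); [exact D2|exact Ds].
  - unfold bt, plus; simpl. ring.
Qed.

Lemma cont2_cos r th : continuity_2d_pt (fun _ th => cos th) r th.
Proof.
  apply (continuity_1d_2d_pt_comp cos (fun _ v => v)); [|apply continuity_2d_pt_id2].
  apply continuity_cos.
Qed.
Lemma cont2_sin r th : continuity_2d_pt (fun _ th => sin th) r th.
Proof.
  apply (continuity_1d_2d_pt_comp sin (fun _ v => v)); [|apply continuity_2d_pt_id2].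
  apply continuity_sin.
Qed.

Lemma cont2_C1 (f : C -> R) r th : C1_on D f -> - rho < r < rho ->
  continuity_2d_pt (fun r th => f (polar r th)) r th /\
  continuity_2d_pt (fun r th => dx f (polar r th)) r th /\
  continuity_2d_pt (fun r th => dy f (polar r th)) r th.
Proof.
  intros Hf Hr. assert (K := D_polar r th Hr). repeat split; apply continuous_polar.
  - now apply C1_continuous with D; [apply open_disk| |].
  - now apply C1_cont_dx with D.
  - now apply C1_cont_dy with D.
Qed.

Ltac cont2 := repeat first
  [ assumption | apply cont2_cos | apply cont2_sin | apply continuity_2d_pt_id1
  | apply continuity_2d_pt_plus | apply continuity_2d_pt_minus
  | apply continuity_2d_pt_mult | apply continuity_2d_pt_opp ].

Lemma cont2_ar r th : - rho < r < rho -> continuity_2d_pt ar r th.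
Proof.
  intros Hr. destruct (cont2_C1 P r th HP Hr) as (A1 & A2 & A3).
  destruct (cont2_C1 Q r th HQ Hr) as (B1 & B2 & B3). unfold ar. cont2.
Qed.

Lemma cont2_bt r th : - rho < r < rho -> continuity_2d_pt bt r th.
Proof.
  intros Hr. destruct (cont2_C1 P r th HP Hr) as (A1 & A2 & A3).
  destruct (cont2_C1 Q r th HQ Hr) as (B1 & B2 & B3). unfold bt. cont2.
Qed.

Lemma cont2_a r th : - rho < r < rho -> continuity_2d_pt a r th.
Proof.
  intros Hr. destruct (cont2_C1 P r th HP Hr) as (A1 & A2 & A3).
  destruct (cont2_C1 Q r th HQ Hr) as (B1 & B2 & B3). unfold a. cont2.
Qed.

Lemma cont2_snd (f : R -> R -> R) r th : continuity_2d_pt f r th -> continuous (f r) th.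
Proof.
  intros H. apply continuity_2d_pt_filterlim in H.
  apply (continuous_comp (fun t : R => (r, t) : R * R) (fun z => f (fst z) (snd z))); [cont | exact H].
Qed.

Lemma near_r r : - rho < r < rho -> locally r (fun x => - rho < x < rho).
Proof.
  intros Hr. apply (open_and _ _ (open_gt (- rho)) (open_lt rho)). exact Hr.
Qed.

(** In polar coordinates the form P dx + Q dy is b dr + a dtheta, with curl a_r - b_theta.  The
    second term vanishes after integration over a full turn.  The first one leaves the integral of
    a over the unit circle, because a vanishes at r = 0. *)
Lemma green_disk :
  RInt (fun r => RInt (fun th => (dx Q (polar r th) - dy P (polar r th)) * r) 0 (2 * PI)) 0 1 =
  RInt (fun th => - P (polar 1 th) * sin th + Q (polar 1 th) * cos th) 0 (2 * PI).
Proof.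
  assert (PP := PI_RGT_0).
  assert (Ex : forall f : R -> R -> R, (forall r th, - rho < r < rho -> continuity_2d_pt f r th) ->
     forall r, - rho < r < rho -> ex_RInt (f r) 0 (2 * PI)).
  { intros f Hf r Hr. apply (ex_RInt_continuous (V := R_CompleteNormedModule)).
    intros t _. apply cont2_snd. now apply Hf. }
  assert (Inner : forall r, - rho < r < rho ->
    RInt (fun th => (dx Q (polar r th) - dy P (polar r th)) * r) 0 (2 * PI) =
    RInt (ar r) 0 (2 * PI)).
  { intros r Hr.
    rewrite (RInt_ext _ (fun th => minus (ar r th) (bt r th))).
    2:{ intros th _. unfold minus, plus, opp; simpl. unfold ar, bt.
        assert (K := sin2_cos2 th). unfold Rsqr in K.
        transitivity ((dx Q (polar r th) - dy P (polar r th)) * r * (sin th * sin th + cos th * cos th));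
          [rewrite K; ring | ring]. }
    etransitivity; [apply (RInt_minus (V := R_CompleteNormedModule) (ar r) (bt r));
      apply Ex; auto; [apply cont2_ar | apply cont2_bt]|].
    rewrite (is_RInt_unique (bt r) 0 (2 * PI) (minus (b r (2 * PI)) (b r 0))).
    - unfold b, polar. rewrite cos_2PI, sin_2PI, cos_0, sin_0.
      unfold minus, plus, opp; simpl. ring.
    - apply (is_RInt_derive (V := R_CompleteNormedModule) (b r)).
      + intros th _. now apply b_dth.
      + intros th _. apply cont2_snd. now apply cont2_bt. }
  set (A := fun r => RInt (a r) 0 (2 * PI)).
  assert (DA : forall r, - rho < r < rho -> is_derive A r (RInt (ar r) 0 (2 * PI))).
  { intros r Hr.
    assert (E : RInt (ar r) 0 (2 * PI) = RInt (fun t => Derive (fun u => a u t) r) 0 (2 * PI)).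
    { apply RInt_ext. intros th _. symmetry. apply is_derive_unique. now apply a_dr. }
    rewrite E.
    apply (is_derive_RInt_param a).
    - apply filter_imp with (2 := near_r r Hr). intros x Hx t _. eexists. now apply a_dr.
    - intros t _. apply continuity_2d_pt_ext_loc with ar; [|now apply cont2_ar].
      destruct (near_r r Hr) as [d Hd]. exists d. intros u v Hu _.
      symmetry. apply is_derive_unique. apply a_dr. apply Hd. exact Hu.
    - apply filter_imp with (2 := near_r r Hr). intros x Hx. apply Ex; auto. apply cont2_a. }
  rewrite (RInt_ext _ (fun r => RInt (ar r) 0 (2 * PI))).
  2:{ intros r Hr. rewrite Rmin_left, Rmax_right in Hr by lra. apply Inner. lra. }
  rewrite (is_RInt_unique _ 0 1 (minus (A 1) (A 0))).
  - assert (A0 : A 0 = 0).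
    { unfold A. rewrite (RInt_ext _ (fun _ => 0)).
      - rewrite RInt_const. unfold scal; simpl; unfold mult; simpl. ring.
      - intros t _. unfold a. apply Rmult_0_l. }
    rewrite A0.
    transitivity (A 1); [unfold minus, plus, opp; simpl; ring|].
    apply RInt_ext. intros t _. unfold a. apply Rmult_1_l.
  - apply (is_RInt_derive (V := R_CompleteNormedModule) A).
    + rewrite Rmin_left, Rmax_right by lra. intros r Hr. apply DA. lra.
    + rewrite Rmin_left, Rmax_right by lra. intros r Hr.
      apply continuous_RInt_param; [lra| |].
      * intros t _. apply cont2_ar. lra.
      * apply filter_imp with (2 := near_r r ltac:(lra)). intros x Hx. apply Ex; auto. apply cont2_ar.
Qed.
End Green.

(** * The one-form of a Killing field *)

(** The Killing field that extends the holomorphic vector field a z^2 + b z + c from the boundary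
    plane; on the half-space it is characterised by these values at w = 0. *)
Definition killing (a b c : C) (p : point) : point :=
  let z := fst p in let w := cw p in
  ((a * z * z + b * z + c - Cconj a * RtoC (w ^ 2))%C, w * Re (RtoC 2 * a * z + b)%C).

(** The complex one-form of the Killing field.  Its real part is minus the metric dual of the field
    and half of its imaginary part is a potential for the contraction of the volume form with it.
    The (1, 0) part of its pull-back to a Bryant surface is holomorphic. *)
Definition killing_form (a b c : C) (p V : point) : C :=
  let z := fst p in let i := RtoC (/ cw p) in
  (a * fst V - Cconj (fst V) * (a * z * z + b * z + c) * (i * i)
   - RtoC (cw V) * i * (RtoC 2 * a * z + b))%C.

Lemma killing_form_Re a b c p V : 0 < cw p -> Re (killing_form a b c p V) = - hdot p V (killing a b c p).
Proof.
  intros Hp. destruct a as [a1 a2], b as [b1 b2], c as [c1 c2], p as [[u v] w], V as [[x y] t].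
  unfold killing_form, hdot, edot, killing, cu, cv, cw, Re, Im in *; simpl in *. field. lra.
Qed.

Lemma killing_form_add a b c p V W s t :
  killing_form a b c p (vadd (vscal s V) (vscal t W)) =
  (RtoC s * killing_form a b c p V + RtoC t * killing_form a b c p W)%C.
Proof.
  destruct a as [a1 a2], b as [b1 b2], c as [c1 c2], p as [[u v] w], V as [[x y] x0], W as [[x' y'] t'].
  unfold killing_form, vadd, vscal, cu, cv, cw, Re, Im; simpl. apply injective_projections; simpl; ring.
Qed.

(** Regularity and derivatives go together, so that both follow at once from the shape of an
    expression. *)
Definition C1_partials (S : C -> Prop) (z : C) (f : C -> C) (fx fy : C) : Prop :=
  C1c S f /\ partials f z fx fy.

Section C1_partials.
Variables (S : C -> Prop) (HS : open S) (z : C) (Hz : S z).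

Lemma C1_partials_plus f g fx fy gx gy : C1_partials S z f fx fy -> C1_partials S z g gx gy ->
  C1_partials S z (fun z => f z + g z)%C (fx + gx)%C (fy + gy)%C.
Proof. intros [] []. split; [now apply C1c_plus | now apply partials_plus]. Qed.

Lemma C1_partials_minus f g fx fy gx gy : C1_partials S z f fx fy -> C1_partials S z g gx gy ->
  C1_partials S z (fun z => f z - g z)%C (fx - gx)%C (fy - gy)%C.
Proof.
  intros [] []. split; [now apply C1c_minus|]. apply partials_plus; [|apply partials_opp]; assumption.
Qed.

Lemma C1_partials_mult f g fx fy gx gy : C1_partials S z f fx fy -> C1_partials S z g gx gy ->
  C1_partials S z (fun z => f z * g z)%C (fx * g z + f z * gx)%C (fy * g z + f z * gy)%C.
Proof. intros [] []. split; [now apply C1c_mult | now apply partials_mult]. Qed.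

Lemma C1_partials_inv (f : C -> R) : (forall z, S z -> f z <> 0) -> C1_on S f ->
  C1_partials S z (fun z => RtoC (/ f z)) (RtoC (- dx f z / f z ^ 2)) (RtoC (- dy f z / f z ^ 2)).
Proof.
  intros N H. split; [now apply C1c_RtoC, C1_inv|].
  assert (Kx := is_derive_inv (fun x => f (x, Im z)) (Re z) _ (C1_dx S f z H Hz)).
  assert (Ky := is_derive_inv (fun y => f (Re z, y)) (Im z) _ (C1_dy S f z H Hz)).
  cbv beta in Kx, Ky. rewrite pair_eta in Kx, Ky.
  split; split; try apply (is_derive_const 0); [now apply Kx, N | now apply Ky, N].
Qed.
End C1_partials.

Ltac differentiate HS := lazymatch goal with
  | |- C1_partials ?S ?z (fun x => Cplus (@?u x) (@?v x)) _ _ => eapply (C1_partials_plus S HS z u v); differentiate HS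
  | |- C1_partials ?S ?z (fun x => Cminus (@?u x) (@?v x)) _ _ => eapply (C1_partials_minus S HS z u v); differentiate HS
  | |- C1_partials ?S ?z (fun x => Cmult (@?u x) (@?v x)) _ _ => eapply (C1_partials_mult S HS z u v); differentiate HS
  | |- C1_partials ?S ?z _ _ _ => first
     [eassumption | split; [apply (C1c_const S HS) | apply partials_const]]
  end.

Section Forms.
Variables (S : C -> Prop) (HS : open S) (f : C -> point).
Hypotheses (Hf : C2_map S f) (HH : forall z, S z -> 0 < cw (f z)).
Variables (a b c : C).

Lemma C2_fst : C1c S (fun z => fst (f z)).
Proof. destruct Hf as ((H1 & _) & (H2 & _) & _). split; assumption. Qed.
Lemma C2_fst_Dx : C1c S (fun z => fst (Dx f z)).
Proof. destruct Hf as ((_ & H1 & _) & (_ & H2 & _) & _). split; assumption. Qed.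
Lemma C2_fst_Dy : C1c S (fun z => fst (Dy f z)).
Proof. destruct Hf as ((_ & _ & H1) & (_ & _ & H2) & _). split; assumption. Qed.
Lemma C2_cw : C1_on S (fun z => cw (f z)).
Proof. apply Hf. Qed.
Lemma C2_cw_Dx : C1_on S (fun z => cw (Dx f z)).
Proof. destruct Hf as (_ & _ & (_ & H & _)). exact H. Qed.
Lemma C2_cw_Dy : C1_on S (fun z => cw (Dy f z)).
Proof. destruct Hf as (_ & _ & (_ & _ & H)). exact H. Qed.

Lemma W_ne z : S z -> cw (f z) <> 0.
Proof. intros Hz. assert (K := HH z Hz). lra. Qed.

(** The derivatives are written out for any field V along f, to be used with both partial
    derivatives of f. *)
Lemma killing_form_partials (V : C -> point) z : S z -> C1c S (fun z => fst (V z)) -> C1_on S (fun z => cw (V z)) ->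
  exists lx ly, C1_partials S z (fun z => killing_form a b c (f z) (V z)) lx ly /\
  let Z := fst (f z) in let iw := RtoC (/ cw (f z)) in
  let Zx := fst (Dx f z) in let Zy := fst (Dy f z) in
  let ix := RtoC (- cw (Dx f z) / cw (f z) ^ 2) in let iy := RtoC (- cw (Dy f z) / cw (f z) ^ 2) in
  let v := fst (V z) in let vx := cdx (fun z => fst (V z)) z in let vy := cdy (fun z => fst (V z)) z in
  let t := RtoC (cw (V z)) in let tx := RtoC (dx (fun z => cw (V z)) z) in
  let ty := RtoC (dy (fun z => cw (V z)) z) in
  lx = (a * vx - (Cconj vx * (a * Z * Z + b * Z + c) * (iw * iw)
        + Cconj v * (RtoC 2 * a * Z * Zx + b * Zx) * (iw * iw)
        + Cconj v * (a * Z * Z + b * Z + c) * (RtoC 2 * ix * iw))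
        - (tx * iw * (RtoC 2 * a * Z + b) + t * ix * (RtoC 2 * a * Z + b) + t * iw * (RtoC 2 * a * Zx)))%C /\
  ly = (a * vy - (Cconj vy * (a * Z * Z + b * Z + c) * (iw * iw)
        + Cconj v * (RtoC 2 * a * Z * Zy + b * Zy) * (iw * iw)
        + Cconj v * (a * Z * Z + b * Z + c) * (RtoC 2 * iy * iw))
        - (ty * iw * (RtoC 2 * a * Z + b) + t * iy * (RtoC 2 * a * Z + b) + t * iw * (RtoC 2 * a * Zy)))%C.
Proof.
  intros Hz HV HT.
  assert (D0 : forall g, C1c S g -> C1_partials S z g (cdx g z) (cdy g z)).
  { intros g Hg. split; [exact Hg | now apply partials_C1 with S]. }
  assert (D1 := D0 _ C2_fst). assert (D2 := D0 _ HV).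
  assert (D2' := conj (C1c_conj S HS _ HV) (partials_conj _ _ _ _ (proj2 D2))).
  fold (C1_partials S z (fun z => Cconj (fst (V z))) (Cconj (cdx (fun z => fst (V z)) z))
    (Cconj (cdy (fun z => fst (V z)) z))) in D2'.
  assert (D3 : C1_partials S z (fun z => RtoC (cw (V z))) (RtoC (dx (fun z => cw (V z)) z))
    (RtoC (dy (fun z => cw (V z)) z))).
  { split; [now apply C1c_RtoC|]. split; split; try apply (is_derive_const 0);
      [exact (C1_dx S _ z HT Hz) | exact (C1_dy S _ z HT Hz)]. }
  assert (D4 := C1_partials_inv S HS z Hz _ W_ne C2_cw).
  do 2 eexists. split.
  - unfold killing_form. differentiate HS.
  - cbv zeta.
    change (cw (Dx f z)) with (dx (fun z => cw (f z)) z).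
    change (cw (Dy f z)) with (dy (fun z => cw (f z)) z).
    change (fst (Dx f z)) with (cdx (fun z => fst (f z)) z).
    change (fst (Dy f z)) with (cdy (fun z => fst (f z)) z).
    split; ring.
Qed.

Let Px (z : C) : R := / 2 * Im (killing_form a b c (f z) (Dx f z)).
Let Py (z : C) : R := / 2 * Im (killing_form a b c (f z) (Dy f z)).

Lemma C1c_killing_form_x : C1c S (fun z => killing_form a b c (f z) (Dx f z)).
Proof.
  (* The regularity statement is attached to a point of S, which has to exist. *)
  destruct (excluded_middle_informative (exists z, S z)) as [[z Hz]|N].
  - destruct (killing_form_partials (Dx f) z Hz C2_fst_Dx C2_cw_Dx) as (lx & ly & (K & _) & _). exact K.
  - split; intros z Hz; elim N; now exists z.
Qed.

Lemma C1c_killing_form_y : C1c S (fun z => killing_form a b c (f z) (Dy f z)).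
Proof.
  destruct (excluded_middle_informative (exists z, S z)) as [[z Hz]|N].
  - destruct (killing_form_partials (Dy f) z Hz C2_fst_Dy C2_cw_Dy) as (lx & ly & (K & _) & _). exact K.
  - split; intros z Hz; elim N; now exists z.
Qed.

Lemma half_C1 (g : C -> R) : C1_on S g -> C1_on S (fun z => / 2 * g z).
Proof. intros H. apply (C1_mult S HS); [now apply C1_const | exact H]. Qed.

Lemma dx_half g z : dx (fun z => / 2 * g z) z = / 2 * dx g z.
Proof. apply Derive_scal. Qed.
Lemma dy_half g z : dy (fun z => / 2 * g z) z = / 2 * dy g z.
Proof. apply Derive_scal. Qed.

Lemma potential_C1 : C1_on S Px /\ C1_on S Py.
Proof. split; apply half_C1; [apply C1c_killing_form_x | apply C1c_killing_form_y]. Qed.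

Lemma mixed_Z z : S z -> cdx (fun z => fst (Dy f z)) z = cdy (fun z => fst (Dx f z)) z.
Proof.
  intros Hz. destruct Hf as (H1 & H2 & _).
  unfold cdx, cdy. f_equal.
  - apply (mixed_partials S (fun z => cu (f z)) z HS H1 Hz).
  - apply (mixed_partials S (fun z => cv (f z)) z HS H2 Hz).
Qed.

(** The right-hand side is the contraction of the volume form du dv dw / w^3 with the field.  The
    second derivatives of f drop out by symmetry; what remains is an algebraic identity between the
    first derivatives. *)
Lemma potential_curl z : S z ->
  dx Py z - dy Px z = det3 (Dx f z) (Dy f z) (killing a b c (f z)) / cw (f z) ^ 3.
Proof.
  intros Hz.
  destruct (killing_form_partials (Dx f) z Hz C2_fst_Dx C2_cw_Dx) as (lx & ly & (_ & K1) & _ & E1).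
  destruct (killing_form_partials (Dy f) z Hz C2_fst_Dy C2_cw_Dy) as (mx & my & (_ & K2) & E2 & _).
  unfold Px, Py. rewrite dx_half, dy_half.
  change (dy (fun z => Im (killing_form a b c (f z) (Dx f z))) z) with (Im (cdy (fun z => killing_form a b c (f z) (Dx f z)) z)).
  change (dx (fun z => Im (killing_form a b c (f z) (Dy f z))) z) with (Im (cdx (fun z => killing_form a b c (f z) (Dy f z)) z)).
  rewrite (proj2 (partials_eq _ _ _ _ K1)), (proj1 (partials_eq _ _ _ _ K2)), E1, E2.
  rewrite mixed_Z by assumption.
  change (dx (fun z => cw (Dy f z)) z) with (dx (dy (fun z => cw (f z))) z).
  rewrite (mixed_partials S (fun z => cw (f z)) z HS (proj2 (proj2 Hf)) Hz).
  change (dy (fun z => cw (Dx f z)) z) with (dy (dx (fun z => cw (f z))) z).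
  generalize (dy (dx (fun z => cw (f z))) z) (cdy (fun z => fst (Dx f z)) z).
  assert (Hw := W_ne z Hz).
  clear - Hw. revert Hw. generalize (Dx f z) (Dy f z) (f z). clear.
  intros [[ux vx] wx] [[uy vy] wy] [[u v] w] Hw s [t1 t2].
  destruct a as [a1 a2], b as [b1 b2], c as [c1 c2].
  unfold det3, cross, edot, killing, cu, cv, cw, Re, Im in *; simpl in *. field. exact Hw.
Qed.
End Forms.

(** * Killing fields of translations *)

Lemma RtoC_nz (x : R) : x <> 0 -> RtoC x <> 0%C.
Proof. intros H E. apply H. now apply (f_equal Re) in E. Qed.

Lemma RtoC_Rinv (x : R) : RtoC (/ x) = (/ RtoC x)%C.
Proof.
  destruct (Req_dec x 0) as [->|N]; [|now apply RtoC_inv].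
  apply injective_projections; unfold Rdiv; simpl; unfold Rdiv; rewrite ?Rinv_0; ring.
Qed.

Section Mobius.
Variables (a b c d : C) (Hdet : (a * d - b * c)%C = 1%C).

Definition isometry_num (a b c d : C) (z : C) (w : R) : C :=
  ((a * z + b) * Cconj (c * z + d) + a * Cconj c * RtoC (w ^ 2))%C.
Definition isometry_den (c d : C) (z : C) (w : R) : R :=
  Cmod (c * z + d)%C ^ 2 + Cmod c ^ 2 * w ^ 2.

Lemma isometry_eq p : isometry a b c d p =
  ((isometry_num a b c d (fst p) (snd p) / RtoC (isometry_den c d (fst p) (snd p)))%C, snd p / isometry_den c d (fst p) (snd p)).
Proof. reflexivity. Qed.

Lemma isometry_den_C z w : RtoC (isometry_den c d z w) =
  ((c * z + d) * Cconj (c * z + d) + c * Cconj c * RtoC (w ^ 2))%C.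
Proof. unfold isometry_den. rewrite RtoC_plus, RtoC_mult, !Cmod2_conj. reflexivity. Qed.

Lemma isometry_den_pos z w : 0 < w -> 0 < isometry_den c d z w.
Proof.
  intros Hw. unfold isometry_den.
  assert (A := pow2_ge_0 (Cmod (c * z + d)%C)). assert (B := pow2_ge_0 (Cmod c)).
  assert (Hw2 : 0 < w ^ 2) by (apply pow_lt; lra).
  destruct (excluded_middle_informative (c = 0%C)) as [E|N].
  - assert (Hd : d <> 0%C).
    { intros E2. rewrite E, E2 in Hdet. apply (f_equal Re) in Hdet. simpl in Hdet. lra. }
    replace (c * z + d)%C with d by (rewrite E; ring).
    apply Cmod_gt_0 in Hd. assert (0 < Cmod d ^ 2) by (apply pow_lt; lra).
    assert (0 <= Cmod c ^ 2 * w ^ 2) by (apply Rmult_le_pos; lra). lra.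
  - apply Cmod_gt_0 in N. assert (0 < Cmod c ^ 2) by (apply pow_lt; lra).
    assert (0 < Cmod c ^ 2 * w ^ 2) by (apply Rmult_lt_0_compat; lra). lra.
Qed.

Lemma isometry_H3 p : H3 p -> H3 (isometry a b c d p).
Proof.
  intros Hp. unfold H3. rewrite isometry_eq. unfold cw; simpl.
  apply Rdiv_lt_0_compat; [exact Hp | now apply isometry_den_pos].
Qed.
End Mobius.

Lemma isometry_inverse (a b c d : C) p : (a * d - b * c)%C = 1%C -> H3 p ->
  isometry a b c d (isometry d (- b)%C (- c)%C a p) = p.
Proof.
  intros Hdet Hp. destruct p as [z w]. unfold H3, cw in Hp; simpl in Hp.
  assert (Hdet' : (d * a - - b * - c)%C = 1%C) by (rewrite <- Hdet; ring).
  set (q0 := isometry_den (- c)%C a z w).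
  assert (Hq0 : 0 < q0) by now apply (isometry_den_pos d (- b)%C (- c)%C a Hdet').
  assert (Hq0C : RtoC q0 <> 0%C) by (apply RtoC_nz; lra).
  rewrite (isometry_eq d). cbn [fst snd]. fold q0.
  set (z0 := (isometry_num d (- b) (- c) a z w / RtoC q0)%C). set (w0 := w / q0).
  assert (Cdet : (Cconj a * Cconj d - Cconj b * Cconj c)%C = 1%C).
  { rewrite <- !Cmult_conj, <- Cminus_conj, Hdet. apply injective_projections; simpl; ring. }
  assert (Eq0 : RtoC q0 = ((a - c * z) * (Cconj a - Cconj c * Cconj z) + c * Cconj c * RtoC (w ^ 2))%C).
  { unfold q0. rewrite isometry_den_C. rewrite Cplus_conj, Cmult_conj, Copp_conj. ring. }
  assert (E1 : (c * z0 + d)%C = ((Cconj a - Cconj c * Cconj z) / RtoC q0)%C).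
  { unfold z0, isometry_num. rewrite Cplus_conj, Cmult_conj, Copp_conj.
    transitivity (((c * ((d * z + - b) * (- Cconj c * Cconj z + Cconj a) + d * - Cconj c * RtoC (w ^ 2))) + d * RtoC q0) / RtoC q0)%C; [field; exact Hq0C|].
    rewrite Eq0 at 1. f_equal.
    transitivity ((Cconj a - Cconj c * Cconj z) * (a * d - b * c))%C; [ring|rewrite Hdet; ring]. }
  assert (E2 : (a * z0 + b)%C = (((Cconj a - Cconj c * Cconj z) * z - Cconj c * RtoC (w ^ 2)) / RtoC q0)%C).
  { unfold z0, isometry_num. rewrite Cplus_conj, Cmult_conj, Copp_conj.
    transitivity (((a * ((d * z + - b) * (- Cconj c * Cconj z + Cconj a) + d * - Cconj c * RtoC (w ^ 2))) + b * RtoC q0) / RtoC q0)%C; [field; exact Hq0C|].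
    rewrite Eq0 at 1. f_equal.
    transitivity (((Cconj a - Cconj c * Cconj z) * z - Cconj c * RtoC (w ^ 2)) * (a * d - b * c))%C; [ring|rewrite Hdet; ring]. }
  assert (Cq0 : Cconj (/ RtoC q0)%C = (/ RtoC q0)%C).
  { rewrite <- RtoC_Rinv. apply injective_projections; simpl; ring. }
  assert (Ew : RtoC (w0 ^ 2) = (RtoC (w ^ 2) * / RtoC q0 * / RtoC q0)%C).
  { rewrite <- RtoC_Rinv, <- !RtoC_mult. f_equal. unfold w0. field. lra. }
  assert (E1c : Cconj (c * z0 + d)%C = ((a - c * z) / RtoC q0)%C).
  { rewrite E1. unfold Cdiv. rewrite Cmult_conj, Cq0, Cminus_conj, Cmult_conj, !Cconj_conj. reflexivity. }
  assert (Ed : isometry_den c d z0 w0 = / q0).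
  { apply RtoC_inj. rewrite isometry_den_C, E1c, E1, Ew, RtoC_Rinv.
    transitivity (((a - c * z) * (Cconj a - Cconj c * Cconj z) + c * Cconj c * RtoC (w ^ 2)) / (RtoC q0 * RtoC q0))%C;
      [field; exact Hq0C|]. rewrite <- Eq0. field. exact Hq0C. }
  rewrite isometry_eq. cbn [fst snd]. rewrite Ed. f_equal.
  - unfold isometry_num. rewrite E1c, E2, Ew, RtoC_Rinv.
    transitivity (z * ((a - c * z) * (Cconj a - Cconj c * Cconj z) + c * Cconj c * RtoC (w ^ 2)) / RtoC q0)%C;
      [field; exact Hq0C|]. rewrite <- Eq0. field. exact Hq0C.
  - unfold w0. field. lra.
Qed.

Lemma Cmod_eq_0_iff (z : C) : Cmod z = 0 <-> z = 0%C.
Proof. split; [apply Cmod_eq_0 | intros ->; apply Cmod_0]. Qed.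

Lemma mobius_infinity a b c d a' b' c' d' :
  mobius a b c d None = mobius a' b' c' d' None -> (a * c')%C = (a' * c)%C.
Proof.
  unfold mobius. destruct (Req_EM_T (Cmod c) 0) as [E|N], (Req_EM_T (Cmod c') 0) as [E'|N'];
    rewrite Cmod_eq_0_iff in *; intros H; try discriminate.
  - rewrite E, E'. ring.
  - assert (K : (a / c)%C = (a' / c')%C) by exact (f_equal (fun o => match o with Some x => x | None => RtoC 0 end) H).
    replace (a * c')%C with (a / c * (c * c'))%C by (field; exact N).
    rewrite K. field. exact N'.
Qed.

Lemma mobius_zero a b c d a' b' c' d' :
  mobius a b c d (Some (RtoC 0)) = mobius a' b' c' d' (Some (RtoC 0)) -> (b * d')%C = (b' * d)%C.
Proof.
  unfold mobius.
  replace (c * 0 + d)%C with d by ring. replace (c' * 0 + d')%C with d' by ring.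
  replace (a * 0 + b)%C with b by ring. replace (a' * 0 + b')%C with b' by ring.
  destruct (Req_EM_T (Cmod d) 0) as [E|N], (Req_EM_T (Cmod d') 0) as [E'|N'];
    rewrite Cmod_eq_0_iff in *; intros H; try discriminate.
  - rewrite E, E'. ring.
  - assert (K : (b / d)%C = (b' / d')%C) by exact (f_equal (fun o => match o with Some x => x | None => RtoC 0 end) H).
    replace (b * d')%C with (b / d * (d * d'))%C by (field; exact N).
    rewrite K. field. exact N'.
Qed.

Definition spiral (m : C) (p : point) : point :=
  ((m * m * fst p)%C, Cmod m ^ 2 * snd p).

(** A diagonal matrix on the right acts as a spiral similarity around the vertical axis. *)
Lemma isometry_spiral a b c d m n p : (m * n)%C = 1%C ->
  isometry (m * a)%C (n * b)%C (m * c)%C (n * d)%C p = isometry a b c d (spiral m p).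
Proof.
  intros Hmn. destruct p as [z w].
  assert (Hm : m <> 0%C).
  { intros E. rewrite E in Hmn. apply (f_equal Re) in Hmn. simpl in Hmn. lra. }
  assert (Hm2 : 0 < Cmod m ^ 2) by (apply pow_lt, Cmod_gt_0; exact Hm).
  assert (Cmn : (Cconj m * Cconj n)%C = 1%C).
  { rewrite <- Cmult_conj, Hmn. apply injective_projections; simpl; ring. }
  rewrite !isometry_eq. unfold spiral. cbn [fst snd].
  assert (K : (c * (m * m * z) + d)%C = (m * (m * c * z + n * d))%C).
  { transitivity (m * m * c * z + (m * n) * d)%C; [rewrite Hmn; ring|ring]. }
  assert (K' : (a * (m * m * z) + b)%C = (m * (m * a * z + n * b))%C).
  { transitivity (m * m * a * z + (m * n) * b)%C; [rewrite Hmn; ring|ring]. }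
  assert (Ed : isometry_den c d (m * m * z)%C (Cmod m ^ 2 * w) = Cmod m ^ 2 * isometry_den (m * c)%C (n * d)%C z w).
  { unfold isometry_den. rewrite K, !Cmod_mult. ring. }
  assert (En : isometry_num a b c d (m * m * z)%C (Cmod m ^ 2 * w) =
     (RtoC (Cmod m ^ 2) * isometry_num (m * a) (n * b) (m * c) (n * d) z w)%C).
  { unfold isometry_num. rewrite K, K', Cmod2_conj, !Cmult_conj.
    replace (RtoC ((Cmod m ^ 2 * w) ^ 2)) with (m * Cconj m * (m * Cconj m) * RtoC (w ^ 2))%C.
    - ring.
    - rewrite <- Cmod2_conj, <- !RtoC_mult. f_equal. ring. }
  rewrite Ed, En, RtoC_mult.
  set (i := isometry_den (m * c)%C (n * d)%C z w).
  unfold Cdiv, Rdiv. rewrite <- RtoC_mult, <- !RtoC_Rinv, Rinv_mult, RtoC_mult. f_equal.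
  - assert (Kc : (RtoC (Cmod m ^ 2) * RtoC (/ Cmod m ^ 2))%C = 1%C).
    { rewrite <- RtoC_mult. f_equal. field. intros E. rewrite E in Hm2. simpl in Hm2. lra. }
    transitivity (isometry_num (m * a) (n * b) (m * c) (n * d) z w * RtoC (/ i) * (RtoC (Cmod m ^ 2) * RtoC (/ Cmod m ^ 2)))%C;
    [rewrite Kc; ring | ring].
  - assert (Kr : Cmod m ^ 2 * / Cmod m ^ 2 = 1) by (field; intros E; rewrite E in Hm2; simpl in Hm2; lra).
    transitivity (w * / i * (Cmod m ^ 2 * / Cmod m ^ 2)); [rewrite Kr; ring|ring].
Qed.

Lemma spiral_inverse m n p : (m * n)%C = 1%C -> spiral m (spiral n p) = p.
Proof.
  intros Hmn. destruct p as [z w]. unfold spiral; cbn [fst snd]. f_equal.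
  - transitivity ((m * n) * (m * n) * z)%C; [ring|rewrite Hmn; ring].
  - replace (Cmod m ^ 2 * (Cmod n ^ 2 * w)) with ((Cmod m * Cmod n) ^ 2 * w) by ring.
    rewrite <- Cmod_mult, Hmn, Cmod_1. ring.
Qed.

Lemma vscal_eq l p : vscal l p = ((RtoC l * fst p)%C, l * snd p).
Proof.
  destruct p as [[u v] w]. unfold vscal, cu, cv, cw; simpl. f_equal.
  apply injective_projections; simpl; ring.
Qed.

Lemma spiral_vscal m l p : spiral m (vscal l p) = vscal l (spiral m p).
Proof.
  rewrite !vscal_eq. unfold spiral; cbn [fst snd]. f_equal; ring.
Qed.

(** Two isometries that send 0 and infinity to the same points differ by a spiral similarity
    around the vertical axis, which commutes with the dilations.  So any of them can be used to
    compute the translation, and the same one for all times. *)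
Lemma translation_unique P Q t Phi a b c d p :
  is_translation P Q t Phi ->
  (a * d - b * c)%C = 1%C -> mobius a b c d (Some (RtoC 0)) = P -> mobius a b c d None = Q ->
  H3 p -> Phi (isometry a b c d p) = isometry a b c d (vscal (exp t) p).
Proof.
  intros (a' & b' & c' & d' & Hdet' & HP' & HQ' & HPhi) Hdet HP HQ Hp.
  rewrite <- HP in HP'. rewrite <- HQ in HQ'.
  apply mobius_zero in HP'. apply mobius_infinity in HQ'.
  set (m := (a' * d - c' * b)%C). set (n := (a * d' - c * b')%C).
  assert (Ea : a' = (m * a)%C).
  { unfold m. transitivity (a' * (a * d - b * c))%C; [rewrite Hdet; ring|].
    transitivity (a' * a * d - b * (a' * c))%C; [ring|rewrite HQ'; ring]. }
  assert (Ec : c' = (m * c)%C).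
  { unfold m. transitivity (c' * (a * d - b * c))%C; [rewrite Hdet; ring|].
    transitivity (d * (a * c') - b * c * c')%C; [ring|rewrite <- HQ'; ring]. }
  assert (Eb : b' = (n * b)%C).
  { unfold n. transitivity (b' * (a * d - b * c))%C; [rewrite Hdet; ring|].
    transitivity (a * (b' * d) - b' * b * c)%C; [ring|rewrite HP'; ring]. }
  assert (Ed : d' = (n * d)%C).
  { unfold n. transitivity (d' * (a * d - b * c))%C; [rewrite Hdet; ring|].
    transitivity (a * d * d' - c * (b * d'))%C; [ring|rewrite <- HP'; ring]. }
  assert (Hmn : (m * n)%C = 1%C).
  { rewrite <- Hdet'. rewrite Ea, Eb, Ec, Ed.
    transitivity (m * n * (a * d - b * c))%C; [rewrite Hdet; ring|ring]. }
  assert (Hnm : (n * m)%C = 1%C) by (rewrite Cmult_comm; exact Hmn).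
  clearbody m n. rewrite Ea, Eb, Ec, Ed in HPhi.
  assert (Hp' : H3 (spiral n p)).
  { unfold H3, spiral, cw; simpl. apply Rmult_lt_0_compat; [|exact Hp].
    assert (N : n <> 0%C).
    { intros E. rewrite E in Hnm. apply (f_equal Re) in Hnm. simpl in Hnm. lra. }
    apply Cmod_gt_0 in N. nra. }
  assert (K := HPhi _ Hp').
  rewrite !isometry_spiral, spiral_vscal, spiral_inverse in K by exact Hmn. exact K.
Qed.

Lemma quotient_derive (x2 x1 x0 q2 q1 q0 : R) : q2 + q1 + q0 <> 0 ->
  is_derive (fun t => (x2 * exp t ^ 2 + x1 * exp t + x0) / (q2 * exp t ^ 2 + q1 * exp t + q0)) 0
   (((2 * x2 + x1) * (q2 + q1 + q0) - (x2 + x1 + x0) * (2 * q2 + q1)) / (q2 + q1 + q0) ^ 2).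
Proof.
  intros H. auto_derive.
  - rewrite exp_0. intros E. apply H. lra.
  - rewrite exp_0. field. intros E. apply H. lra.
Qed.

(** Along the dilations, the numerators and the denominator of the isometry are polynomials of
    degree 2 in exp t.  The coefficients of the field are those of the push-forward of z d/dz under
    the Moebius map. *)
Lemma isometry_velocity (a b c d : C) p : (a * d - b * c)%C = 1%C -> H3 p ->
  let V := killing (- (c * d))%C (a * d + b * c)%C (- (a * b))%C (isometry a b c d p) in
  is_derive (fun t => cu (isometry a b c d (vscal (exp t) p))) 0 (cu V) /\
  is_derive (fun t => cv (isometry a b c d (vscal (exp t) p))) 0 (cv V) /\
  is_derive (fun t => cw (isometry a b c d (vscal (exp t) p))) 0 (cw V).
Proof.
  intros Hdet Hp. destruct p as [z w]. unfold H3, cw in Hp; simpl in Hp. cbv zeta.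
  set (n2 := (a * z * Cconj c * Cconj z + a * Cconj c * RtoC (w ^ 2))%C).
  set (n1 := (a * z * Cconj d + b * Cconj c * Cconj z)%C).
  set (n0 := (b * Cconj d)%C).
  set (q2 := Cmod (c * z)%C ^ 2 + Cmod c ^ 2 * w ^ 2).
  set (q1 := 2 * Re (c * z * Cconj d)%C).
  set (q0 := Cmod d ^ 2).
  assert (Q2 : RtoC q2 = (c * z * Cconj c * Cconj z + c * Cconj c * RtoC (w ^ 2))%C).
  { unfold q2. rewrite RtoC_plus, RtoC_mult, !Cmod2_conj, Cmult_conj. ring. }
  assert (Q1 : RtoC q1 = (c * z * Cconj d + Cconj c * Cconj z * d)%C).
  { unfold q1. destruct c, z, d. apply injective_projections; unfold Re, Im; simpl; ring. }
  assert (Q0 : RtoC q0 = (d * Cconj d)%C) by apply Cmod2_conj.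
  assert (Eden : forall e, isometry_den c d (RtoC e * z)%C (e * w) = q2 * e ^ 2 + q1 * e + q0).
  { intros e. apply RtoC_inj. rewrite isometry_den_C, !RtoC_plus, !RtoC_mult, Q2, Q1, Q0.
    rewrite Cplus_conj, !Cmult_conj.
    replace (Cconj (RtoC e)) with (RtoC e) by (apply injective_projections; simpl; ring).
    replace ((e * w) ^ 2) with (e ^ 2 * w ^ 2) by ring. rewrite RtoC_mult.
    replace (RtoC (e ^ 2)) with (RtoC e * RtoC e)%C by (rewrite <- RtoC_mult; f_equal; ring).
    ring. }
  assert (Enum : forall e, isometry_num a b c d (RtoC e * z)%C (e * w) =
     (n2 * RtoC (e ^ 2) + n1 * RtoC e + n0)%C).
  { intros e. unfold isometry_num, n2, n1, n0. rewrite Cplus_conj, !Cmult_conj.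
    replace (Cconj (RtoC e)) with (RtoC e) by (apply injective_projections; simpl; ring).
    replace ((e * w) ^ 2) with (e ^ 2 * w ^ 2) by ring. rewrite RtoC_mult.
    replace (RtoC (e ^ 2)) with (RtoC e * RtoC e)%C by (rewrite <- RtoC_mult; f_equal; ring).
    ring. }
  assert (Eq : isometry_den c d z w = q2 + q1 + q0).
  { rewrite <- (Cmult_1_l z), <- (Rmult_1_l w). rewrite Eden. ring. }
  assert (En : isometry_num a b c d z w = (n2 + n1 + n0)%C).
  { rewrite <- (Cmult_1_l z), <- (Rmult_1_l w). rewrite Enum. rewrite pow1. ring. }
  assert (Hq : 0 < q2 + q1 + q0) by (rewrite <- Eq; now apply (isometry_den_pos a b)).
  assert (HqC : RtoC (q2 + q1 + q0) <> 0%C) by (apply RtoC_nz; lra).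
  set (q := q2 + q1 + q0) in *.
  set (V := killing (- (c * d))%C (a * d + b * c)%C (- (a * b))%C (isometry a b c d (z, w))).
  assert (Cn1 : Cconj (RtoC (w ^ 2)) = RtoC (w ^ 2)) by (apply injective_projections; simpl; ring).
  assert (V1 : fst V = ((((2 * n2 + n1) * RtoC q - (n2 + n1 + n0) * RtoC (2 * q2 + q1)) / RtoC (q ^ 2))%C)).
  { unfold V, killing. rewrite isometry_eq. unfold cw; cbn [fst snd]. rewrite Eq, En.
    replace (RtoC ((w / q) ^ 2)) with (RtoC (w ^ 2) * / (RtoC q * RtoC q))%C.
    2:{ rewrite <- RtoC_mult, <- RtoC_Rinv, <- RtoC_mult. f_equal. field. lra. }
    replace (RtoC (q ^ 2)) with (RtoC q * RtoC q)%C by (rewrite <- RtoC_mult; f_equal; ring).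
    rewrite Copp_conj, Cmult_conj.
    transitivity ((- (c * d) * (n2 + n1 + n0) * (n2 + n1 + n0) + (a * d + b * c) * (n2 + n1 + n0) * RtoC q
       - a * b * RtoC q * RtoC q + Cconj c * Cconj d * RtoC (w ^ 2) * (a * d - b * c) * (a * d - b * c)) / (RtoC q * RtoC q))%C;
       [rewrite Hdet; field; exact HqC|].
    transitivity ((((2 * n2 + n1) * RtoC q - (n2 + n1 + n0) * RtoC (2 * q2 + q1)) * (a * d - b * c)) / (RtoC q * RtoC q))%C;
       [|rewrite Hdet; f_equal; ring].
    f_equal. unfold q. rewrite !RtoC_plus, RtoC_mult, Q2, Q1, Q0. unfold n2, n1, n0. ring. }
  assert (V2 : snd V = w * (q0 - q2) / q ^ 2).
  { unfold V, killing. rewrite isometry_eq. unfold cw; cbn [fst snd]. rewrite Eq, En.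
    assert (K : (RtoC 2 * - (c * d) * ((n2 + n1 + n0) / RtoC q) + (a * d + b * c))%C =
      (((Cconj c * Cconj z + Cconj d) * (d - c * z) - c * Cconj c * RtoC (w ^ 2)) / RtoC q)%C).
    { transitivity ((RtoC 2 * - (c * d) * (n2 + n1 + n0) + (a * d + b * c) * RtoC q) / RtoC q)%C; [field; exact HqC|].
      transitivity (((Cconj c * Cconj z + Cconj d) * (d - c * z) - c * Cconj c * RtoC (w ^ 2)) * (a * d - b * c) / RtoC q)%C;
        [|rewrite Hdet; f_equal; ring].
      f_equal. unfold q. rewrite !RtoC_plus, Q2, Q1, Q0. unfold n2, n1, n0. ring. }
    rewrite K.
    assert (K2 : Re (((Cconj c * Cconj z + Cconj d) * (d - c * z) - c * Cconj c * RtoC (w ^ 2)) / RtoC q)%C = (q0 - q2) / q).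
    { unfold Cdiv. rewrite <- RtoC_Rinv.
      set (X := ((Cconj c * Cconj z + Cconj d) * (d - c * z) - c * Cconj c * RtoC (w ^ 2))%C).
      assert (KX : Re X = q0 - q2).
      { unfold X, q0, q2. rewrite !Cmod_sqr. destruct c, z, d. unfold Re, Im; simpl. ring. }
      unfold Rdiv. rewrite <- KX. unfold Re; simpl. ring. }
    rewrite K2. field. lra. }
  assert (Eiso : forall t, isometry a b c d (vscal (exp t) (z, w)) =
    (((n2 * RtoC (exp t ^ 2) + n1 * RtoC (exp t) + n0) / RtoC (q2 * exp t ^ 2 + q1 * exp t + q0))%C,
      exp t * w / (q2 * exp t ^ 2 + q1 * exp t + q0))).
  { intros t. rewrite vscal_eq. cbn [fst snd]. rewrite isometry_eq. cbn [fst snd].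
    rewrite Eden, Enum. reflexivity. }
  split; [|split].
  - apply is_derive_ext with (fun t => (Re n2 * exp t ^ 2 + Re n1 * exp t + Re n0) / (q2 * exp t ^ 2 + q1 * exp t + q0)).
    { intros t. rewrite Eiso. unfold cu. cbn [fst]. unfold Cdiv. rewrite <- RtoC_Rinv.
      unfold Re, Rdiv; simpl. ring. }
    evar_last; [apply quotient_derive; fold q; lra|].
    fold q. unfold cu. rewrite V1. unfold Cdiv. rewrite <- RtoC_Rinv.
    unfold Re, Rdiv; simpl. ring.
  - apply is_derive_ext with (fun t => (Im n2 * exp t ^ 2 + Im n1 * exp t + Im n0) / (q2 * exp t ^ 2 + q1 * exp t + q0)).
    { intros t. rewrite Eiso. unfold cv. cbn [fst]. unfold Cdiv. rewrite <- RtoC_Rinv.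
      unfold Im, Rdiv; simpl. ring. }
    evar_last; [apply quotient_derive; fold q; lra|].
    fold q. unfold cv. rewrite V1. unfold Cdiv. rewrite <- RtoC_Rinv.
    unfold Im, Rdiv; simpl. ring.
  - apply is_derive_ext with (fun t => (0 * exp t ^ 2 + w * exp t + 0) / (q2 * exp t ^ 2 + q1 * exp t + q0)).
    { intros t. rewrite Eiso. unfold cw. cbn [snd]. unfold Rdiv; simpl. ring. }
    evar_last; [apply quotient_derive; fold q; lra|].
    fold q. unfold cw. rewrite V2. unfold Rdiv. f_equal. unfold q. ring.
Qed.

(** It is enough to differentiate the translations at time 0.  In terms of a matrix (a b; c d) that
    takes (0, infinity) to (P, Q) = (b / d, a / c), the coefficients are - c d, a d + b c, - a b;
    these formulas cover the cases where P or Q is infinite. *)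
Lemma killing_formula P Q Y : translation_killing_field P Q Y ->
  exists a b c : C, (forall p, H3 p -> Y p = killing a b c p) /\
    forall f0 f1 f2 : C, flux_fraction f0 f1 f2 P Q = (c * f2 - b * f1 + a * f0)%C.
Proof.
  intros (Phi & HT & HD).
  destruct (HT 0) as (a & b & c & d & Hdet & HP & HQ & _).
  exists (- (c * d))%C, (a * d + b * c)%C, (- (a * b))%C. split.
  - intros p Hp.
    set (p0 := isometry d (- b)%C (- c)%C a p).
    assert (Hp0 : H3 p0).
    { apply isometry_H3; [|exact Hp]. rewrite <- Hdet. ring. }
    assert (E : isometry a b c d p0 = p) by now apply isometry_inverse.
    assert (EPhi : forall t, Phi t p = isometry a b c d (vscal (exp t) p0)).
    { intros t. rewrite <- E. now apply (translation_unique P Q). }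
    assert (E0 : Phi 0 p = p).
    { rewrite EPhi, exp_0, vscal_eq. transitivity (isometry a b c d p0); [f_equal | exact E].
      clearbody p0. destruct p0 as [z w]. simpl fst; simpl snd. f_equal; ring. }
    destruct (HD 0 p Hp) as (D1 & D2 & D3). rewrite E0 in D1, D2, D3.
    destruct (isometry_velocity a b c d p0 Hdet Hp0) as (V1 & V2 & V3). rewrite E in V1, V2, V3.
    assert (Ex : forall (f : point -> R) l l',
      is_derive (fun t => f (Phi t p)) 0 l ->
      is_derive (fun t => f (isometry a b c d (vscal (exp t) p0))) 0 l' -> l = l').
    { intros f l l' H1 H2. rewrite <- (is_derive_unique _ _ _ H1), <- (is_derive_unique _ _ _ H2).
      apply Derive_ext. intros t. now rewrite EPhi. }
    assert (K1 := Ex cu _ _ D1 V1). assert (K2 := Ex cv _ _ D2 V2). assert (K3 := Ex cw _ _ D3 V3).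
    set (W := killing _ _ _ p) in *. clearbody W.
    destruct (Y p) as [[y1 y2] y3], W as [[w1 w2] w3].
    unfold cu, cv, cw in K1, K2, K3; simpl in K1, K2, K3. now rewrite K1, K2, K3.
  - intros f0 f1 f2. revert HP HQ. unfold mobius.
    replace (c * 0 + d)%C with d by ring. replace (a * 0 + b)%C with b by ring.
    destruct (Req_EM_T (Cmod d) 0) as [E|N], (Req_EM_T (Cmod c) 0) as [E'|N'];
      rewrite Cmod_eq_0_iff in *; intros <- <-; simpl.
    + rewrite E, E' in Hdet. exfalso. apply (f_equal Re) in Hdet. simpl in Hdet. lra.
    + rewrite E in *. assert (K : (b * c)%C = (- (1))%C) by (rewrite <- Hdet; ring).
      transitivity (a / c * - - f2 * - - (1) + f1)%C; [ring|].
      transitivity (- (a / c * f2 * (- (1))) - (- (1)) * f1)%C; [ring|].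
      rewrite <- K. field. exact N'.
    + rewrite E' in *. assert (K : (a * d)%C = 1%C) by (rewrite <- Hdet; ring).
      transitivity (- (b / d * f2 * 1) - 1 * f1)%C; [ring|].
      rewrite <- K. field. exact N.
    + assert (K : (b / d - a / c)%C = (- / (c * d))%C).
      { transitivity (- (a * d - b * c) / (c * d))%C; [field; auto|rewrite Hdet; field; auto]. }
      rewrite K. field. auto.
Qed.

(** * The flux through a spanning disk *)

Lemma velocity_comp (S : C -> Prop) (f : C -> point) (c : R -> C) t :
  open S -> C2_map S f -> C1_path c -> S (c t) ->
  velocity (fun t => f (c t)) t =
  vadd (vscal (Re (path_velocity c t)) (Dx f (c t))) (vscal (Im (path_velocity c t)) (Dy f (c t))).
Proof.
  intros HS (H1 & H2 & H3) Hc Ht.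
  destruct (C1_path_vel c t Hc) as [V1 V2].
  assert (K : forall g, C1_on S g ->
    Derive (fun t => g (c t)) t = Re (path_velocity c t) * dx g (c t) + Im (path_velocity c t) * dy g (c t)).
  { intros g Hg. etransitivity; [exact (is_derive_unique _ _ _ (C1_curve S g c t _ _ HS Hg Ht V1 V2))|]. simpl. ring. }
  unfold velocity.
  rewrite (K (fun z => cu (f z)) (proj1 H1)), (K (fun z => cv (f z)) (proj1 H2)),
    (K (fun z => cw (f z)) (proj1 H3)). reflexivity.
Qed.

Lemma lagrange a b : edot (cross a b) (cross a b) = edot a a * edot b b - edot a b ^ 2.
Proof. unfold edot, cross, cu, cv, cw; simpl. ring. Qed.

(** The vector n is a multiple of the cross product; the factor is eliminated instead of divided out. *)
Lemma normal_parallel a b n : edot n a = 0 -> edot n b = 0 ->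
  forall y, edot (cross a b) (cross a b) * edot n y = edot (cross a b) n * edot (cross a b) y.
Proof.
  intros Ha Hb [[y1 y2] y3]. destruct a as [[a1 a2] a3], b as [[b1 b2] b3], n as [[n1 n2] n3].
  unfold edot, cross, cu, cv, cw in *; simpl in *.
  set (c1 := a2 * b3 - a3 * b2). set (c2 := a3 * b1 - a1 * b3). set (c3 := a1 * b2 - a2 * b1).
  assert (X1 : n2 * c3 - n3 * c2 = 0).
  { transitivity (a1 * (n1 * b1 + n2 * b2 + n3 * b3) - b1 * (n1 * a1 + n2 * a2 + n3 * a3)); [unfold c2, c3; ring|rewrite Ha, Hb; ring]. }
  assert (X2 : n3 * c1 - n1 * c3 = 0).
  { transitivity (a2 * (n1 * b1 + n2 * b2 + n3 * b3) - b2 * (n1 * a1 + n2 * a2 + n3 * a3)); [unfold c1, c3; ring|rewrite Ha, Hb; ring]. }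
  assert (X3 : n1 * c2 - n2 * c1 = 0).
  { transitivity (a3 * (n1 * b1 + n2 * b2 + n3 * b3) - b3 * (n1 * a1 + n2 * a2 + n3 * a3)); [unfold c1, c2; ring|rewrite Ha, Hb; ring]. }
  clearbody c1 c2 c3.
  transitivity ((c1 * n1 + c2 * n2 + c3 * n3) * (c1 * y1 + c2 * y2 + c3 * y3)
    + (c2 * (n1 * c2 - n2 * c1) - c3 * (n3 * c1 - n1 * c3)) * y1
    + (c3 * (n2 * c3 - n3 * c2) - c1 * (n1 * c2 - n2 * c1)) * y2
    + (c1 * (n3 * c1 - n1 * c3) - c2 * (n2 * c3 - n3 * c2)) * y3); [ring|rewrite X1, X2, X3; ring].
Qed.

Lemma hdot_zero p a b : 0 < cw p -> hdot p a b = 0 -> edot a b = 0.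
Proof.
  intros Hp H. unfold hdot in H.
  replace (edot a b) with (edot a b / cw p ^ 2 * cw p ^ 2) by (field; lra). rewrite H. ring.
Qed.

Lemma hnorm_one p a : 0 < cw p -> hnorm p a = 1 -> edot a a = cw p ^ 2.
Proof.
  intros Hp H. unfold hnorm in H.
  assert (K : hdot p a a = 1).
  { assert (P : 0 <= hdot p a a).
    { unfold hdot. apply Rmult_le_pos; [unfold edot; nra|left; apply Rinv_0_lt_compat; apply pow_lt; lra]. }
    rewrite <- (sqrt_sqrt _ P), H. ring. }
  unfold hdot in K.
  replace (edot a a) with (edot a a / cw p ^ 2 * cw p ^ 2) by (field; lra). rewrite K. ring.
Qed.

Lemma edot_sym a b : edot a b = edot b a.
Proof. unfold edot. ring. Qed.

Lemma edot_self_pos a : a <> ((0, 0), 0) -> 0 < edot a a.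
Proof.
  intros H. destruct a as [[x y] t]. unfold edot, cu, cv, cw; simpl.
  destruct (Req_dec x 0) as [->|]; [destruct (Req_dec y 0) as [->|]; [destruct (Req_dec t 0) as [->|]|]|];
    try nra. now elim H.
Qed.

Lemma sqrt_unique_pos (x y : R) : 0 <= y -> y ^ 2 = x -> sqrt x = y.
Proof. intros Hy <-. now apply sqrt_pow2. Qed.

(** The unit normal is the cross product of the partial derivatives, rescaled; the scaling factor
    cancels the area density up to powers of w.  So the integrand is the pull-back of the contraction
    of the volume form with y. *)
Lemma normal_flux_density (k : C -> point) (z : C) (n y : point) :
  0 < cw (k z) -> immersive k z -> hnorm (k z) n = 1 ->
  hdot (k z) n (Dx k z) = 0 -> hdot (k z) n (Dy k z) = 0 ->
  0 < det3 (Dx k z) (Dy k z) n ->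
  hdot (k z) n y * area_density k z = det3 (Dx k z) (Dy k z) y / cw (k z) ^ 3.
Proof.
  intros Hw Him Hn Hx Hy Hs.
  apply hnorm_one in Hn; [|exact Hw]. apply hdot_zero in Hx; [|exact Hw]. apply hdot_zero in Hy; [|exact Hw].
  apply edot_self_pos in Him.
  assert (Par := normal_parallel _ _ _ Hx Hy).
  unfold det3 in *. unfold area_density, hdot.
  assert (L := lagrange (Dx k z) (Dy k z)).
  set (c := cross (Dx k z) (Dy k z)) in *. set (w := cw (k z)) in *.
  assert (P1 := Par y). assert (P2 := Par n). rewrite Hn in P2.
  set (N := edot c c) in *. set (s := edot c n) in *.
  assert (A : sqrt (edot (Dx k z) (Dx k z) / w ^ 2 * (edot (Dy k z) (Dy k z) / w ^ 2) - (edot (Dx k z) (Dy k z) / w ^ 2) ^ 2) = s / w ^ 3).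
  { apply sqrt_unique_pos.
    - apply Rmult_le_pos; [lra|left; apply Rinv_0_lt_compat, pow_lt; lra].
    - replace (edot (Dx k z) (Dx k z) / w ^ 2 * (edot (Dy k z) (Dy k z) / w ^ 2) - (edot (Dx k z) (Dy k z) / w ^ 2) ^ 2) with (N / w ^ 4)
        by (rewrite L; field; lra).
      replace N with (s * s / w ^ 2) by (rewrite <- P2; field; lra). field. lra. }
  rewrite A.
  assert (E : edot n y = s * edot c y / N) by (rewrite <- P1; field; lra).
  rewrite E. transitivity (s * s * edot c y / (N * w ^ 5)); [field; split; lra|].
  rewrite <- P2. field. split; lra.
Qed.

Lemma continuous_det3 (a b n : R -> point) t :
  (forall f : point -> R, f = cu \/ f = cv \/ f = cw ->
     continuous (fun t => f (a t)) t /\ continuous (fun t => f (b t)) t /\ continuous (fun t => f (n t)) t) ->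
  continuous (fun t => det3 (a t) (b t) (n t)) t.
Proof.
  intros H.
  destruct (H cu ltac:(auto)) as (A1 & B1 & N1).
  destruct (H cv ltac:(auto)) as (A2 & B2 & N2).
  destruct (H cw ltac:(auto)) as (A3 & B3 & N3).
  change (continuous (fun t => (cv (a t) * cw (b t) - cw (a t) * cv (b t)) * cu (n t) +
    (cw (a t) * cu (b t) - cu (a t) * cw (b t)) * cv (n t) +
    (cu (a t) * cv (b t) - cv (a t) * cu (b t)) * cw (n t)) t). cont.
Qed.

Lemma det3_comb a b n s t u v :
  det3 (vadd (vscal s a) (vscal t b)) (vadd (vscal u a) (vscal v b)) n = (s * v - t * u) * det3 a b n.
Proof.
  unfold det3, cross, edot, vadd, vscal, cu, cv, cw; simpl. ring.
Qed.

Lemma det3_scal a b n s : det3 a b (vscal s n) = s * det3 a b n.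
Proof. unfold det3, edot, vscal, cu, cv, cw; simpl. ring. Qed.

Section Disk.
Variables (G : R -> point) (k nu : C -> point).
Hypotheses (Hk : spanning_disk G k) (Hnu : disk_normal G k nu).

Lemma disk_circle t : (cos (2 * PI * t), sin (2 * PI * t)) = circle 1 t.
Proof. unfold circle. now rewrite !Rmult_1_l. Qed.

Lemma disk_velocity t :
  velocity G t = vadd (vscal (- (2 * PI) * sin (2 * PI * t)) (Dx k (circle 1 t)))
                      (vscal (2 * PI * cos (2 * PI * t)) (Dy k (circle 1 t))).
Proof.
  destruct Hk as ((rho & Hrho & HC) & _ & HG).
  assert (EG : G = fun t => k (circle 1 t)).
  { apply functional_extensionality. intros s. rewrite <- HG, disk_circle. reflexivity. }
  destruct (C1_circle 1) as [H1 H2].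
  rewrite EG, (velocity_comp (fun z => Cmod z < rho) k (circle 1) t (open_disk rho) HC H1).
  - rewrite H2. simpl. f_equal; f_equal; ring.
  - rewrite Cmod_circle; lra.
Qed.

(** On the boundary the normal is on the positive side by assumption.  It cannot change sides along a
    radius, where the determinant is continuous and does not vanish. *)
Lemma disk_orientation z : Cmod z <= 1 -> 0 < det3 (Dx k z) (Dy k z) (nu z).
Proof.
  intros Hz.
  destruct Hk as ((rho & Hrho & HC) & Him & HG). destruct Hnu as (Hcont & Hnorm & Hor).
  assert (Hpol : exists r t, 0 <= r <= 1 /\ z = polar r (2 * PI * t)).
  { destruct (excluded_middle_informative (z = 0%C)) as [->|N].
    - exists 0, 0. split; [lra|]. unfold polar. rewrite !Rmult_0_l. reflexivity.
    - destruct (cexp_surj z N) as [a <-]. rewrite Cmod_cexp in Hz.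
      exists (exp (Re a)), (Im a / (2 * PI)). assert (P := PI_RGT_0). split.
      + split; [left; apply exp_pos | exact Hz].
      + unfold polar, cexp. replace (2 * PI * (Im a / (2 * PI))) with (Im a) by (field; lra). reflexivity. }
  destruct Hpol as (r & t & Hr & ->).
  (* The radius through z, constant outside of [0, 1]. *)
  set (ga := fun s => polar (clamp 1 s) (2 * PI * t)).
  assert (Hga : forall s, Cmod (ga s) <= 1).
  { intros s. unfold ga. rewrite Cmod_polar. assert (K := clamp_range 1 s ltac:(lra)).
    rewrite Rabs_pos_eq; lra. }
  assert (Cga : forall s, continuous ga s).
  { intros s. unfold ga, polar. cont. }
  set (phi := fun s => det3 (Dx k (ga s)) (Dy k (ga s)) (nu (ga s))).
  assert (HCo := C2_fst_Dx _ _ HC). assert (HCo' := C2_fst_Dy _ _ HC).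
  assert (HCw := C2_cw_Dx _ _ HC). assert (HCw' := C2_cw_Dy _ _ HC).
  assert (Cphi : forall s, continuous phi s).
  { intros s. apply continuous_det3. intros f Hf.
    assert (Hsr : Cmod (ga s) < rho) by (specialize (Hga s); lra).
    split; [|split].
    - apply (continuous_comp ga (fun z => f (Dx k z))); [apply Cga|].
      destruct Hf as [-> | [-> | ->]]; (eapply C1_continuous; [apply (open_disk rho)| |exact Hsr]);
        [apply HCo | apply HCo | apply HCw].
    - apply (continuous_comp ga (fun z => f (Dy k z))); [apply Cga|].
      destruct Hf as [-> | [-> | ->]]; (eapply C1_continuous; [apply (open_disk rho)| |exact Hsr]);
        [apply HCo' | apply HCo' | apply HCw'].
    - assert (Cnu : continuous (fun s => nu (ga s)) s).
      { apply (filterlim_comp _ _ _ ga nu (locally s) (within (fun z => Cmod z <= 1) (locally (ga s))) (locally (nu (ga s)))).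
        - intros P HP. unfold within in HP. apply (Cga s) in HP.
          unfold filtermap in *. apply filter_imp with (2 := HP). intros u Hu. apply Hu, Hga.
        - apply Hcont. apply Hga. }
      destruct Hf as [-> | [-> | ->]].
      + apply (continuous_comp (fun s => fst (nu (ga s))) Re); [|apply continuous_Re].
        apply (continuous_comp (fun s => nu (ga s)) fst); [exact Cnu|].
        destruct (nu (ga s)). apply continuous_fst.
      + apply (continuous_comp (fun s => fst (nu (ga s))) Im); [|apply continuous_Im].
        apply (continuous_comp (fun s => nu (ga s)) fst); [exact Cnu|].
        destruct (nu (ga s)). apply continuous_fst.
      + apply (continuous_comp (fun s => nu (ga s)) snd); [exact Cnu|].
        destruct (nu (ga s)). apply continuous_snd. }
  assert (Nz : forall s, phi s <> 0).
  { intros s E. specialize (Hga s). destruct (Him _ Hga) as [Hw Him']. destruct (Hnorm _ Hga) as (N1 & N2 & N3).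
    unfold H3 in Hw. apply hnorm_one in N1; [|exact Hw].
    apply hdot_zero in N2; [|exact Hw]. apply hdot_zero in N3; [|exact Hw].
    assert (P := normal_parallel _ _ _ N2 N3 (nu (ga s))).
    unfold phi, det3 in E. rewrite E, N1 in P. apply edot_self_pos in Him'.
    assert (0 < cw (k (ga s)) ^ 2) by (apply pow_lt; exact Hw). nra. }
  assert (P1 : 0 < phi 1).
  { specialize (Hor t). cbv zeta in Hor. rewrite disk_circle, disk_velocity in Hor.
    assert (E1 : ga 1 = circle 1 t).
    { unfold ga, polar, circle. rewrite clamp_high by lra. reflexivity. }
    rewrite det3_comb in Hor. unfold phi. rewrite E1.
    replace (Re (circle 1 t)) with (cos (2 * PI * t)) in Hor by (unfold circle; simpl; ring).
    replace (Im (circle 1 t)) with (sin (2 * PI * t)) in Hor by (unfold circle; simpl; ring).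
    replace (cos (2 * PI * t) * (2 * PI * cos (2 * PI * t)) - sin (2 * PI * t) * (- (2 * PI) * sin (2 * PI * t)))
      with (2 * PI * (sin (2 * PI * t) * sin (2 * PI * t) + cos (2 * PI * t) * cos (2 * PI * t))) in Hor by ring.
    assert (K := sin2_cos2 (2 * PI * t)). unfold Rsqr in K. rewrite K in Hor.
    assert (P := PI_RGT_0). nra. }
  assert (Egr : ga r = polar r (2 * PI * t)).
  { unfold ga. f_equal. unfold clamp. rewrite Rmin_right, Rmax_right; lra. }
  rewrite <- Egr. change (0 < phi r).
  destruct (Rlt_le_dec 0 (phi r)) as [|Hle]; [assumption|exfalso].
  destruct (IVT_gen phi r 1 0) as (s & _ & Hs).
  - intros s. apply continuity_pt_filterlim. apply Cphi.
  - rewrite Rmin_left, Rmax_right by lra. lra.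
  - now apply (Nz s).
Qed.

(** The height of the disk has a positive minimum on the compact unit circle, and uniformly
    continuous; Green's formula needs the form on a neighbourhood of the closed disk. *)
Lemma disk_neighbourhood : exists rho, 1 < rho /\ C2_map (fun z => Cmod z < rho) k /\
  forall z, Cmod z < rho -> 0 < cw (k z).
Proof.
  destruct Hk as ((rho & Hrho & HC) & Him & _).
  assert (PP := PI_RGT_0).
  assert (Cw : forall r th, - rho < r < rho -> continuity_2d_pt (fun r th => cw (k (polar r th))) r th).
  { intros r th Hr. apply (continuous_polar (fun z => cw (k z))).
    apply C1_continuous with (fun z => Cmod z < rho); [apply open_disk|apply HC|].
    rewrite Cmod_polar. now apply Rabs_def1. }
  destruct (continuity_ab_min (fun th => cw (k (polar 1 th))) 0 (2 * PI)) as (m & Hm & _); [lra| |].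
  { intros th _. apply continuity_pt_filterlim.
    apply (cont2_snd (fun r th => cw (k (polar r th))) 1 th). apply Cw. lra. }
  assert (Hmp : 0 < cw (k (polar 1 m))).
  { apply Him. rewrite Cmod_polar, Rabs_pos_eq; lra. }
  (* Close to the circle, the height differs from its value on the circle by less than the minimum. *)
  destruct (uniform_continuity_2d_1d' (fun r th => cw (k (polar r th))) 0 (2 * PI) 1
     ltac:(intros; apply Cw; lra) (mkposreal _ Hmp)) as [d Hd].
  assert (Hd1 : 0 < Rmin d (rho - 1)) by (destruct d; apply Rmin_glb_lt; simpl; lra).
  assert (A := Rmin_l d (rho - 1)). assert (B := Rmin_r d (rho - 1)).
  exists (1 + Rmin d (rho - 1)). split; [lra|]. split.
  { assert (Sub : forall g, C1_on (fun z => Cmod z < rho) g -> C1_on (fun z => Cmod z < 1 + Rmin d (rho - 1)) g).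
    { intros g Hg z Hz. apply Hg. lra. }
    destruct HC as ((A1 & A2 & A3) & (B1 & B2 & B3) & (E1 & E2 & E3)).
    split; [split; [|split]|split; [split; [|split]|split; [|split]]]; now apply Sub. }
  intros z Hz.
  destruct (Rle_lt_dec (Cmod z) 1) as [Hz1|Hz1]; [now apply Him|].
  assert (N : nonzeroC z).
  { intros E. rewrite E, Cmod_0 in Hz1. lra. }
  destruct (cexp_surj z N) as [a Ha].
  set (r := exp (Re a)).
  assert (Hr : Cmod z = r) by (rewrite <- Ha; apply Cmod_cexp).
  (* Uniform continuity is available for angles between 0 and 2 pi. *)
  set (s := Im a / (2 * PI)). set (th := 2 * PI * (s + IZR (- Int_part s))).
  assert (Hth : 0 <= th <= 2 * PI).
  { unfold th. rewrite opp_IZR. destruct (base_Int_part s). split.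
    - apply Rmult_le_pos; lra.
    - rewrite <- (Rmult_1_r (2 * PI)) at 2. apply Rmult_le_compat_l; lra. }
  assert (Ez : z = polar r th).
  { rewrite <- Ha. unfold cexp, polar. fold r.
    assert (P := periodic_Z (circle r) ltac:(intros t; unfold circle;
      replace (2 * PI * (t + 1)) with (2 * PI * t + 2 * INR 1 * PI) by (simpl; ring);
      rewrite cos_period, sin_period; reflexivity) (- Int_part s) s).
    unfold circle in P. fold th in P. rewrite P. unfold s.
    replace (2 * PI * (Im a / (2 * PI))) with (Im a) by (field; lra). reflexivity. }
  rewrite Ez.
  assert (K := Hd th 1 th r Hth ltac:(destruct d; simpl; lra) Hth ltac:(lra)
    ltac:(rewrite Rminus_diag, Rabs_R0; apply cond_pos)).
  simpl in K. apply Rabs_def2 in K. specialize (Hm th Hth). lra.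
Qed.

(** The integrand is the curl of the potential, by [potential_curl] and [normal_flux_density]. *)
Lemma disk_flux (a b c : C) (Y : point -> point) :
  (forall p, H3 p -> Y p = killing a b c p) ->
  disk_integral k (fun z => hdot (k z) (nu z) (Y (k z))) =
  RInt (fun t => / 2 * Im (killing_form a b c (G t) (velocity G t))) 0 1.
Proof.
  intros HY.
  assert (Hk' := Hk). destruct Hk' as (_ & Him & HG).
  destruct Hnu as (_ & Hnorm & _).
  assert (PP := PI_RGT_0).
  destruct disk_neighbourhood as (rho & Hrho & HC & Hpos).
  set (D := fun z => Cmod z < rho) in *.
  assert (HD : open D) by apply open_disk.
  destruct (potential_C1 D HD k HC Hpos a b c) as [HPx HPy].
  assert (Gr := green_disk rho _ _ Hrho HPx HPy).
  unfold disk_integral.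
  transitivity (RInt (fun r => RInt (fun th =>
      (dx (fun z => / 2 * Im (killing_form a b c (k z) (Dy k z))) (polar r th) -
       dy (fun z => / 2 * Im (killing_form a b c (k z) (Dx k z))) (polar r th)) * r) 0 (2 * PI)) 0 1).
  { apply RInt_ext. intros r Hr. rewrite Rmin_left, Rmax_right in Hr by lra.
    apply RInt_ext. intros th _. cbv zeta.
    change (r * cos th, r * sin th) with (polar r th).
    assert (Hz : Cmod (polar r th) <= 1) by (rewrite Cmod_polar, Rabs_pos_eq; lra).
    destruct (Him _ Hz) as [Hw Hi]. destruct (Hnorm _ Hz) as (N1 & N2 & N3).
    rewrite (potential_curl D HD k HC Hpos a b c) by (unfold D; lra).
    rewrite (normal_flux_density k (polar r th) (nu (polar r th)) (Y (k (polar r th)))); auto.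
    - rewrite HY by exact Hw. reflexivity.
    - now apply disk_orientation. }
  rewrite Gr.
  assert (HPc : forall t, continuous (fun th => - (/ 2 * Im (killing_form a b c (k (polar 1 th)) (Dx k (polar 1 th)))) * sin th +
      (/ 2 * Im (killing_form a b c (k (polar 1 th)) (Dy k (polar 1 th)))) * cos th) t).
  { intros th.
    assert (Hz : D (polar 1 th)) by (unfold D; rewrite Cmod_polar, Rabs_pos_eq; lra).
    assert (Cpol : continuous (fun th => polar 1 th) th).
    { unfold polar. cont. }
    assert (C1 := C1_continuous D _ _ HD HPx Hz). assert (C2 := C1_continuous D _ _ HD HPy Hz).
    assert (C1' := continuous_comp _ _ _ Cpol C1). assert (C2' := continuous_comp _ _ _ Cpol C2).
    cbv beta in C1', C2'. cont. }
  set (F := fun th => - (/ 2 * Im (killing_form a b c (k (polar 1 th)) (Dx k (polar 1 th)))) * sin th +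
      (/ 2 * Im (killing_form a b c (k (polar 1 th)) (Dy k (polar 1 th)))) * cos th) in *.
  assert (K := RInt_comp_lin (V := R_CompleteNormedModule) F (2 * PI) 0 0 1).
  rewrite Rmult_0_r, Rmult_1_r, !Rplus_0_r in K.
  rewrite <- K by (apply (ex_RInt_continuous (V := R_CompleteNormedModule)); intros; apply HPc).
  apply RInt_ext. intros t _.
  rewrite disk_velocity, killing_form_add.
  assert (EG : G t = k (circle 1 t)) by (rewrite <- HG, disk_circle; reflexivity).
  rewrite EG. rewrite Rplus_0_r. unfold F. change (polar 1 (2 * PI * t)) with (circle 1 t).
  unfold scal; simpl; unfold mult; simpl. unfold Im; simpl. ring.
Qed.
End Disk.

(** * The flux as a loop integral *)

Lemma edot_comb s a t b y : edot (vadd (vscal s a) (vscal t b)) y = s * edot a y + t * edot b y.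
Proof. unfold edot, vadd, vscal, cu, cv, cw; simpl. ring. Qed.

Lemma edot_comb_r s a t b y : edot y (vadd (vscal s a) (vscal t b)) = s * edot y a + t * edot y b.
Proof. unfold edot, vadd, vscal, cu, cv, cw; simpl. ring. Qed.

(** A and B being orthogonal and of the same length, a vector orthogonal to g1 A + g2 B is a multiple
    of g2 A - g1 B; the length is given, and the two orientation conditions fix the sign.  In the
    parameter plane the conormal is thus on the right of the curve. *)
Lemma conormal_rotation p A B H (n1 n2 g1 g2 : R) :
  let e := vadd (vscal n1 A) (vscal n2 B) in
  let v := vadd (vscal g1 A) (vscal g2 B) in
  0 < cw p -> hdot p A A = hdot p B B -> hdot p A B = 0 ->
  hnorm p e = 1 -> hdot p e v = 0 -> 0 < det3 A B H -> 0 < det3 v e (vscal (- 1) H) ->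
  n1 * g1 + n2 * g2 = 0 /\ g1 * n2 - g2 * n1 < 0 /\
  forall V, hdot p e V * hnorm p v = g2 * hdot p A V - g1 * hdot p B V.
Proof.
  intros e v Hw HE HF He Hv HH Ho.
  apply hnorm_one in He; [|exact Hw]. apply hdot_zero in Hv; [|exact Hw]. apply hdot_zero in HF; [|exact Hw].
  unfold e, v in *. rewrite det3_scal, det3_comb in Ho.
  assert (HE' : edot A A = edot B B).
  { unfold hdot in HE. replace (edot A A) with (edot A A / cw p ^ 2 * cw p ^ 2) by (field; lra).
    rewrite HE. field. lra. }
  rewrite !edot_comb, !edot_comb_r, (edot_sym B A), HF, <- HE' in He, Hv.
  set (E := edot A A) in *. set (w := cw p) in *.
  assert (Hw2 : 0 < w ^ 2) by (apply pow_lt; exact Hw).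
  assert (He2 : E * (n1 ^ 2 + n2 ^ 2) = w ^ 2) by lra.
  assert (HEp : 0 < E).
  { destruct (Rle_lt_dec E 0); [|assumption]. exfalso.
    assert (0 <= n1 ^ 2 + n2 ^ 2) by nra. nra. }
  assert (Horth : n1 * g1 + n2 * g2 = 0).
  { assert (K : E * (n1 * g1 + n2 * g2) = 0) by lra. apply Rmult_integral in K. destruct K; lra. }
  assert (Hneg : g1 * n2 - g2 * n1 < 0) by nra.
  split; [exact Horth|split; [exact Hneg|]].
  intros V.
  assert (Hs : hnorm p (vadd (vscal g1 A) (vscal g2 B)) = E * (g2 * n1 - g1 * n2) / w ^ 2).
  { unfold hnorm. apply sqrt_unique_pos.
    - apply Rmult_le_pos; [nra|left; now apply Rinv_0_lt_compat].
    - unfold hdot. rewrite !edot_comb, !edot_comb_r, (edot_sym B A), HF, <- HE'. fold E w.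
      assert (K : (g2 * n1 - g1 * n2) ^ 2 = (n1 ^ 2 + n2 ^ 2) * (g1 ^ 2 + g2 ^ 2)).
      { transitivity ((n1 ^ 2 + n2 ^ 2) * (g1 ^ 2 + g2 ^ 2) - (n1 * g1 + n2 * g2) ^ 2); [ring|rewrite Horth; ring]. }
      replace ((E * (g2 * n1 - g1 * n2) / w ^ 2) ^ 2) with (E ^ 2 * (g2 * n1 - g1 * n2) ^ 2 / w ^ 4) by (field; lra).
      rewrite K. transitivity (E * (g1 ^ 2 + g2 ^ 2) * (E * (n1 ^ 2 + n2 ^ 2)) / w ^ 4); [field; lra|].
      rewrite He2. field. lra. }
  rewrite Hs. unfold hdot. rewrite edot_comb. fold w.
  assert (K1 : E * n1 * (g2 * n1 - g1 * n2) = g2 * w ^ 2).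
  { rewrite <- He2. transitivity (g2 * (E * (n1 ^ 2 + n2 ^ 2)) - E * n2 * (n1 * g1 + n2 * g2)); [ring|rewrite Horth; ring]. }
  assert (K2 : E * n2 * (g2 * n1 - g1 * n2) = - g1 * w ^ 2).
  { rewrite <- He2. transitivity (- g1 * (E * (n1 ^ 2 + n2 ^ 2)) + E * n1 * (n1 * g1 + n2 * g2)); [ring|rewrite Horth; ring]. }
  transitivity ((E * n1 * (g2 * n1 - g1 * n2) * edot A V + E * n2 * (g2 * n1 - g1 * n2) * edot B V) / w ^ 4); [field; lra|].
  rewrite K1, K2. field. lra.
Qed.

(** The coefficient of dz in the pull-back of the complex one-form.  It is made from the surface
    alone, so it is single-valued around the puncture, and of class C1. *)
Definition surface_form (a b c : C) (X : C -> point) (z : C) : C :=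
  (RtoC (/ 2) * (killing_form a b c (X z) (Dx X z) - Ci * killing_form a b c (X z) (Dy X z)))%C.

Section EndFlux.
Variables (Om : C -> Prop) (X : C -> point) (a b c : C).
Hypothesis (HX : bryant_end Om X).
Let S := punctured Om.

Lemma end_open : open S.
Proof. apply open_punctured. apply HX. Qed.

Lemma end_C2 : C2_map S X.
Proof. apply HX. Qed.

Lemma end_pos z : S z -> 0 < cw (X z).
Proof. intros Hz. apply HX in Hz. apply Hz. Qed.

Lemma surface_form_C1 : C1c S (surface_form a b c X).
Proof.
  apply (C1c_mult S end_open); [apply (C1c_const S end_open)|].
  apply (C1c_minus S end_open).
  - apply (C1c_killing_form_x S end_open X end_C2 end_pos).
  - apply (C1c_mult S end_open); [apply (C1c_const S end_open)|].
    apply (C1c_killing_form_y S end_open X end_C2 end_pos).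
Qed.

(** The real part of the one-form accounts for the conormal term and the imaginary part for the
    disk; what is integrated is - 2 Im (n dz), with n the surface form. *)
Lemma flux_loop_integral (Y : point -> point) (phi : R) :
  (forall p, H3 p -> Y p = killing a b c p) -> is_flux Om X Y phi ->
  exists g, end_loop Om g /\
    (forall t, exists n : C, Re (n * Cconj (path_velocity g t))%C = 0 /\
       Im (Cconj (path_velocity g t) * n)%C < 0 /\ towards_puncture Om g t n) /\
    phi = - 2 * RInt (form_along (fun z => Im (surface_form a b c X z))
                                 (fun z => Re (surface_form a b c X z)) g) 0 1.
Proof.
  intros HY (g & eta & k & nu & HL & Heta & Hk & Hnu & Hphi).
  assert (Hg := loop_C1 Om g HL). assert (HS := loop_punctured Om g HL).
  assert (HO := end_open). assert (HC2 := end_C2).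
  assert (HV : forall t, velocity (fun t => X (g t)) t =
    vadd (vscal (Re (path_velocity g t)) (Dx X (g t))) (vscal (Im (path_velocity g t)) (Dy X (g t)))).
  { intros t. apply (velocity_comp S X g t HO HC2 Hg). apply HS. }
  assert (Con : forall t, exists n : C, Re (n * Cconj (path_velocity g t))%C = 0 /\
       Im (Cconj (path_velocity g t) * n)%C < 0 /\ towards_puncture Om g t n /\
       forall V, hdot (X (g t)) (eta t) V * hnorm (X (g t)) (velocity (fun t => X (g t)) t) =
         Im (path_velocity g t) * hdot (X (g t)) (Dx X (g t)) V - Re (path_velocity g t) * hdot (X (g t)) (Dy X (g t)) V).
  { intros t. destruct (Heta t) as (E1 & E2 & (n & En & ET) & E3). cbv beta in *.
    destruct HX as (_ & _ & _ & HX'). destruct (HX' _ (HS t)) as (Hw & _ & (Hc1 & Hc2) & _ & Ho).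
    rewrite HV, En in *.
    destruct (conormal_rotation (X (g t)) (Dx X (g t)) (Dy X (g t)) _ (Re n) (Im n) (Re (path_velocity g t)) (Im (path_velocity g t))
       Hw Hc1 Hc2 E1 E2 Ho E3) as (R1 & R2 & R3).
    exists n. split; [|split; [|split]].
    - rewrite <- R1. unfold Re, Im; simpl. ring.
    - replace (Im (Cconj (path_velocity g t) * n)%C) with (Re (path_velocity g t) * Im n - Im (path_velocity g t) * Re n); [exact R2|].
      unfold Re, Im; simpl. ring.
    - exact ET.
    - exact R3. }
  exists g. split; [exact HL|]. split.
  { intros t. destruct (Con t) as (n & N1 & N2 & N3 & _). exists n. auto. }
  rewrite Hphi. unfold curve_integral.
  rewrite (disk_flux _ k nu Hk Hnu a b c Y HY).
  set (nx := fun z => killing_form a b c (X z) (Dx X z)). set (ny := fun z => killing_form a b c (X z) (Dy X z)).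
  assert (Cx : C1c S nx) by apply (C1c_killing_form_x S HO X HC2 end_pos).
  assert (Cy : C1c S ny) by apply (C1c_killing_form_y S HO X HC2 end_pos).
  set (A := form_along (fun z => Re (ny z)) (fun z => - Re (nx z)) g).
  set (B := form_along (fun z => / 2 * Im (nx z)) (fun z => / 2 * Im (ny z)) g).
  assert (Cont : forall f, C1_on S f -> forall t, continuous f (g t)).
  { intros f Hf t. apply (C1_continuous S); auto. apply HS. }
  assert (CA : forall t, continuous A t).
  { intros t. apply continuous_form_along; [exact Hg| |].
    - apply Cont. apply Cy.
    - apply (Cont (fun z => - Re (nx z))). apply C1_opp; [exact HO|apply Cx]. }
  assert (CB : forall t, continuous B t).
  { intros t. apply continuous_form_along; [exact Hg| |].
    - apply (Cont (fun z => / 2 * Im (nx z))). apply (half_C1 S HO (fun z => Im (nx z))). apply Cx.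
    - apply (Cont (fun z => / 2 * Im (ny z))). apply (half_C1 S HO (fun z => Im (ny z))). apply Cy. }
  assert (IA : ex_RInt A 0 1) by (apply (ex_RInt_continuous (V := R_CompleteNormedModule)); auto).
  assert (IB : ex_RInt B 0 1) by (apply (ex_RInt_continuous (V := R_CompleteNormedModule)); auto).
  rewrite (RInt_ext _ A).
  2:{ intros t _. destruct (Con t) as (n & _ & _ & _ & R3).
      assert (Hw : 0 < cw (X (g t))) by (apply end_pos, HS).
      rewrite HY by exact Hw. rewrite R3. unfold A, form_along, nx, ny.
      rewrite !killing_form_Re by exact Hw.
      change (Derive (fun t => Re (g t)) t) with (Re (path_velocity g t)).
      change (Derive (fun t => Im (g t)) t) with (Im (path_velocity g t)).
      match goal with |- ?u = ?v => change (@eq R u v) end. ring. }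
  rewrite (RInt_ext (fun t => / 2 * Im (killing_form a b c (X (g t)) (velocity (fun t => X (g t)) t))) B).
  2:{ intros t _. rewrite HV, killing_form_add. unfold B, form_along, nx, ny.
      change (Derive (fun t => Re (g t)) t) with (Re (path_velocity g t)).
      change (Derive (fun t => Im (g t)) t) with (Im (path_velocity g t)).
      unfold Re, Im; simpl. ring. }
  assert (F : forall t, form_along (fun z => Im (surface_form a b c X z)) (fun z => Re (surface_form a b c X z)) g t
     = minus (scal (- / 2) (A t)) (scal (-1) (B t))).
  { intros t. unfold A, B, form_along, surface_form. fold (nx (g t)) (ny (g t)).
    generalize (nx (g t)) (ny (g t)). intros u v.
    unfold minus, plus, opp, scal, mult; simpl. unfold mult; simpl. unfold Re, Im; simpl. field. }
  rewrite (RInt_ext _ _ 0 1 (fun t _ => F t)).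
  assert (IA' := ex_RInt_scal (V := R_NormedModule) A 0 1 (- / 2) IA).
  assert (IB' := ex_RInt_scal (V := R_NormedModule) B 0 1 (-1) IB).
  assert (K := RInt_minus (V := R_CompleteNormedModule) _ _ 0 1 IA' IB').
  assert (K1 := RInt_scal (V := R_CompleteNormedModule) A 0 1 (- / 2) IA).
  assert (K2 := RInt_scal (V := R_CompleteNormedModule) B 0 1 (-1) IB).
  transitivity (-2 * (minus (scal (- / 2) (RInt A 0 1)) (scal (-1) (RInt B 0 1)))).
  - unfold minus, plus, opp, scal, mult; simpl. unfold mult; simpl.
    generalize (RInt A 0 1 : R) (RInt B 0 1 : R). intros u v. simpl. field.
  - etransitivity; [|exact (f_equal (fun x => -2 * x) (eq_sym K))].
    exact (f_equal2 (fun u v : R => -2 * minus u v) (eq_sym K1) (eq_sym K2)).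
Qed.
End EndFlux.

(** * Holomorphic functions *)

Definition Cderiv (f : C -> C) (z l : C) : Prop :=
  is_derive (K := C_AbsRing) (V := C_NormedModule) f z l.

Lemma Cderiv_eps f z l : Cderiv f z l -> forall eps : posreal,
  exists d : posreal, forall w, Cmod (w - z)%C < d ->
    Cmod (f w - f z - (w - z) * l)%C <= eps * Cmod (w - z)%C.
Proof.
  intros [_ H] eps. destruct (H z (fun P HP => HP) eps) as [d Hd].
  exists d. intros w Hw. apply (Hd w). exact Hw.
Qed.

Lemma Re_le_Cmod (z : C) : Rabs (Re z) <= Cmod z.
Proof. apply (Rle_trans _ _ _ (Rmax_l _ (Rabs (Im z)))). apply Rmax_Cmod. Qed.
Lemma Im_le_Cmod (z : C) : Rabs (Im z) <= Cmod z.
Proof. apply (Rle_trans _ _ _ (Rmax_r (Rabs (Re z)) _)). apply Rmax_Cmod. Qed.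

(** Stated for both the real and the imaginary part; u will be 1 or i. *)
Lemma Cderiv_line f z l u (part : C -> R) :
  (forall v w, part (v - w)%C = part v - part w) -> (forall t v, part (RtoC t * v)%C = t * part v) ->
  (forall v, Rabs (part v) <= Cmod v) ->
  Cmod u = 1 -> Cderiv f z l ->
  is_derive (fun t => part (f (z + RtoC t * u)%C)) 0 (part (u * l)%C).
Proof.
  intros Hminus Hscal Hle Hu Hf. apply is_derive_Reals. intros eps Heps.
  assert (He2 : 0 < eps / 2) by lra.
  destruct (Cderiv_eps f z l Hf (mkposreal _ He2)) as [d Hd].
  exists d. intros h Hh0 Hh. rewrite Rplus_0_l.
  assert (Z0 : (z + RtoC 0 * u)%C = z) by ring. rewrite Z0.
  assert (K := Hd (z + RtoC h * u)%C).
  replace (z + RtoC h * u - z)%C with (RtoC h * u)%C in K by ring.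
  assert (Hm : Cmod (RtoC h * u)%C = Rabs h) by (rewrite Cmod_mult, Hu, Cmod_R; ring).
  rewrite Hm in K. specialize (K Hh). simpl in K.
  assert (E : (part (f (z + RtoC h * u)%C) - part (f z)) / h - part (u * l)%C =
     part (f (z + RtoC h * u)%C - f z - RtoC h * u * l)%C / h).
  { rewrite !Hminus. replace (RtoC h * u * l)%C with (RtoC h * (u * l))%C by ring.
    rewrite Hscal. field. exact Hh0. }
  rewrite E. unfold Rdiv. rewrite Rabs_mult, Rabs_inv.
  assert (0 < Rabs h) by now apply Rabs_pos_lt.
  apply Rle_lt_trans with (eps / 2 * Rabs h * / Rabs h).
  - apply Rmult_le_compat_r; [left; now apply Rinv_0_lt_compat|].
    eapply Rle_trans; [apply Hle | exact K].
  - rewrite Rmult_assoc, Rinv_r by lra. lra.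
Qed.

Lemma Cderiv_partials f z l : Cderiv f z l -> partials f z l (Ci * l)%C.
Proof.
  intros Hf.
  assert (Shift : forall (g : R -> R) x v, is_derive (fun t => g (x + t)) 0 v -> is_derive g x v).
  { intros g x v H. apply is_derive_ext with (fun y => (fun t => g (x + t)) (y - x)).
    { intros t. f_equal. ring. }
    evar_last.
    - apply (is_derive_comp (fun t => g (x + t)) (fun y => y - x)).
      + rewrite Rminus_diag. exact H.
      + apply (is_derive_minus (fun y => y) (fun _ => x)); [apply is_derive_id|apply is_derive_const].
    - unfold scal, minus, plus, opp, zero, one; simpl. unfold mult, opp, zero, plus; simpl. ring. }
  assert (M1 : Cmod 1%C = 1) by apply Cmod_1.
  assert (Mi : Cmod Ci = 1).
  { unfold Cmod, Ci; simpl. replace (0 * (0 * 1) + 1 * (1 * 1)) with 1 by ring. apply sqrt_1. }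
  assert (PR : forall u, Cmod u = 1 -> is_derive (fun t => Re (f (z + RtoC t * u)%C)) 0 (Re (u * l)%C)).
  { intros u Hu. apply (Cderiv_line f z l u Re); auto; try apply Re_le_Cmod.
    intros t v. unfold Re; simpl. ring. }
  assert (PI : forall u, Cmod u = 1 -> is_derive (fun t => Im (f (z + RtoC t * u)%C)) 0 (Im (u * l)%C)).
  { intros u Hu. apply (Cderiv_line f z l u Im); auto; try apply Im_le_Cmod.
    intros t v. unfold Im; simpl. ring. }
  assert (E1 : forall t, (z + RtoC t * 1)%C = (Re z + t, Im z)).
  { intros t. destruct z. apply injective_projections; simpl; ring. }
  assert (E2 : forall t, (z + RtoC t * Ci)%C = (Re z, Im z + t)).
  { intros t. destruct z. apply injective_projections; simpl; ring. }
  split; split; apply Shift.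
  - rewrite <- (Cmult_1_l l). apply is_derive_ext with (2 := PR _ M1). intros t. now rewrite E1.
  - rewrite <- (Cmult_1_l l). apply is_derive_ext with (2 := PI _ M1). intros t. now rewrite E1.
  - apply is_derive_ext with (2 := PR _ Mi). intros t. now rewrite E2.
  - apply is_derive_ext with (2 := PI _ Mi). intros t. now rewrite E2.
Qed.

Lemma Cderiv_continuous f z l : Cderiv f z l -> continuous f z.
Proof.
  intros Hf. intros P [e He].
  destruct (Cderiv_eps f z l Hf (mkposreal 1 Rlt_0_1)) as [d Hd].
  set (k := 2 * (1 + 1 + Cmod l)).
  assert (Hl := Cmod_ge_0 l).
  assert (Hm : 0 < Rmin (d / 2) (e / k)).
  { destruct d, e; apply Rmin_glb_lt; simpl; [lra|]. apply Rdiv_lt_0_compat; unfold k; lra. }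
  assert (A := Rmin_l (d / 2) (e / k)). assert (B := Rmin_r (d / 2) (e / k)).
  exists (mkposreal _ Hm). intros w [W1 W2].
  change (Rabs (Re w - Re z) < Rmin (d / 2) (e / k)) in W1.
  change (Rabs (Im w - Im z) < Rmin (d / 2) (e / k)) in W2.
  set (m := Rmin (d / 2) (e / k)) in *.
  assert (Hw : Cmod (w - z)%C < 2 * m).
  { assert (K := Cmod_triangle (RtoC (Re w - Re z)) (Ci * RtoC (Im w - Im z))).
    replace (RtoC (Re w - Re z) + Ci * RtoC (Im w - Im z))%C with (w - z)%C in K.
    - rewrite Cmod_mult, !Cmod_R in K.
      replace (Cmod Ci) with 1 in K; [lra|].
      unfold Cmod, Ci; simpl. replace (0 * (0 * 1) + 1 * (1 * 1)) with 1 by ring. symmetry; apply sqrt_1.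
    - destruct w, z. apply injective_projections; simpl; ring. }
  specialize (Hd w ltac:(lra)). simpl in Hd.
  assert (Hfw : Cmod (f w - f z)%C < e).
  { assert (K := Cmod_triangle (f w - f z - (w - z) * l) ((w - z) * l)).
    replace (f w - f z - (w - z) * l + (w - z) * l)%C with (f w - f z)%C in K by ring.
    rewrite Cmod_mult in K.
    assert (Hk : m * k <= e).
    { apply Rle_trans with (e / k * k); [apply Rmult_le_compat_r; [unfold k; lra | exact B]|].
      right. field. unfold k; lra. }
    assert (Cmod (w - z)%C * (1 + Cmod l) <= 2 * m * (1 + Cmod l)) by (apply Rmult_le_compat_r; lra).
    unfold k in Hk. nra. }
  apply He. split.
  - apply Rle_lt_trans with (2 := Hfw). apply (Re_le_Cmod (f w - f z)%C).
  - apply Rle_lt_trans with (2 := Hfw). apply (Im_le_Cmod (f w - f z)%C).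
Qed.

(** Class C1 is part of the notion, since closed forms are required to be of class C1. *)
Definition holomorphic_on (T : C -> Prop) (f : C -> C) : Prop :=
  C1c T f /\ forall s, T s -> cdy f s = (Ci * cdx f s)%C.

Section Hol.
Variables (T : C -> Prop) (HT : open T).

Lemma holomorphic_const k : holomorphic_on T (fun _ => k).
Proof.
  split; [now apply C1c_const|]. intros s _.
  destruct (partials_eq _ _ _ _ (partials_const k s)) as [-> ->]. ring.
Qed.

Lemma holomorphic_mult f g : holomorphic_on T f -> holomorphic_on T g -> holomorphic_on T (fun s => f s * g s)%C.
Proof.
  intros [F1 F2] [G1 G2]. split; [now apply C1c_mult|]. intros s Hs.
  destruct (partials_eq _ _ _ _ (partials_mult _ _ _ _ _ _ _ (partials_C1 T f s F1 Hs)
    (partials_C1 T g s G1 Hs))) as [-> ->]. rewrite F2, G2 by assumption. ring.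
Qed.

Lemma holomorphic_plus f g : holomorphic_on T f -> holomorphic_on T g -> holomorphic_on T (fun s => f s + g s)%C.
Proof.
  intros [F1 F2] [G1 G2]. split; [now apply C1c_plus|]. intros s Hs.
  destruct (partials_eq _ _ _ _ (partials_plus _ _ _ _ _ _ _ (partials_C1 T f s F1 Hs)
    (partials_C1 T g s G1 Hs))) as [-> ->]. rewrite F2, G2 by assumption. ring.
Qed.

Lemma holomorphic_minus f g : holomorphic_on T f -> holomorphic_on T g -> holomorphic_on T (fun s => f s - g s)%C.
Proof.
  intros [F1 F2] [G1 G2]. split; [now apply C1c_minus|]. intros s Hs.
  destruct (partials_eq _ _ _ _ (partials_plus _ _ _ _ _ _ _ (partials_C1 T f s F1 Hs)
    (partials_opp _ _ _ _ (partials_C1 T g s G1 Hs)))) as [Ex Ey]. change (fun s => f s - g s)%C with (fun s => f s + - g s)%C.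
  rewrite Ex, Ey, F2, G2 by assumption. ring.
Qed.

Lemma holomorphic_ext f g : (forall s, T s -> f s = g s) -> holomorphic_on T f -> holomorphic_on T g.
Proof.
  intros E [F1 F2]. split; [now apply (C1c_ext T HT f)|]. intros s Hs.
  destruct (partials_eq g s _ _ (partials_ext T f g s _ _ HT Hs E (partials_C1 T f s F1 Hs))) as [-> ->].
  now apply F2.
Qed.

Lemma holomorphic_of_derivative f f' : (forall s, T s -> Cderiv f s (f' s)) ->
  (forall s, T s -> continuous f' s) -> holomorphic_on T f.
Proof.
  intros Hf Hc.
  assert (P : forall s, T s -> partials f s (f' s) (Ci * f' s)%C) by (intros; now apply Cderiv_partials, Hf).
  assert (CRe : forall s, T s -> continuous (fun s => Re (f' s)) s).
  { intros s Hs. apply (continuous_comp f' Re); [now apply Hc|apply continuous_Re]. }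
  assert (CIm : forall s, T s -> continuous (fun s => Im (f' s)) s).
  { intros s Hs. apply (continuous_comp f' Im); [now apply Hc|apply continuous_Im]. }
  split.
  - split.
    + apply (C1_intro T _ (fun s => Re (f' s)) (fun s => - Im (f' s)) HT); auto.
      * intros s Hs. apply (P s Hs).
      * intros s Hs. destruct (P s Hs) as (_ & K & _). evar_last; [exact K|]. unfold Re, Im; simpl. ring.
      * intros s Hs. now apply (continuous_opp (fun s => Im (f' s))), CIm.
    + apply (C1_intro T _ (fun s => Im (f' s)) (fun s => Re (f' s)) HT); auto.
      * intros s Hs. apply (P s Hs).
      * intros s Hs. destruct (P s Hs) as (_ & _ & K). evar_last; [exact K|]. unfold Re, Im; simpl. ring.
  - intros s Hs. destruct (partials_eq _ _ _ _ (P s Hs)) as [-> ->]. reflexivity.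
Qed.

(** The real and imaginary parts of f' are first derivatives of those of f, and their
    Cauchy-Riemann equations express the symmetry of the second derivatives of f. *)
Lemma holomorphic_derivative f f' : (forall s, T s -> Cderiv f s (f' s)) -> C1c T f' -> holomorphic_on T f'.
Proof.
  intros Hf Hf'.
  assert (P : forall s, T s -> partials f s (f' s) (Ci * f' s)%C) by (intros; now apply Cderiv_partials, Hf).
  assert (Hf1 : holomorphic_on T f).
  { apply holomorphic_of_derivative with f'; [exact Hf|]. intros s Hs. now apply (C1c_continuous T HT f'). }
  destruct Hf1 as [[F1 F2] _].
  assert (E : forall s, T s -> dx (fun z => Re (f z)) s = Re (f' s) /\ dx (fun z => Im (f z)) s = Im (f' s) /\
     dy (fun z => Re (f z)) s = - Im (f' s) /\ dy (fun z => Im (f z)) s = Re (f' s)).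
  { intros s Hs. destruct (partials_eq _ _ _ _ (P s Hs)) as [E1 E2].
    assert (A1 := f_equal Re E1). assert (A2 := f_equal Im E1).
    assert (B1 := f_equal Re E2). assert (B2 := f_equal Im E2).
    split; [exact A1|split; [exact A2|split]].
    - transitivity (Re (Ci * f' s)%C); [exact B1|]. unfold Re, Im; simpl. ring.
    - transitivity (Im (Ci * f' s)%C); [exact B2|]. unfold Re, Im; simpl. ring. }
  destruct Hf' as [G1 G2]. assert (G2' := C1_opp T HT _ G2).
  assert (CRe : C2_on T (fun z => Re (f z))).
  { split; [exact F1|split].
    - apply (C1_ext T HT (fun s => Re (f' s))); [|exact G1]. intros s Hs. symmetry. now apply E.
    - apply (C1_ext T HT (fun s => - Im (f' s))); [|exact G2']. intros s Hs. symmetry. now apply E. }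
  assert (CIm : C2_on T (fun z => Im (f z))).
  { split; [exact F2|split].
    - apply (C1_ext T HT (fun s => Im (f' s))); [|exact G2]. intros s Hs. symmetry. now apply E.
    - apply (C1_ext T HT (fun s => Re (f' s))); [|exact G1]. intros s Hs. symmetry. now apply E. }
  split; [now split|]. intros s Hs.
  assert (M1 := mixed_partials T _ s HT CRe Hs). assert (M2 := mixed_partials T _ s HT CIm Hs).
  rewrite (dx_ext T HT (dy (fun z => Re (f z))) (fun s => - Im (f' s))) in M1 by (auto; intros; now apply E).
  rewrite (dy_ext T HT (dx (fun z => Re (f z))) (fun s => Re (f' s))) in M1 by (auto; intros; now apply E).
  rewrite (dx_ext T HT (dy (fun z => Im (f z))) (fun s => Re (f' s))) in M2 by (auto; intros; now apply E).
  rewrite (dy_ext T HT (dx (fun z => Im (f z))) (fun s => Im (f' s))) in M2 by (auto; intros; now apply E).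
  assert (M3 : dx (fun s => - Im (f' s)) s = - dx (fun s => Im (f' s)) s).
  { unfold dx. apply (Derive_opp (fun x => Im (f' (x, Im s)))). }
  rewrite M3 in M1. unfold cdx, cdy.
  apply injective_projections; simpl; lra.
Qed.
End Hol.

Lemma partials_cexp s : partials cexp s (cexp s) (Ci * cexp s)%C.
Proof.
  unfold cexp. split; split; unfold Re, Im; simpl; auto_derive; auto; ring.
Qed.

Lemma comp_cexp_C1 (S : C -> Prop) (f : C -> R) : open S -> C1_on S f ->
  open (fun s => S (cexp s)) -> C1_on (fun s => S (cexp s)) (fun s => f (cexp s)) /\
  forall s, S (cexp s) ->
    is_derive (fun x => f (cexp (x, Im s))) (Re s)
      (dx f (cexp s) * Re (cexp s) + dy f (cexp s) * Im (cexp s)) /\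
    is_derive (fun y => f (cexp (Re s, y))) (Im s)
      (dx f (cexp s) * - Im (cexp s) + dy f (cexp s) * Re (cexp s)).
Proof.
  intros HS Hf HT.
  assert (D : forall s, S (cexp s) ->
    is_derive (fun x => f (cexp (x, Im s))) (Re s)
      (dx f (cexp s) * Re (cexp s) + dy f (cexp s) * Im (cexp s)) /\
    is_derive (fun y => f (cexp (Re s, y))) (Im s)
      (dx f (cexp s) * - Im (cexp s) + dy f (cexp s) * Re (cexp s))).
  { intros s Hs. destruct (partials_cexp s) as [[P1 P2] [P3 P4]]. split.
    - assert (K := C1_curve S f (fun x => cexp (x, Im s)) (Re s) (Re (cexp s)) (Im (cexp s)) HS Hf).
      cbv beta in K. rewrite pair_eta in K. now apply K.
    - assert (K := C1_curve S f (fun y => cexp (Re s, y)) (Im s) (Re (Ci * cexp s)%C) (Im (Ci * cexp s)%C) HS Hf).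
      cbv beta in K. rewrite pair_eta in K.
      replace (- Im (cexp s)) with (Re (Ci * cexp s)%C) by (unfold Re, Im; simpl; ring).
      replace (Re (cexp s)) with (Im (Ci * cexp s)%C) by (unfold Re, Im; simpl; ring).
      now apply K. }
  split; [|exact D].
  assert (Ce : forall s, continuous cexp s) by apply continuous_cexp.
  assert (Cr : forall s, continuous (fun s => Re (cexp s)) s).
  { intros s. apply (continuous_comp cexp Re); [apply Ce|apply continuous_Re]. }
  assert (Ci' : forall s, continuous (fun s => Im (cexp s)) s).
  { intros s. apply (continuous_comp cexp Im); [apply Ce|apply continuous_Im]. }
  assert (Cx : forall s, S (cexp s) -> continuous (fun s => dx f (cexp s)) s).
  { intros s Hs. apply (continuous_comp cexp (dx f)); [apply Ce|now apply C1_cont_dx with S]. }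
  assert (Cy : forall s, S (cexp s) -> continuous (fun s => dy f (cexp s)) s).
  { intros s Hs. apply (continuous_comp cexp (dy f)); [apply Ce|now apply C1_cont_dy with S]. }
  apply (C1_intro _ _ (fun s => dx f (cexp s) * Re (cexp s) + dy f (cexp s) * Im (cexp s))
          (fun s => dx f (cexp s) * - Im (cexp s) + dy f (cexp s) * Re (cexp s)) HT).
  - intros s Hs. now apply D.
  - intros s Hs. now apply D.
  - intros s Hs. apply (continuous_plus (fun s => dx f (cexp s) * Re (cexp s))).
    + apply (continuous_mult (fun s => dx f (cexp s))); auto.
    + apply (continuous_mult (fun s => dy f (cexp s))); auto.
  - intros s Hs. apply (continuous_plus (fun s => dx f (cexp s) * - Im (cexp s))).
    + apply (continuous_mult (fun s => dx f (cexp s))); auto.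
      now apply (continuous_opp (fun s => Im (cexp s))).
    + apply (continuous_mult (fun s => dy f (cexp s))); auto.
Qed.

Lemma comp_cexp_C1c (S : C -> Prop) (f : C -> C) : open S -> C1c S f ->
  open (fun s => S (cexp s)) -> C1c (fun s => S (cexp s)) (fun s => f (cexp s)) /\
  forall s, S (cexp s) -> partials (fun s => f (cexp s)) s
    (cdx f (cexp s) * RtoC (Re (cexp s)) + cdy f (cexp s) * RtoC (Im (cexp s)))%C
    (cdy f (cexp s) * RtoC (Re (cexp s)) - cdx f (cexp s) * RtoC (Im (cexp s)))%C.
Proof.
  intros HS [H1 H2] HT.
  destruct (comp_cexp_C1 S _ HS H1 HT) as [A1 A2]. destruct (comp_cexp_C1 S _ HS H2 HT) as [B1 B2].
  split; [now split|]. intros s Hs. destruct (A2 s Hs) as [D1 D2]. destruct (B2 s Hs) as [D3 D4].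
  split; split.
  - evar_last; [exact D1|]. unfold cdx, cdy, Re, Im; simpl. ring.
  - evar_last; [exact D3|]. unfold cdx, cdy, Re, Im; simpl. ring.
  - evar_last; [exact D2|]. unfold cdx, cdy, Re, Im; simpl. ring.
  - evar_last; [exact D4|]. unfold cdx, cdy, Re, Im; simpl. ring.
Qed.

(** The chain rule for exp multiplies the defect of the Cauchy-Riemann equation by the conjugate
    of exp s, and the further factor exp s by itself; neither vanishes. *)
Lemma cauchy_riemann_descend (S : C -> Prop) (f : C -> C) : open S -> C1c S f ->
  open (fun s => S (cexp s)) -> holomorphic_on (fun s => S (cexp s)) (fun s => f (cexp s) * cexp s)%C ->
  forall s, S (cexp s) -> cdy f (cexp s) = (Ci * cdx f (cexp s))%C.
Proof.
  intros HS Hf HT [_ H] s Hs.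
  destruct (comp_cexp_C1c S f HS Hf HT) as [_ D].
  assert (P := partials_mult _ _ _ _ _ _ _ (D s Hs) (partials_cexp s)).
  destruct (partials_eq _ _ _ _ P) as [E1 E2]. specialize (H s Hs). rewrite E1, E2 in H.
  set (e := cexp s) in *. assert (He : nonzeroC e) by apply cexp_nz.
  assert (K : (e * Cconj e * (cdy f e - Ci * cdx f e))%C = 0%C).
  { replace (Cconj e) with (RtoC (Re e) - Ci * RtoC (Im e))%C.
    2:{ destruct e. apply injective_projections; simpl; ring. }
    set (fx := cdx f e) in *. set (fy := cdy f e) in *. clearbody fx fy.
    assert (Ci2 : (Ci * Ci)%C = (- (1))%C) by (apply injective_projections; simpl; ring).
    transitivity (((fy * RtoC (Re e) - fx * RtoC (Im e)) * e + f e * (Ci * e))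
       - Ci * ((fx * RtoC (Re e) + fy * RtoC (Im e)) * e + f e * e)
       + (Ci * Ci + 1) * fx * RtoC (Im e) * e)%C; [ring|]. rewrite H, Ci2. ring. }
  assert (Hn : (e * Cconj e)%C <> 0%C).
  { rewrite <- Cmod2_conj. apply RtoC_nz. apply Cmod_gt_0 in He.
    assert (0 < Cmod e ^ 2) by (apply pow_lt; lra). lra. }
  destruct (excluded_middle_informative ((cdy f e - Ci * cdx f e)%C = 0%C)) as [K'|K'];
    [|exfalso; exact (Cmult_neq_0 _ _ Hn K' K)].
  replace (cdy f e) with (cdy f e - Ci * cdx f e + Ci * cdx f e)%C by ring. rewrite K'. ring.
Qed.

(** * The Bryant representation and its residues *)

Lemma Ci2 : (Ci * Ci)%C = (- (1))%C.
Proof. apply injective_projections; simpl; ring. Qed.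

(** This is the identity between (dX) X^-1 and F' F^-1 for X = F F^*, with the Hermitian matrix X
    written in the coordinates U / q and 1 / q of the half-space.  The conjugates Ab, Bb, Cb, Db do
    not get differentiated, as F^* is antiholomorphic; the only relation needed between them is det F^* = 1. *)
Lemma bryant_algebra (A B C0 D A' B' C' D' Ab Bb Cb Db a b c : C) :
  (A * D - B * C0)%C = 1%C -> (Ab * Db - Bb * Cb)%C = 1%C ->
  (A' * D + A * D' - B' * C0 - B * C')%C = 0%C ->
  let q := (A * Ab + B * Bb)%C in
  let U := (Ab * C0 + Bb * D)%C in let Ub := (A * Cb + B * Db)%C in
  let dq := (A' * Ab + B' * Bb)%C in
  let dU := (Ab * C' + Bb * D')%C in let dUb := (A' * Cb + B' * Db)%C in
  q <> 0%C ->
  (a * ((dU - U / q * dq) / q) - (dUb - Ub / q * dq) / q * (a * (U / q) * (U / q) + b * (U / q) + c) * (q * q)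
   - (- dq / (q * q)) * q * (RtoC 2 * a * (U / q) + b))%C =
  (a * (D * C' - C0 * D') + b * (D * A' - C0 * B') + c * (B * A' - A * B'))%C.
Proof.
  intros Hdet Hdetb Hd q U Ub dq dU dUb Hq.
  assert (Kc : (dUb * q - Ub * dq)%C = (- (B * A' - A * B'))%C).
  { unfold dUb, q, Ub, dq. transitivity (- (B * A' - A * B') * (Ab * Db - Bb * Cb))%C; [ring|rewrite Hdetb; ring]. }
  assert (Kb : ((B * A' - A * B') * U + dq)%C = ((D * A' - C0 * B') * q)%C).
  { unfold U, dq, q.
    transitivity ((D * A' - C0 * B') * (A * Ab + B * Bb) + (A' * Ab + B' * Bb) * (1 - (A * D - B * C0)))%C; [ring|rewrite Hdet; ring]. }
  assert (Ka1 : (q * D - Ab)%C = (B * U)%C).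
  { unfold q, U. transitivity (B * (Ab * C0 + Bb * D) + Ab * ((A * D - B * C0) - 1))%C; [ring|rewrite Hdet; ring]. }
  assert (Ka2 : (q * C0 + Bb)%C = (A * U)%C).
  { unfold q, U. transitivity (A * (Ab * C0 + Bb * D) + Bb * (1 - (A * D - B * C0)))%C; [ring|rewrite Hdet; ring]. }
  assert (Ka : (dU * q + U * dq + (B * A' - A * B') * U * U)%C = ((D * C' - C0 * D') * q * q)%C).
  { transitivity (dU * q + U * ((B * A' - A * B') * U + dq))%C; [ring|]. rewrite Kb.
    transitivity ((D * C' - C0 * D') * q * q + q * (dU - C' * (q * D) + D' * (q * C0) + U * (D * A' - C0 * B')))%C; [ring|].
    replace (q * D)%C with (B * U + Ab)%C by (rewrite <- Ka1; ring).
    replace (q * C0)%C with (A * U - Bb)%C by (rewrite <- Ka2; ring).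
    unfold dU.
    transitivity ((D * C' - C0 * D') * q * q + q * U * (A' * D + A * D' - B' * C0 - B * C'))%C; [ring|rewrite Hd; ring]. }
  clearbody q U Ub dq dU dUb.
  transitivity ((a * (dU * q - U * dq) - (dUb * q - Ub * dq) * (a * U * U + b * U * q + c * q * q)
     + dq * (RtoC 2 * a * U + b * q)) / (q * q))%C; [field; exact Hq|].
  rewrite Kc.
  transitivity ((a * (dU * q + U * dq + (B * A' - A * B') * U * U) + b * q * ((B * A' - A * B') * U + dq)
     + c * q * q * (B * A' - A * B')) / (q * q))%C; [field; exact Hq|].
  rewrite Ka, Kb. field. exact Hq.
Qed.

Section Bryant.
Variables (Om : C -> Prop) (X : C -> point) (FA FB FC FD : C -> C).
Hypotheses (HX : bryant_end Om X) (HF : bryant_representation Om X FA FB FC FD).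

Let T (s : C) : Prop := punctured Om (cexp s).
Let dA := C_derive FA. Let dB := C_derive FB. Let dC := C_derive FC. Let dD := C_derive FD.

(** A combination of the entries of F' F^-1. *)
Definition cover_form (a b c : C) (s : C) : C :=
  (a * (FD s * dC s - FC s * dD s) + b * (FD s * dA s - FC s * dB s) + c * (FB s * dA s - FA s * dB s))%C.

Lemma cover_open : open T.
Proof.
  intros s Hs. apply (continuous_cexp s (punctured Om)). apply (end_open Om X HX). exact Hs.
Qed.

Lemma cover_domain s : Om (cexp s) -> T s.
Proof. intros H. split; [exact H|apply cexp_nz]. Qed.

Lemma F_deriv s : T s -> Cderiv FA s (dA s) /\ Cderiv FB s (dB s) /\ Cderiv FC s (dC s) /\ Cderiv FD s (dD s).
Proof.
  intros [Hs _]. destruct (HF s Hs) as ((H1 & H2 & H3 & H4) & _).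
  split; [|split; [|split]]; (apply C_derive_correct; [exact 0%C|assumption]).
Qed.

Lemma F_det s : T s -> (FA s * FD s - FB s * FC s)%C = 1%C.
Proof. intros [Hs _]. apply (HF s Hs). Qed.

Lemma F_det_derivative s : T s ->
  (dA s * FD s + FA s * dD s - dB s * FC s - FB s * dC s)%C = 0%C.
Proof.
  intros Hs. destruct (F_deriv s Hs) as (HA & HB & HC & HD).
  apply Cderiv_partials in HA, HB, HC, HD.
  assert (P := partials_plus _ _ _ _ _ _ _ (partials_mult _ _ _ _ _ _ _ HA HD)
     (partials_opp _ _ _ _ (partials_mult _ _ _ _ _ _ _ HB HC))).
  destruct (partials_unique _ _ _ _ _ _ (partials_ext T _ (fun _ => 1%C) s _ _ cover_open Hs F_det P)
    (partials_const 1 s)) as [E _].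
  rewrite <- E. ring.
Qed.

Let q (s : C) : C := (FA s * Cconj (FA s) + FB s * Cconj (FB s))%C.

Lemma q_real s : q s = RtoC (Cmod (FA s) ^ 2 + Cmod (FB s) ^ 2).
Proof. unfold q. rewrite RtoC_plus, !Cmod2_conj. reflexivity. Qed.

Lemma q_pos s : T s -> 0 < Cmod (FA s) ^ 2 + Cmod (FB s) ^ 2.
Proof.
  intros Hs. assert (K := F_det s Hs).
  assert (A := pow2_ge_0 (Cmod (FA s))). assert (B := pow2_ge_0 (Cmod (FB s))).
  destruct (excluded_middle_informative (FA s = 0%C)) as [E|N].
  - assert (N : FB s <> 0%C).
    { intros E2. rewrite E, E2 in K. apply (f_equal Re) in K. simpl in K. lra. }
    apply Cmod_gt_0 in N. assert (0 < Cmod (FB s) ^ 2) by (apply pow_lt; lra). lra.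
  - apply Cmod_gt_0 in N. assert (0 < Cmod (FA s) ^ 2) by (apply pow_lt; lra). lra.
Qed.

(** The relations zeta q = conj A C + conj B D and w q = 1 are differentiated with d/dx - i d/dy,
    which annihilates the conjugates of A, B, C and D.  This gives the derivatives of the surface in
    terms of F, and the identity becomes [bryant_algebra]. *)
Lemma surface_form_cover a b c s : T s ->
  (surface_form a b c X (cexp s) * cexp s)%C = cover_form a b c s.
Proof.
  intros Hs.
  assert (HS := end_open Om X HX). assert (HC2 := end_C2 Om X HX).
  assert (Hpos := end_pos Om X HX).
  assert (HZ := C2_fst _ _ HC2). assert (HW := C1c_RtoC _ HS _ (C2_cw _ _ HC2)).
  destruct (comp_cexp_C1c _ _ HS HZ cover_open) as [_ PZ].
  destruct (comp_cexp_C1c _ _ HS HW cover_open) as [_ PW].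
  specialize (PZ s Hs). specialize (PW s Hs).
  destruct (F_deriv s Hs) as (HA & HB & HC & HD).
  apply Cderiv_partials in HA, HB, HC, HD.
  assert (HAb := partials_conj _ _ _ _ HA). assert (HBb := partials_conj _ _ _ _ HB).
  assert (Pq := partials_plus _ _ _ _ _ _ _ (partials_mult _ _ _ _ _ _ _ HA HAb)
     (partials_mult _ _ _ _ _ _ _ HB HBb)).
  assert (PU := partials_plus _ _ _ _ _ _ _ (partials_mult _ _ _ _ _ _ _ HAb HC)
     (partials_mult _ _ _ _ _ _ _ HBb HD)).
  change (fun z => (FA z * Cconj (FA z) + FB z * Cconj (FB z))%C) with q in Pq.
  cbv beta in Pq, PU.
  assert (Eq0 : forall s, T s -> q s <> 0%C).
  { intros u Hu. rewrite q_real. apply RtoC_nz. assert (K := q_pos u Hu). lra. }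
  assert (EZ : forall u, T u -> (fst (X (cexp u)) * q u)%C = (Cconj (FA u) * FC u + Cconj (FB u) * FD u)%C).
  { intros u Hu. destruct (HF u (proj1 Hu)) as (_ & _ & _ & E & _). rewrite E, <- q_real. field. now apply Eq0. }
  assert (EW : forall u, T u -> (RtoC (cw (X (cexp u))) * q u)%C = 1%C).
  { intros u Hu. destruct (HF u (proj1 Hu)) as (_ & _ & _ & _ & E). unfold cw. rewrite E, RtoC_Rinv, <- q_real.
    field. now apply Eq0. }
  assert (PZq := partials_mult _ _ _ _ _ _ _ PZ Pq). assert (PWq := partials_mult _ _ _ _ _ _ _ PW Pq).
  destruct (partials_unique _ _ _ _ _ _ (partials_ext T _ _ s _ _ cover_open Hs EZ PZq) PU) as [Z1 Z2].
  destruct (partials_unique _ _ _ _ _ _ (partials_ext T _ _ s _ _ cover_open Hs EW PWq)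
    (partials_const 1 s)) as [W1 W2].
  clear PZq PWq PU Pq HAb HBb HA HB HC HD.
  change (cdx (fun z => fst (X z)) (cexp s)) with (fst (Dx X (cexp s))) in *.
  change (cdy (fun z => fst (X z)) (cexp s)) with (fst (Dy X (cexp s))) in *.
  change (cdx (fun z => RtoC (cw (X z))) (cexp s)) with (cw (Dx X (cexp s)), dx (fun _ => 0) (cexp s)) in *.
  change (cdy (fun z => RtoC (cw (X z))) (cexp s)) with (cw (Dy X (cexp s)), dy (fun _ => 0) (cexp s)) in *.
  replace (cw (Dx X (cexp s)), dx (fun _ => 0) (cexp s)) with (RtoC (cw (Dx X (cexp s)))) in W1, W2
    by (unfold dx, RtoC; now rewrite Derive_const).
  replace (cw (Dy X (cexp s)), dy (fun _ => 0) (cexp s)) with (RtoC (cw (Dy X (cexp s)))) in W1, W2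
    by (unfold dy, RtoC; now rewrite Derive_const).
  assert (EZs := EZ s Hs). assert (EWs := EW s Hs). assert (Eqs := Eq0 s Hs).
  assert (Hdet := F_det s Hs). assert (Hdd := F_det_derivative s Hs).
  assert (Hw : cw (X (cexp s)) <> 0) by (assert (K := Hpos _ Hs); lra).
  assert (Hqc : Cconj (q s) = q s).
  { rewrite q_real. apply injective_projections; simpl; ring. }
  unfold surface_form, killing_form, cover_form.
  rewrite !RtoC_Rinv.
  assert (Cee : (RtoC (Re (cexp s)) + Ci * RtoC (Im (cexp s)))%C = cexp s).
  { destruct (cexp s). apply injective_projections; simpl; ring. }
  assert (Zc1 := f_equal Cconj Z1). assert (Zc2 := f_equal Cconj Z2).
  assert (EZc := f_equal Cconj EZs). assert (Detc := f_equal Cconj Hdet).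
  assert (ConjR : forall x : R, Cconj (RtoC x) = RtoC x) by (intros; apply injective_projections; simpl; ring).
  assert (CI : Cconj Ci = (- Ci)%C) by (apply injective_projections; simpl; ring).
  unfold q in Z1, Z2, W1, W2, EZs, EWs, Eqs, Zc1, Zc2, EZc.
  repeat (first [rewrite Cplus_conj in Zc1 | rewrite Cminus_conj in Zc1 | rewrite Cmult_conj in Zc1
    | rewrite ConjR in Zc1 | rewrite CI in Zc1 | rewrite Cconj_conj in Zc1]).
  repeat (first [rewrite Cplus_conj in Zc2 | rewrite Cminus_conj in Zc2 | rewrite Cmult_conj in Zc2
    | rewrite Copp_conj in Zc2 | rewrite ConjR in Zc2 | rewrite CI in Zc2 | rewrite Cconj_conj in Zc2]).
  rewrite Cminus_conj, !Cmult_conj, ConjR in Detc.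
  repeat (first [rewrite Cplus_conj in EZc | rewrite Cmult_conj in EZc | rewrite Cconj_conj in EZc]).
  repeat (first [rewrite Cmult_conj in Z2 | rewrite CI in Z2]).
  repeat (first [rewrite Cmult_conj in W2 | rewrite CI in W2]).
  clear ConjR CI.
  clear Hqc EZ EW Eq0.
  assert (HwC : RtoC (cw (X (cexp s))) <> 0%C) by now apply RtoC_nz.
  (* What remains is an identity between complex numbers: values, derivatives and conjugates are
  made independent variables. *)
  revert Z1 Z2 W1 W2 Zc1 Zc2 EZs EZc EWs Eqs Hdet Detc Hdd Cee HwC.
  generalize (FA s) (FB s) (FC s) (FD s) (dA s) (dB s) (dC s) (dD s). intros A B C0 D A' B' C' D'.
  generalize (Cconj A) (Cconj B) (Cconj C0) (Cconj D) (Cconj A') (Cconj B') (Cconj C') (Cconj D').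
  intros Ab Bb Cb Db Ab' Bb' Cb' Db'.
  generalize (RtoC (Re (cexp s))) (RtoC (Im (cexp s))). intros er ei.
  generalize (RtoC (cw (Dx X (cexp s)))) (RtoC (cw (Dy X (cexp s)))) (RtoC (cw (X (cexp s)))). intros wx wy w.
  generalize (fst (Dx X (cexp s))) (fst (Dy X (cexp s))) (fst (X (cexp s))). intros Zx Zy Z.
  generalize (Cconj Zx) (Cconj Zy) (Cconj Z). intros Zxb Zyb Zb.
  generalize (cexp s). clear. intros e.
  intros Z1 Z2 W1 W2 Zc1 Zc2 EZ EZc EW Hq Hdet Detc Hdd He Hw.
  assert (I2 := Ci2).
  set (qq := (A * Ab + B * Bb)%C) in *.
  assert (EZ' : Z = ((Ab * C0 + Bb * D) / qq)%C) by (rewrite <- EZ; field; exact Hq).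
  assert (EZb' : Zb = ((A * Cb + B * Db) / qq)%C).
  { rewrite <- EZc. replace (Ab * A + Bb * B)%C with qq by (unfold qq; ring). field; exact Hq. }
  assert (EW' : w = (/ qq)%C) by (transitivity (w * qq / qq)%C; [field; exact Hq|rewrite EW; field; exact Hq]).
  assert (DZ : (e * (Zx - Ci * Zy) * qq + Z * (RtoC 2 * (A' * Ab + B' * Bb)))%C = (RtoC 2 * (Ab * C' + Bb * D'))%C).
  { etransitivity; [|etransitivity; [exact (f_equal2 (fun u v => u - Ci * v)%C Z1 Z2)|]];
    rewrite <- ?He; cbv beta; unfold qq; ring [I2]. }
  assert (DZb : (e * (Zxb - Ci * Zyb) * qq + Zb * (RtoC 2 * (A' * Ab + B' * Bb)))%C = (RtoC 2 * (A' * Cb + B' * Db))%C).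
  { etransitivity; [|etransitivity; [exact (f_equal2 (fun u v => u - Ci * v)%C Zc1 Zc2)|]];
    rewrite <- ?He; cbv beta; unfold qq; ring [I2]. }
  assert (DW : (e * (wx - Ci * wy) * qq + w * (RtoC 2 * (A' * Ab + B' * Bb)))%C = 0%C).
  { etransitivity; [|etransitivity; [exact (f_equal2 (fun u v => u - Ci * v)%C W1 W2)|]];
    rewrite <- ?He; cbv beta; unfold qq; ring [I2]. }
  assert (E1 : (e * (Zx - Ci * Zy))%C = (RtoC 2 * ((Ab * C' + Bb * D') - (Ab * C0 + Bb * D) / qq * (A' * Ab + B' * Bb)) / qq)%C).
  { transitivity ((e * (Zx - Ci * Zy) * qq + Z * (RtoC 2 * (A' * Ab + B' * Bb)) - Z * (RtoC 2 * (A' * Ab + B' * Bb))) / qq)%C; [field; exact Hq|].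
    rewrite DZ, EZ'. field. exact Hq. }
  assert (E2 : (e * (Zxb - Ci * Zyb))%C = (RtoC 2 * ((A' * Cb + B' * Db) - (A * Cb + B * Db) / qq * (A' * Ab + B' * Bb)) / qq)%C).
  { transitivity ((e * (Zxb - Ci * Zyb) * qq + Zb * (RtoC 2 * (A' * Ab + B' * Bb)) - Zb * (RtoC 2 * (A' * Ab + B' * Bb))) / qq)%C; [field; exact Hq|].
    rewrite DZb, EZb'. field. exact Hq. }
  assert (E3 : (e * (wx - Ci * wy))%C = (RtoC 2 * (- (A' * Ab + B' * Bb) / (qq * qq)))%C).
  { transitivity ((e * (wx - Ci * wy) * qq + w * (RtoC 2 * (A' * Ab + B' * Bb)) - w * (RtoC 2 * (A' * Ab + B' * Bb))) / qq)%C; [field; exact Hq|].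
    rewrite DW, EW'. field. exact Hq. }
  assert (Alg := bryant_algebra A B C0 D A' B' C' D' Ab Bb Cb Db a b c Hdet Detc Hdd Hq).
  cbv zeta in Alg. fold qq in Alg. rewrite <- Alg.
  transitivity (/ RtoC 2 * (a * (e * (Zx - Ci * Zy)) - (e * (Zxb - Ci * Zyb)) * (a * Z * Z + b * Z + c) * (/ w * / w)
     - (e * (wx - Ci * wy)) * / w * (RtoC 2 * a * Z + b)))%C; [ring|].
  rewrite E1, E2, E3, EW', EZ'.
  assert (H2 : RtoC 2 <> 0%C) by (apply RtoC_nz; lra).
  field. repeat split; first [exact Hq | exact H2 | idtac].
Qed.

(** The surface is of class C2, so this combination of the entries of F' F^-1 is of class C1,
    although F' itself is not known to be continuous so far. *)
Lemma cover_form_C1 a b c : C1c T (cover_form a b c).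
Proof.
  assert (HS := end_open Om X HX).
  destruct (comp_cexp_C1c _ _ HS (surface_form_C1 Om X a b c HX) cover_open) as [H _].
  assert (He : C1c T cexp).
  { destruct (comp_cexp_C1 _ _ HS (C1_Re _ HS) cover_open) as [H1 _].
    destruct (comp_cexp_C1 _ _ HS (C1_Im _ HS) cover_open) as [H2 _]. split; assumption. }
  apply (C1c_ext T cover_open (fun s => surface_form a b c X (cexp s) * cexp s)%C).
  - intros s Hs. now apply surface_form_cover.
  - apply (C1c_mult T cover_open); assumption.
Qed.

Lemma holomorphic_linear_system (f g f' m n : C -> C) :
  (forall s, T s -> Cderiv f s (f' s)) -> (forall s, T s -> continuous g s) ->
  C1c T m -> C1c T n -> (forall s, T s -> (m s * f s + n s * g s)%C = f' s) -> holomorphic_on T f.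
Proof.
  intros Hf Hg Hm Hn E. apply (holomorphic_of_derivative T cover_open f f' Hf).
  intros s Hs.
  apply continuous_ext_loc with (fun s => m s * f s + n s * g s)%C.
  - apply filter_imp with T; [exact E|]. apply cover_open. exact Hs.
  - apply continuous_Cplus; apply continuous_Cmult.
    + now apply (C1c_continuous T cover_open m).
    + apply Cderiv_continuous with (f' s). now apply Hf.
    + now apply (C1c_continuous T cover_open n).
    + now apply Hg.
Qed.

(** The four entries of F' = (F' F^-1) F; the lower ones use that the trace of F' F^-1 is zero. *)
Lemma F_equations s : T s ->
  ((cover_form 0 1 0 s * FA s + - cover_form 0 0 1 s * FC s)%C = dA s /\
   (cover_form 0 1 0 s * FB s + - cover_form 0 0 1 s * FD s)%C = dB s) /\
  ((- cover_form 0 1 0 s * FC s + cover_form 1 0 0 s * FA s)%C = dC s /\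
   (- cover_form 0 1 0 s * FD s + cover_form 1 0 0 s * FB s)%C = dD s).
Proof.
  intros Hs. assert (H := F_det s Hs). assert (Hd := F_det_derivative s Hs).
  unfold cover_form. split; split.
  - transitivity (dA s * (FA s * FD s - FB s * FC s))%C; [ring|rewrite H; ring].
  - transitivity (dB s * (FA s * FD s - FB s * FC s))%C; [ring|rewrite H; ring].
  - transitivity (dC s * (FA s * FD s - FB s * FC s)
      - FC s * (dA s * FD s + FA s * dD s - dB s * FC s - FB s * dC s))%C; [ring|rewrite H, Hd; ring].
  - transitivity (dD s * (FA s * FD s - FB s * FC s)
      - FD s * (dA s * FD s + FA s * dD s - dB s * FC s - FB s * dC s))%C; [ring|rewrite H, Hd; ring].
Qed.

(** In F' = (F' F^-1) F the matrix F' F^-1 is of class C1.  As F is continuous, F' is continuous;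
    so F is of class C1, and then F' is of class C1, hence holomorphic. *)
Lemma F_holomorphic : ((holomorphic_on T FA /\ holomorphic_on T FB) /\ (holomorphic_on T FC /\ holomorphic_on T FD)) /\
  ((holomorphic_on T dA /\ holomorphic_on T dB) /\ (holomorphic_on T dC /\ holomorphic_on T dD)).
Proof.
  assert (M1 := cover_form_C1 0 1 0). assert (M2 := C1c_opp T cover_open _ (cover_form_C1 0 0 1)).
  assert (M3 := C1c_opp T cover_open _ M1). assert (M4 := cover_form_C1 1 0 0).
  assert (Cont : (forall s, T s -> continuous FA s) /\ (forall s, T s -> continuous FB s) /\
     (forall s, T s -> continuous FC s) /\ (forall s, T s -> continuous FD s)).
  { repeat split; intros s Hs; destruct (F_deriv s Hs) as (H1 & H2 & H3 & H4);
      eapply Cderiv_continuous; eassumption. }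
  destruct Cont as (CA & CB & CC & CD).
  assert (HA : holomorphic_on T FA).
  { apply (holomorphic_linear_system FA FC dA _ _ (fun s Hs => proj1 (F_deriv s Hs)) CC M1 M2). intros; now apply F_equations. }
  assert (HB : holomorphic_on T FB).
  { apply (holomorphic_linear_system FB FD dB _ _ (fun s Hs => proj1 (proj2 (F_deriv s Hs))) CD M1 M2). intros; now apply F_equations. }
  assert (HC : holomorphic_on T FC).
  { apply (holomorphic_linear_system FC FA dC _ _ (fun s Hs => proj1 (proj2 (proj2 (F_deriv s Hs)))) CA M3 M4). intros; now apply F_equations. }
  assert (HD : holomorphic_on T FD).
  { apply (holomorphic_linear_system FD FB dD _ _ (fun s Hs => proj2 (proj2 (proj2 (F_deriv s Hs)))) CB M3 M4). intros; now apply F_equations. }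
  assert (D1 : forall f g m n f', holomorphic_on T f -> holomorphic_on T g -> C1c T m -> C1c T n ->
     (forall s, T s -> (m s * f s + n s * g s)%C = f' s) -> C1c T f').
  { intros f g m n f' [Hf _] [Hg _] Hm Hn E. apply (C1c_ext T cover_open _ _ E).
    apply (C1c_plus T cover_open); now apply (C1c_mult T cover_open). }
  split; [now split|]. split; split.
  - apply (holomorphic_derivative T cover_open FA _ (fun s Hs => proj1 (F_deriv s Hs))).
    apply (D1 _ _ _ _ _ HA HC M1 M2). intros; now apply F_equations.
  - apply (holomorphic_derivative T cover_open FB _ (fun s Hs => proj1 (proj2 (F_deriv s Hs)))).
    apply (D1 _ _ _ _ _ HB HD M1 M2). intros; now apply F_equations.
  - apply (holomorphic_derivative T cover_open FC _ (fun s Hs => proj1 (proj2 (proj2 (F_deriv s Hs))))).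
    apply (D1 _ _ _ _ _ HC HA M3 M4). intros; now apply F_equations.
  - apply (holomorphic_derivative T cover_open FD _ (fun s Hs => proj2 (proj2 (proj2 (F_deriv s Hs))))).
    apply (D1 _ _ _ _ _ HD HB M3 M4). intros; now apply F_equations.
Qed.

Lemma cover_form_holomorphic a b c : holomorphic_on T (cover_form a b c).
Proof.
  destruct F_holomorphic as [[[HA HB] [HC HD]] [[HA' HB'] [HC' HD']]].
  assert (HT := cover_open).
  apply (holomorphic_plus T HT); [apply (holomorphic_plus T HT)|]; (apply (holomorphic_mult T HT); [apply (holomorphic_const T HT)|]);
    apply (holomorphic_minus T HT); apply (holomorphic_mult T HT); assumption.
Qed.

Lemma surface_form_holomorphic a b c : holomorphic_on (punctured Om) (surface_form a b c X).
Proof.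
  split; [apply (surface_form_C1 Om X a b c HX)|].
  intros z Hz. destruct (cexp_surj z (proj2 Hz)) as [s <-].
  apply (cauchy_riemann_descend (punctured Om)); auto.
  - apply (end_open Om X HX).
  - apply (surface_form_C1 Om X a b c HX).
  - apply cover_open.
  - apply (holomorphic_ext T cover_open (cover_form a b c)); [|apply cover_form_holomorphic].
    intros u Hu. symmetry. now apply surface_form_cover.
Qed.

(** The Cauchy-Riemann equations for n say that n dz is closed. *)
Lemma surface_form_exact a b c :
  locally_exact (punctured Om) (fun z => Im (surface_form a b c X z)) (fun z => Re (surface_form a b c X z)).
Proof.
  destruct (surface_form_holomorphic a b c) as [[H1 H2] H].
  apply closed_locally_exact; auto; [apply (end_open Om X HX)|].
  intros z Hz. specialize (H z Hz). apply (f_equal Im) in H.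
  change (Im (cdy (surface_form a b c X) z)) with (dy (fun z => Im (surface_form a b c X z)) z) in H.
  rewrite H. unfold cdx, Im, Re; simpl. ring.
Qed.

Section Circle.
Variables (r : R) (Hr : 0 < r) (Hdisc : forall z : C, Cmod z <= r -> Om z).

Lemma circle_domain th : T (ln r, th).
Proof.
  apply cover_domain, Hdisc. rewrite Cmod_cexp. simpl. rewrite exp_ln; lra.
Qed.

Lemma cover_continuous a b c th :
  continuous (fun th => Re (cover_form a b c (ln r, th))) th /\
  continuous (fun th => Im (cover_form a b c (ln r, th))) th.
Proof.
  assert (K : continuous (fun th : R => cover_form a b c (ln r, th)) th).
  { apply (continuous_comp (fun th : R => (ln r, th) : C) (cover_form a b c)).
    - apply continuous_pair; [apply continuous_const|apply continuous_id].
    - apply (C1c_continuous T cover_open); [apply cover_form_C1|apply circle_domain]. }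
  split; [apply (continuous_comp _ Re _ K (continuous_Re _)) | apply (continuous_comp _ Im _ K (continuous_Im _))].
Qed.

(** On the lift s = ln r + i theta of the circle, dz is i exp s dtheta. *)
Lemma circle_surface_integral a b c :
  RInt (form_along (fun z => Im (surface_form a b c X z)) (fun z => Re (surface_form a b c X z)) (circle r)) 0 1 =
  RInt (fun th => Re (cover_form a b c (ln r, th))) 0 (2 * PI).
Proof.
  destruct (C1_circle r) as [_ V].
  set (F := fun th => Re (cover_form a b c (ln r, th))).
  assert (CF : forall th, continuous F th) by (intros th; exact (proj1 (cover_continuous a b c th))).
  assert (K := RInt_comp_lin (V := R_CompleteNormedModule) F (2 * PI) 0 0 1).
  rewrite Rmult_0_r, Rmult_1_r, !Rplus_0_r in K.
  rewrite <- K by (apply (ex_RInt_continuous (V := R_CompleteNormedModule)); intros; apply CF).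
  apply RInt_ext. intros t _. rewrite Rplus_0_r. unfold F, form_along.
  rewrite <- surface_form_cover by apply circle_domain.
  rewrite <- circle_cexp by exact Hr.
  change (Derive (fun t => Re (circle r t)) t) with (Re (path_velocity (circle r) t)).
  change (Derive (fun t => Im (circle r t)) t) with (Im (path_velocity (circle r) t)).
  rewrite V. generalize (surface_form a b c X (circle r t)). intros u.
  unfold circle, scal; simpl; unfold mult; simpl. unfold Re, Im; simpl. ring.
Qed.

Let J (h : C -> C) : C :=
  (RInt (fun th => Re (h (ln r, th))) 0 (2 * PI), RInt (fun th => Im (h (ln r, th))) 0 (2 * PI)).

Lemma residue_J h :
  (forall th, continuous (fun th => Re (h (ln r, th))) th) ->
  (forall th, continuous (fun th => Im (h (ln r, th))) th) ->
  (RtoC (4 * PI) * residue r h)%C = (RtoC 2 * J h)%C.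
Proof.
  intros HR HI. unfold residue. cbv zeta. assert (P := PI_RGT_0).
  assert (E : (RInt (fun t => Re (h (ln r, t) * Ci)%C) 0 (2 * PI),
               RInt (fun t => Im (h (ln r, t) * Ci)%C) 0 (2 * PI)) = (Ci * J h)%C).
  { unfold J. apply injective_projections; simpl.
    - rewrite (RInt_ext _ (fun t => opp (Im (h (ln r, t))))).
      2:{ intros t _. unfold opp; simpl. unfold Re, Im; simpl. ring. }
      etransitivity; [apply (RInt_opp (V := R_CompleteNormedModule) (fun t => Im (h (ln r, t))));
        apply (ex_RInt_continuous (V := R_CompleteNormedModule)); intros; apply HI|].
      unfold opp; simpl.
      match goal with |- ?u = ?v => change (@eq R u v) end. ring.
    - rewrite (RInt_ext _ (fun t => Re (h (ln r, t)))).
      2:{ intros t _. unfold Re, Im; simpl. ring. }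
      assert (Q : forall x y : R, x = 0 * y + 1 * x) by (intros; ring). apply Q. }
  rewrite E. rewrite !RtoC_mult.
  assert (N1 : RtoC 2 <> 0%C) by (apply RtoC_nz; lra).
  assert (N2 : RtoC PI <> 0%C) by (apply RtoC_nz; lra).
  assert (N3 : Ci <> 0%C) by (intros E0; apply (f_equal Im) in E0; simpl in E0; lra).
  replace (RtoC 4) with (RtoC 2 * RtoC 2)%C by (rewrite <- RtoC_mult; f_equal; ring).
  field. repeat split; assumption.
Qed.

Lemma J_linear a b c : J (cover_form a b c) =
  (a * J (cover_form 1 0 0) + b * J (cover_form 0 1 0) + c * J (cover_form 0 0 1))%C.
Proof.
  set (h1 := cover_form 1 0 0). set (h2 := cover_form 0 1 0). set (h3 := cover_form 0 0 1).
  assert (I : forall a b c, is_RInt (fun th => Re (cover_form a b c (ln r, th))) 0 (2 * PI) (Re (J (cover_form a b c))) /\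
                            is_RInt (fun th => Im (cover_form a b c (ln r, th))) 0 (2 * PI) (Im (J (cover_form a b c)))).
  { intros a' b' c'. split; apply (RInt_correct (V := R_CompleteNormedModule)); apply (ex_RInt_continuous (V := R_CompleteNormedModule)); intros th _.
    - exact (proj1 (cover_continuous a' b' c' th)).
    - exact (proj2 (cover_continuous a' b' c' th)). }
  destruct (I 1%C 0%C 0%C) as [R1 I1]. destruct (I 0%C 1%C 0%C) as [R2 I2]. destruct (I 0%C 0%C 1%C) as [R3 I3].
  fold h1 in R1, I1. fold h2 in R2, I2. fold h3 in R3, I3.
  assert (K : forall z h, is_RInt (fun th => Re (h (ln r, th))) 0 (2 * PI) (Re (J h)) ->
     is_RInt (fun th => Im (h (ln r, th))) 0 (2 * PI) (Im (J h)) ->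
     is_RInt (fun th => Re (z * h (ln r, th))%C) 0 (2 * PI) (Re (z * J h)%C) /\
     is_RInt (fun th => Im (z * h (ln r, th))%C) 0 (2 * PI) (Im (z * J h)%C)).
  { intros z h HR HI. split.
    - apply (is_RInt_minus (V := R_NormedModule) (fun th => scal (Re z) (Re (h (ln r, th)))) (fun th => scal (Im z) (Im (h (ln r, th))))).
      + now apply (is_RInt_scal (V := R_NormedModule) (fun th => Re (h (ln r, th)))).
      + now apply (is_RInt_scal (V := R_NormedModule) (fun th => Im (h (ln r, th)))).
    - apply (is_RInt_plus (V := R_NormedModule) (fun th => scal (Re z) (Im (h (ln r, th)))) (fun th => scal (Im z) (Re (h (ln r, th))))).
      + now apply (is_RInt_scal (V := R_NormedModule) (fun th => Im (h (ln r, th)))).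
      + now apply (is_RInt_scal (V := R_NormedModule) (fun th => Re (h (ln r, th)))). }
  destruct (K a h1 R1 I1) as [K1 L1]. destruct (K b h2 R2 I2) as [K2 L2]. destruct (K c h3 R3 I3) as [K3 L3].
  assert (S1 := is_RInt_plus _ _ _ _ _ _ (is_RInt_plus _ _ _ _ _ _ K1 K2) K3).
  assert (S2 := is_RInt_plus _ _ _ _ _ _ (is_RInt_plus _ _ _ _ _ _ L1 L2) L3).
  assert (E : forall t, cover_form a b c (ln r, t) = (a * h1 (ln r, t) + b * h2 (ln r, t) + c * h3 (ln r, t))%C).
  { intros t. unfold h1, h2, h3, cover_form. ring. }
  apply injective_projections.
  - change (RInt (fun th => Re (cover_form a b c (ln r, th))) 0 (2 * PI) =
      Re (a * J h1 + b * J h2 + c * J h3)%C).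
    transitivity (RInt (fun x => plus (plus (Re (a * h1 (ln r, x))%C) (Re (b * h2 (ln r, x))%C)) (Re (c * h3 (ln r, x))%C)) 0 (2 * PI)).
    + apply RInt_ext. intros t _. rewrite E. reflexivity.
    + etransitivity; [exact (is_RInt_unique (V := R_CompleteNormedModule) _ _ _ _ S1)|]. reflexivity.
  - change (RInt (fun th => Im (cover_form a b c (ln r, th))) 0 (2 * PI) =
      Im (a * J h1 + b * J h2 + c * J h3)%C).
    transitivity (RInt (fun x => plus (plus (Im (a * h1 (ln r, x))%C) (Im (b * h2 (ln r, x))%C)) (Im (c * h3 (ln r, x))%C)) 0 (2 * PI)).
    + apply RInt_ext. intros t _. rewrite E. reflexivity.
    + etransitivity; [exact (is_RInt_unique (V := R_CompleteNormedModule) _ _ _ _ S2)|]. reflexivity.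
Qed.
End Circle.
End Bryant.

Theorem theorem1 (Om : C -> Prop) (X : C -> point) (FA FB FC FD : C -> C)
    (r : R) (P Q : sphere) (Y : point -> point) (phi : R) :
  bryant_end Om X ->
  bryant_representation Om X FA FB FC FD ->
  0 < r -> (forall z : C, Cmod z <= r -> Om z) ->
  P <> Q ->
  translation_killing_field P Q Y ->
  is_flux Om X Y phi ->
  let phi0 := (RtoC (4 * PI) *
    residue r (fun s => FD s * C_derive FC s - FC s * C_derive FD s))%C in
  let phi1 := (RtoC (4 * PI) *
    residue r (fun s => FC s * C_derive FB s - FD s * C_derive FA s))%C in
  let phi2 := (RtoC (4 * PI) *
    residue r (fun s => FB s * C_derive FA s - FA s * C_derive FB s))%C in
  phi = Re (flux_fraction phi0 phi1 phi2 P Q).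
Proof.
  intros HX HF Hr Hdisc _ HY Hflux phi0 phi1 phi2.
  destruct (killing_formula P Q Y HY) as (a & b & c & HYk & Hfrac).
  destruct (flux_loop_integral Om X a b c HX Y phi HYk Hflux) as (g & HL & Hside & ->).
  assert (HO : open Om) by apply HX.
  rewrite (loop_integral Om g r HO Hr Hdisc HL Hside).
  2:{ intros z Hz. apply (C1_continuous (punctured Om) (fun z => Im (surface_form a b c X z))); auto.
      - apply (end_open Om X HX).
      - apply (surface_form_C1 Om X a b c HX). }
  2:{ intros z Hz. apply (C1_continuous (punctured Om) (fun z => Re (surface_form a b c X z))); auto.
      - apply (end_open Om X HX).
      - apply (surface_form_C1 Om X a b c HX). }
  2:{ now apply (surface_form_exact Om X FA FB FC FD HX HF). }
  rewrite (circle_surface_integral Om X FA FB FC FD HX HF r Hr Hdisc).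
  assert (Ccov := cover_continuous Om X FA FB FC FD HX HF r Hr Hdisc).
  set (cov := cover_form FA FB FC FD) in *.
  set (J := fun h : C -> C => (RInt (fun th => Re (h (ln r, th))) 0 (2 * PI),
     RInt (fun th => Im (h (ln r, th))) 0 (2 * PI)) : C).
  assert (E0 : phi0 = (RtoC 2 * J (cov 1 0 0))%C).
  { etransitivity; [|exact (residue_J r (cov 1 0 0)%C (fun th => proj1 (Ccov _ _ _ th)) (fun th => proj2 (Ccov _ _ _ th)))].
    unfold phi0. f_equal. f_equal. apply functional_extensionality. intros s. unfold cov, cover_form. ring. }
  assert (E1 : phi1 = (RtoC 2 * J (cov 0 (- (1)) 0))%C).
  { etransitivity; [|exact (residue_J r (cov 0 (- (1)) 0)%C (fun th => proj1 (Ccov _ _ _ th)) (fun th => proj2 (Ccov _ _ _ th)))].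
    unfold phi1. f_equal. f_equal. apply functional_extensionality. intros s. unfold cov, cover_form. ring. }
  assert (E2 : phi2 = (RtoC 2 * J (cov 0 0 1))%C).
  { etransitivity; [|exact (residue_J r (cov 0 0 1)%C (fun th => proj1 (Ccov _ _ _ th)) (fun th => proj2 (Ccov _ _ _ th)))].
    unfold phi2. f_equal. f_equal. apply functional_extensionality. intros s. unfold cov, cover_form. ring. }
  assert (Lin := J_linear Om X FA FB FC FD HX HF r Hr Hdisc).
  change (forall a b c : C, J (cov a b c) =
    (a * J (cov 1 0 0) + b * J (cov 0 1 0) + c * J (cov 0 0 1))%C) in Lin.
  change (RInt (fun th => Re (cov a b c (ln r, th))) 0 (2 * PI)) with (Re (J (cov a b c))).
  rewrite Hfrac, E0, E1, E2, (Lin a b c), (Lin 0 (- (1)) 0)%C.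
  generalize (J (cov 1 0 0)%C) (J (cov 0 1 0)%C) (J (cov 0 0 1)%C). intros j0 j1 j2.
  unfold Re; simpl. ring.
Qed.
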